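(* There is a deterministic algorithm that takes as input an undirected unrooted tree $\mathcal{T}$ with $n$ vertices, $p$ paths $P_1,\dots,P_p$ in $\mathcal{T}$, where $P_i$ is the unique path between vertices $u_i$ and $v_i$ and carries a weight $w_i\in\{0,1,\dots,C\}$, and a positive integer $k$; and that returns, for each edge $e$ of $\mathcal{T}$, the indices of $k$ paths of lowest weight among those containing $e$ (ties broken arbitrarily), or all paths containing $e$ if there are fewer than $k$ of them. Its running time is $\mathcal{O}(nk+p+C)$.
   Context: Computation model: word RAM with $\mathcal{O}(\log n)$-bit words. *)

(* Defs.v *)
From mathcomp Require Import all_boot.

Set Implicit Arguments.
Unset Strict Implicit.
Unset Printing Implicit Defensive.

(* Unit-cost word RAM whose memory cells and registers hold [w]-bit words, i.e.
   naturals below [2 ^ w]; arithmetic wraps around modulo [2 ^ w].  Division by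
   zero yields 0 and the remainder modulo zero is the dividend.  A program
   mentions finitely many registers and is independent of [w]. *)

Inductive binop :=
| Badd | Bsub | Bmul | Bdiv | Bmod
| Band | Bor | Bxor | Bshl | Bshr.

Definition eval_binop (w : nat) (o : binop) (a b : nat) : nat :=
  match o with
  | Badd => (a + b) %% 2 ^ w
  | Bsub => (a + 2 ^ w - b) %% 2 ^ w
  | Bmul => (a * b) %% 2 ^ w
  | Bdiv => a %/ b
  | Bmod => a %% b
  | Band => Nat.land a b
  | Bor  => Nat.lor a b
  | Bxor => Nat.lxor a b
  | Bshl => (a * 2 ^ b) %% 2 ^ w
  | Bshr => a %/ 2 ^ b
  end.

Inductive instr :=
| Const (d x : nat)              (* r[d] := x mod 2^w *)
| Op (o : binop) (d a b : nat)   (* r[d] := r[a] o r[b] *)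
| Read (d a : nat)               (* r[d] := ram[r[a]] *)
| Write (a b : nat)              (* ram[r[a]] := r[b] *)
| Jmp (l : nat)
| Jlt (a b l : nat)              (* if r[a] < r[b] goto l *)
| Jeq (a b l : nat).             (* if r[a] = r[b] goto l *)

Definition program := seq instr.

Record state := State { pc : nat; reg : nat -> nat; ram : nat -> nat }.

Definition upd (f : nat -> nat) (a x : nat) : nat -> nat :=
  fun b => if b == a then x else f b.

Definition exec (w : nat) (i : instr) (s : state) : state :=
  let: State l r m := s in
  match i with
  | Const d x  => State l.+1 (upd r d (x %% 2 ^ w)) m
  | Op o d a b => State l.+1 (upd r d (eval_binop w o (r a) (r b))) m
  | Read d a   => State l.+1 (upd r d (m (r a))) m
  | Write a b  => State l.+1 r (upd m (r a) (r b))
  | Jmp l'     => State l' r m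
  | Jlt a b l' => State (if r a < r b then l' else l.+1) r m
  | Jeq a b l' => State (if r a == r b then l' else l.+1) r m
  end.

(* The machine halts by moving the program counter past the end of the
   program; a halted state is a fixed point of [step]. *)
Definition step (w : nat) (A : program) (s : state) : state :=
  if onth A (pc s) is Some i then exec w i s else s.

Definition halted (A : program) (s : state) : bool := size A <= pc s.

Definition run (w : nat) (A : program) (t : nat) (s : state) : state :=
  iter t (step w A) s.

(* The input occupies the memory from address 0 on; everything else is 0. *)
Definition init (input : seq nat) : state :=
  State 0 (fun=> 0) (nth 0 input).

(* A graph on the vertices ['I_n] is given by the list of its edges, each edge
   occurring once with its endpoints in either order. *)

Section Graphs.
Variable n : nat.
Implicit Types (T : seq ('I_n * 'I_n)) (e : 'I_n * 'I_n).

Definition adj T : rel 'I_n :=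
  [rel x y | ((x, y) \in T) || ((y, x) \in T)].

Definition simple_graph T : Prop :=
  {in T, forall e, e.1 != e.2} /\ uniq [seq [set e.1; e.2] | e <- T].

(* [ucycle] also accepts [:: x; y] for an edge xy, which is not a cycle of the
   graph. *)
Definition acyclic T : Prop :=
  forall s : seq 'I_n, ucycle (adj T) s -> size s < 3.

Definition is_tree T : Prop :=
  [/\ 0 < n, simple_graph T, (forall x y, connect (adj T) x y) & acyclic T].

(* As in [path], the vertices visited are [x :: q]. *)
Definition simple_path T (x y : 'I_n) (q : seq 'I_n) : bool :=
  [&& path (adj T) x q, last x q == y & uniq (x :: q)].

Definition traverses (x : 'I_n) (q : seq 'I_n) e : bool :=
  has (fun d => (d == e) || (d == (e.2, e.1))) (zip (x :: q) q).

End Graphs.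

(* n, p, k, then the endpoints of the n - 1 edges, then (u_i, v_i, wt_i) for
   each path.  Neither the paths themselves nor the weight bound are given. *)
Definition encode (n : nat) (T : seq ('I_n * 'I_n)) (p : nat)
    (u v : 'I_p -> 'I_n) (wt : 'I_p -> nat) (k : nat) : seq nat :=
  [:: n; p; k]
    ++ flatten [seq [:: val e.1; val e.2] | e <- T]
    ++ flatten [seq [:: val (u i); val (v i); wt i] | i <- enum 'I_p].

(* [l] lists, in any order and without repetition, [minn k #|A|] elements of
   [A] of lowest weight. *)
Definition k_lightest (p : nat) (wt : 'I_p -> nat) (k : nat) (A : {set 'I_p})
    (l : seq 'I_p) : Prop :=
  [/\ uniq l, {subset l <= A}, size l = minn k #|A| &
      forall i j, i \in l -> j \in A -> j \notin l -> wt i <= wt j].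

(* The answers form an array of [k.+1]-cell rows whose base address is in
   register 0: row [e] holds the number of indices reported for edge number
   [e], followed by these indices. *)
Definition output_row (k : nat) (s : state) (e : nat) : seq nat :=
  let a := reg s 0 + e * k.+1 in
  [seq ram s (a + j.+1) | j <- iota 0 (ram s a)].

(* Main.v *)
(* The tree is rooted and its vertices are renamed so that parents are larger
   than their children.  The paths are handled by increasing weight.  To insert a
   path, walk from its two ends towards the root, always moving the smaller of the
   two current vertices: it cannot be an ancestor of the other one, so the edge to
   its parent is on the path and the path is added to the row of that edge.  Edges
   with a full row are contracted, so each step but the last costs one of the at
   most [n * k] insertions.  Contracted edges are skipped with the union-find
   structure of Gabow and Tarjan for a fixed tree: microsets of about [log n]
   vertices are bit masks, and the [O (n / log n)] classes of microsets are merged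
   by relabelling the smaller one, which makes all finds [O (1)] amortized.

   The program is written in a small structured language, compiled to the word RAM
   together with its exact running time. *)
Require Import Defs.
From mathcomp Require Import all_boot zify.

Set Implicit Arguments.
Unset Strict Implicit.
Unset Printing Implicit Defensive.

(** * A structured language over the word RAM *)

(** Time is accounted for by credits. Each macro element carries the number of times its class can
    still double, and the sum [phi] of these numbers pays for relabelling the smaller class. There
    are at most [n / b] macro elements and [log n <= 3 * b], so [phi] starts below [3 * n]: this
    product is what the microsets are for. Each insertion into a row earns a fixed credit, which
    pays for one step of the walk and its search. Paths are never handled as lists of vertices. The
    edge from [c] to its parent is on a path exactly if [c] is an ancestor of one end and not of the
    other; this cut criterion serves both the walk invariant and the final specification. On the
    machine, every value of the program stays below [B], a power of two with [2 ^ w = 64 * B]; the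
    six spare bits make room for the addresses of the interleaved arrays. Sums of neighbours, sums
    of edge numbers and table indices are quadratic in the size parameter [N], so [B] has to exceed
    a multiple of [N * N], and [N ^ 16 <= 2 ^ w] leaves ample room for this. *)

(* Array [j] occupies the addresses [D + 32 * i + j]: interleaving makes the
   arrays unbounded and disjoint without any size bookkeeping. *)
Inductive expr :=
| Lit (c : nat)
| Var (x : nat)
| Bin (o : binop) (e1 e2 : expr)
| Ld (j : nat) (e : expr)
| Inp (e : expr)
| Out (e : expr).

Inductive test := Tlt (e1 e2 : expr) | Teq (e1 e2 : expr).

Inductive cmd :=
| Skip
| Set_ (x : nat) (e : expr)
| St (j : nat) (e1 e2 : expr)
| Wr (e1 e2 : expr)
| Seq (a b : cmd)
| If (b : test) (a1 a2 : cmd)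
| While (b : test) (a : cmd).

Definition Tl (b : test) := match b with Tlt e _ | Teq e _ => e end.
Definition Tr (b : test) := match b with Tlt _ e | Teq _ e => e end.

Record st := Mk { vr : nat -> nat; ar : nat -> nat -> nat; ou : nat -> nat }.

Definition setv (s : st) x v :=
  Mk (fun y => if Nat.eqb y x then v else vr s y) (ar s) (ou s).
Definition sta (s : st) j i v :=
  Mk (vr s)
     (fun j' => if Nat.eqb j' j then fun i' => if i' == i then v else ar s j i'
                else ar s j') (ou s).
Definition wro (s : st) i v :=
  Mk (vr s) (ar s) (fun i' => if i' == i then v else ou s i').

(** Expressions compile to straight-line code, so this is both their code size and their running
    time. The 6 of [Ld] is five instructions for the address and one for the access. *)
Fixpoint ce (e : expr) : nat :=
  match e with
  | Lit _ | Var _ => 1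
  | Bin _ a b => ce a + ce b + 1
  | Ld _ a => ce a + 6
  | Inp a => ce a + 1
  | Out a => ce a + 2
  end.

Definition ct b := ce (Tl b) + ce (Tr b).

Section Compile.

(** Registers 0 and 1 hold the base addresses of the output and of the working memory. Parity
    separates the others: temporaries form a stack on the even registers, program variables use the
    odd ones. *)
Definition treg d := 2 * d + 2.
Definition vreg x := 2 * x + 3.

Definition addr j d : seq instr :=
  [:: Const (treg d.+1) 32; Op Bmul (treg d) (treg d) (treg d.+1); Const (treg d.+1) j;
      Op Badd (treg d) (treg d) (treg d.+1); Op Badd (treg d) (treg d) 1].

(** The bitwise and of a register with itself serves as a register move. *)
Fixpoint cexp d (e : expr) : seq instr :=
  match e with
  | Lit c => [:: Const (treg d) c]
  | Var x => [:: Op Band (treg d) (vreg x) (vreg x)]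
  | Bin o a b => cexp d a ++ cexp d.+1 b ++ [:: Op o (treg d) (treg d) (treg d.+1)]
  | Ld j a => cexp d a ++ addr j d ++ [:: Read (treg d) (treg d)]
  | Inp a => cexp d a ++ [:: Read (treg d) (treg d)]
  | Out a => cexp d a ++ [:: Op Badd (treg d) (treg d) 0; Read (treg d) (treg d)]
  end.

Definition ctest (b : test) l : seq instr :=
  cexp 0 (Tl b) ++ cexp 1 (Tr b) ++
  [:: match b with Tlt _ _ => Jlt (treg 0) (treg 1) l | Teq _ _ => Jeq (treg 0) (treg 1) l end].

Fixpoint csize (c : cmd) : nat :=
  match c with
  | Skip => 0
  | Set_ _ e => (ce e).+1
  | St _ e1 e2 => ce e1 + ce e2 + 6
  | Wr e1 e2 => ce e1 + ce e2 + 2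
  | Seq a b => csize a + csize b
  | If b a1 a2 => ct b + csize a1 + csize a2 + 2
  | While b a => ct b + csize a + 3
  end.

(** Jumps are absolute, hence the address [o] of the code. A jump is taken when its test succeeds,
    so the else branch comes first and a successful loop test skips the jump that leaves the
    loop. *)
Fixpoint compile (o : nat) (c : cmd) : seq instr :=
  match c with
  | Skip => [::]
  | Set_ x e => cexp 0 e ++ [:: Op Band (vreg x) (treg 0) (treg 0)]
  | St j e1 e2 => cexp 0 e1 ++ addr j 0 ++ cexp 1 e2 ++ [:: Write (treg 0) (treg 1)]
  | Wr e1 e2 =>
      cexp 0 e1 ++ [:: Op Badd (treg 0) (treg 0) 0] ++ cexp 1 e2 ++ [:: Write (treg 0) (treg 1)]
  | Seq a b => compile o a ++ compile (o + csize a) b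
  | If b a1 a2 =>
      ctest b (o + ct b + csize a2 + 2) ++ compile (o + ct b + 1) a2 ++
      [:: Jmp (o + csize c)] ++ compile (o + ct b + csize a2 + 2) a1
  | While b a =>
      ctest b (o + ct b + 2) ++ [:: Jmp (o + csize c)] ++
      compile (o + ct b + 2) a ++ [:: Jmp o]
  end.

Lemma size_cexp e d : size (cexp d e) = ce e.
Proof.
by elim: e d => //= [o a IHa b IHb|j a IH|a IH|a IH] d;
  rewrite !size_cat /= ?IHa ?IHb ?IH //; lia.
Qed.

Lemma size_compile c o : size (compile o c) = csize c.
Proof.
elim: c o => //= [x e|j a b|a b|a IHa b IHb|b a IHa c IHc|b a IHa] o;
  rewrite /ctest ?size_cat /= ?size_cat /= ?IHa ?IHb ?IHc ?size_cexp /ct /=; lia.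
Qed.

End Compile.

(** * Bounds on bitwise operations *)

Lemma land_le a b : Nat.land a b <= a.
Proof. by apply/leP; apply: PeanoNat.Nat.land_le_l. Qed.

Lemma bits_lt a n : (forall i, n <= i -> Nat.testbit a i = false) -> a < 2 ^ n.
Proof.
move=> H; case: (posnP a) => [->|a0]; first by rewrite expn_gt0.
have a00 : a <> 0 by lia.
have h := PeanoNat.Nat.bit_log2 a a00.
rewrite ltnNge; apply/negP => hn.
have : n <= Nat.log2 a.
  have [_ lt] := PeanoNat.Nat.log2_spec a (proj1 (PeanoNat.Nat.neq_0_lt_0 a) a00).
  rewrite leqNgt; apply/negP => hl.
  have : 2 ^ (Nat.log2 a).+1 <= 2 ^ n by rewrite leq_exp2l.
  have -> : 2 ^ (Nat.log2 a).+1 = Nat.pow 2 (Nat.log2 a).+1.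
    by elim: (Nat.log2 a).+1 => // k; rewrite expnS => ->.
  lia.
by move=> /H; rewrite h.
Qed.

Lemma pow_nat k : Nat.pow 2 k = 2 ^ k.
Proof. by elim: k => // k IH; rewrite expnS -IH. Qed.

Lemma lt_bits a n i : a < 2 ^ n -> n <= i -> Nat.testbit a i = false.
Proof.
move=> h hi; case: (posnP a) => [->|a0]; first by rewrite PeanoNat.Nat.bits_0.
apply: PeanoNat.Nat.bits_above_log2; apply/ltP; apply: leq_trans hi.
apply/ltP/PeanoNat.Nat.log2_lt_pow2; first by lia.
by rewrite pow_nat; lia.
Qed.

(** A disjunction can exceed both operands, but not a power of two above them. This is why the bound
    [B] on all values is chosen to be a power of two. *)
Lemma lor_lt a b n : a < 2 ^ n -> b < 2 ^ n -> Nat.lor a b < 2 ^ n.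
Proof.
move=> ha hb; apply: bits_lt => i hi.
by rewrite PeanoNat.Nat.lor_spec (lt_bits ha) ?(lt_bits hb).
Qed.

Lemma lxor_lt a b n : a < 2 ^ n -> b < 2 ^ n -> Nat.lxor a b < 2 ^ n.
Proof.
move=> ha hb; apply: bits_lt => i hi.
by rewrite PeanoNat.Nat.lxor_spec (lt_bits ha) ?(lt_bits hb).
Qed.

(** * Semantics of the language and correctness of the compiler *)

Section Semantics.

(* [B] bounds all values, [L] is the size of the input, and [OS] that of the
   output array. *)
Variables (B L OS : nat) (inp : nat -> nat).

(** Arithmetic is exact here: [eok] excludes overflow and negative differences, so proofs about
    programs never meet the modulus. *)
Fixpoint ev (s : st) (e : expr) : nat :=
  match e with
  | Lit c => c
  | Var x => vr s x
  | Bin o a b =>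
      match o with
      | Badd => ev s a + ev s b
      | Bsub => ev s a - ev s b
      | Bmul => ev s a * ev s b
      | Bshl => ev s a * 2 ^ ev s b
      | Bdiv => ev s a %/ ev s b
      | Bmod => ev s a %% ev s b
      | Band => Nat.land (ev s a) (ev s b)
      | Bor  => Nat.lor (ev s a) (ev s b)
      | Bxor => Nat.lxor (ev s a) (ev s b)
      | Bshr => ev s a %/ 2 ^ ev s b
      end
  | Ld j a => ar s j (ev s a)
  | Inp a => inp (ev s a)
  | Out a => ou s (ev s a)
  end.

Definition evt s b :=
  match b with
  | Tlt e1 e2 => ev s e1 < ev s e2
  | Teq e1 e2 => ev s e1 == ev s e2
  end.

Definition okop o x y : Prop :=
  match o with
  | Badd => x + y < B
  | Bsub => y <= x
  | Bmul => x * y < B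
  | Bshl => x * 2 ^ y < B
  | _ => True
  end.

(* No operation overflows and no access leaves its array. *)
Fixpoint eok (s : st) (e : expr) : Prop :=
  match e with
  | Lit c => c < B
  | Var x => True
  | Bin o a b => [/\ eok s a, eok s b & okop o (ev s a) (ev s b)]
  | Ld j a => eok s a /\ j < 32
  | Inp a => eok s a /\ ev s a < L
  | Out a => eok s a /\ ev s a < OS
  end.

(** The number is the exact count of machine steps. In the rules for tests, the constants count the
    conditional jump and, where one is executed, the unconditional jump. *)
Inductive bs : cmd -> st -> nat -> st -> Prop :=
| bs_skip s : bs Skip s 0 s
| bs_set s x e : eok s e -> bs (Set_ x e) s (ce e).+1 (setv s x (ev s e))
| bs_st s j a b : eok s a -> eok s b -> j < 32 ->
    bs (St j a b) s (ce a + ce b + 6) (sta s j (ev s a) (ev s b))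
| bs_wr s a b : eok s a -> eok s b -> ev s a < OS ->
    bs (Wr a b) s (ce a + ce b + 2) (wro s (ev s a) (ev s b))
| bs_seq s1 s2 s3 a b t1 t2 : bs a s1 t1 s2 -> bs b s2 t2 s3 ->
    bs (Seq a b) s1 (t1 + t2) s3
| bs_ift s s' b a1 a2 t : eok s (Tl b) -> eok s (Tr b) -> evt s b ->
    bs a1 s t s' -> bs (If b a1 a2) s (ct b + 1 + t) s'
| bs_iff s s' b a1 a2 t : eok s (Tl b) -> eok s (Tr b) -> ~~ evt s b ->
    bs a2 s t s' -> bs (If b a1 a2) s (ct b + 2 + t) s'
| bs_whf s b a : eok s (Tl b) -> eok s (Tr b) -> ~~ evt s b ->
    bs (While b a) s (ct b + 2) s
| bs_wht s s' s'' b a t t' : eok s (Tl b) -> eok s (Tr b) -> evt s b ->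
    bs a s t s' -> bs (While b a) s' t' s'' ->
    bs (While b a) s (ct b + 2 + t + t') s''.

#[local] Arguments run : simpl never.

Section Simulation.

Variables (w D : nat) (A : program).
(** An address [D + 32 * i + j] has [D <= 32 * B] and [32 * i + j < 32 * B], so six bits beyond
    those of a value suffice. *)
Hypothesis w6 : 2 ^ w = 64 * B.
Hypothesis wB : exists m, B = 2 ^ m.
Hypothesis DE : D = L + OS.
Hypothesis DB : D <= 32 * B.

Definition wf s := [/\ forall x, vr s x < B, forall j i, ar s j i < B &
  forall i, ou s i < B].

Hypothesis inpB : forall i, inp i < B.

Definition represents (s : st) (r m : nat -> nat) : Prop :=
  [/\ forall x, r (vreg x) = vr s x, r 0 = L, r 1 = D &
   [/\ forall j i, j < 32 -> i < B -> m (D + 32 * i + j) = ar s j i,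
       forall i, i < OS -> m (L + i) = ou s i &
       forall i, i < L -> m i = inp i]].

Definition code_at o (c : seq instr) := forall i, i < size c -> onth A (o + i) = onth c i.

Lemma code_cat o c1 c2 : code_at o (c1 ++ c2) ->
  code_at o c1 /\ code_at (o + size c1) c2.
Proof.
move=> H; split=> i Hi.
  by rewrite H ?size_cat ?onth_cat ?Hi //; lia.
rewrite -addnA H ?size_cat ?onth_cat; last by lia.
by rewrite ltnNge leq_addr /= addKn.
Qed.

Lemma code_cons o i c : code_at o (i :: c) -> onth A o = Some i /\ code_at o.+1 c.
Proof.
move=> H; split; first by rewrite -[o]addn0 H.
by move=> j Hj; rewrite addSnnS H.
Qed.

Lemma runS i o r m t : onth A o = Some i ->
  run w A t.+1 (State o r m) = run w A t (exec w i (State o r m)).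
Proof. by move=> H; rewrite /run iterSr /step /= H. Qed.

Lemma run1 i o r m : onth A o = Some i ->
  run w A 1 (State o r m) = exec w i (State o r m).
Proof. exact: runS. Qed.

Lemma pc_eq a b r m : a = b -> State a r m = State b r m.
Proof. by move->. Qed.

Lemma runD t1 t2 s : run w A (t1 + t2) s = run w A t2 (run w A t1 s).
Proof. by rewrite addnC /run iterD. Qed.

Lemma ev_lt s e : wf s -> eok s e -> ev s e < B.
Proof.
move=> [w1 w2 w3]; elim: e => //= o a IHa b IHb [/IHa ha /IHb hb]; case: wB ha hb => k Bk.
case: o => //= ha hb h;
  try by [apply: leq_ltn_trans ha; rewrite ?leq_div ?leq_mod ?land_le; lia].
- by rewrite Bk; apply: lor_lt; rewrite -Bk.
- by rewrite Bk; apply: lxor_lt; rewrite -Bk.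
Qed.

Lemma Veq_T d x : (vreg x == treg d) = false. Proof. rewrite /treg /vreg; lia. Qed.
Lemma V0 x : (vreg x == 0) = false. Proof. rewrite /vreg; lia. Qed.
Lemma V1 x : (vreg x == 1) = false. Proof. rewrite /vreg; lia. Qed.

Lemma small x : x < B -> x %% 2 ^ w = x.
Proof. by move=> h; rewrite modn_small // w6; lia. Qed.

(** The shallower temporaries contain pending left operands, which the evaluation of a right operand
    must preserve. *)
Definition keep d (r r' : nat -> nat) := forall d', d' < d -> r' (treg d') = r (treg d').

Lemma rel_upd s r m d x : represents s r m -> represents s (upd r (treg d) x) m.
Proof.
move=> [h1 h2 h3 h4]; split=> // [y||]; rewrite /upd.
- by rewrite Veq_T.
- by have -> : (0 == treg d) = false by rewrite /treg; lia.
- by have -> : (1 == treg d) = false by rewrite /treg; lia.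
Qed.

Lemma updE r d x : upd r d x d = x. Proof. by rewrite /upd eqxx. Qed.

Lemma updN r d d' x : d' != d -> upd r (treg d) x (treg d') = r (treg d').
Proof. by move=> h; rewrite /upd ifN // /treg; lia. Qed.

Lemma upd1 r d x : upd r (treg d) x 1 = r 1.
Proof. by rewrite /upd ifN // /treg; lia. Qed.

Lemma addr_ok s j d o r m i : represents s r m -> r (treg d) = i -> i < B -> j < 32 ->
  code_at o (addr j d) ->
  exists r', [/\ run w A 5 (State o r m) = State (o + 5) r' m, represents s r' m,
     r' (treg d) = D + 32 * i + j & keep d r r'].
Proof.
move=> R ri iB j32 /code_cons[c1 /code_cons[c2 /code_cons[c3 /code_cons[c4 /code_cons[c5 _]]]]].
rewrite (runS _ _ _ c1) /= (runS _ _ _ c2) /= (runS _ _ _ c3) /= (runS _ _ _ c4) /= (runS _ _ _ c5) /=.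
eexists; split.
- by rewrite -!addSnnS addn0.
- by do !apply: rel_upd.
- rewrite !(updE, upd1, updN, ri) //; try lia.
  case: R => _ _ -> _.
  have B32 : 32 < 2 ^ w by lia.
  rewrite (modn_small B32) [j %% _]modn_small; last by lia.
  have H1 : i * 32 < 2 ^ w by lia.
  rewrite (modn_small H1).
  have H2 : i * 32 + j < 2 ^ w by lia.
  rewrite (modn_small H2) modn_small; lia.
- by move=> d' hd; rewrite !updN //; lia.
Qed.

Lemma cexp_ok s e : wf s -> eok s e ->
  forall d o r m, represents s r m -> code_at o (cexp d e) ->
  exists r', [/\ run w A (ce e) (State o r m) = State (o + ce e) r' m, represents s r' m,
     r' (treg d) = ev s e & keep d r r'].
Proof.
move=> W; elim: e => [c|x|o a IHa b IHb|j a IH|a IH|a IH] /=.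
- move=> cB d o r m R /code_cons[c1 _].
  rewrite (runS _ _ _ c1) /= small //.
  eexists; split; [by apply: pc_eq; lia | exact: rel_upd | exact: updE |].
  by move=> d' h; rewrite updN //; lia.
- move=> _ d o r m R /code_cons[c1 _].
  rewrite (runS _ _ _ c1) /= PeanoNat.Nat.land_diag.
  eexists; split; [by apply: pc_eq; lia | exact: rel_upd | by rewrite updE; case: R |].
  by move=> d' h; rewrite updN //; lia.
- move=> [oka okb okk] d o' r m R /code_cat[C1 /code_cat[C2 /code_cons[C3 _]]].
  have [r1 [E1 R1 V1' K1]] := IHa oka _ _ _ _ R C1.
  rewrite !size_cexp in C2 C3.
  have [r2 [E2 R2 V2 K2]] := IHb okb _ _ _ _ R1 C2.
  rewrite !runD E1 E2 (runS _ _ _ C3) /=.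
  have ha := ev_lt W oka; have hb := ev_lt W okb.
  eexists; split; [by apply: pc_eq; lia | exact: rel_upd | | ].
    rewrite updE V2 (K2 d) // V1'.
    case: o okk {C3} => //= h; try by rewrite small.
    by rewrite -addnBAC // modnDr small //; lia.
  by move=> d' h; rewrite updN ?K2 ?K1 //; lia.
- move=> [oka j32] d o r m R C.
  have {C} := C : code_at o (cexp d a ++ addr j d ++ [:: Read (treg d) (treg d)]).
  move=> /code_cat[C1 /code_cat[C2 /code_cons[C3 _]]].
  have [r1 [E1 R1 V1' K1]] := IH oka _ _ _ _ R C1.
  rewrite !size_cexp in C2 C3.
  have ha := ev_lt W oka.
  have [r2 [E2 R2 V2 K2]] := addr_ok R1 V1' ha j32 C2.
  rewrite !runD -[6]/(5 + 1) runD E1 E2 (runS _ _ _ C3) /= V2.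
  eexists; split; [by apply: pc_eq; lia | exact: rel_upd | |].
    by rewrite updE; case: R => _ _ _ [->].
  by move=> d' h; rewrite updN ?K2 ?K1 //; lia.
- move=> [oka j32] d o r m R /code_cat[C1 /code_cons[C3 _]].
  have [r1 [E1 R1 V1' K1]] := IH oka _ _ _ _ R C1.
  rewrite !size_cexp in C3.
  rewrite !runD E1 (runS _ _ _ C3) /= V1'.
  eexists; split; [by apply: pc_eq; lia | exact: rel_upd | |].
    by rewrite updE; case: R => _ _ _ [_ _ ->].
  by move=> d' h; rewrite updN ?K1 //; lia.
- move=> [oka j32] d o r m R /code_cat[C1 /code_cons[C2 /code_cons[C3 _]]].
  have [r1 [E1 R1 V1' K1]] := IH oka _ _ _ _ R C1.
  rewrite !size_cexp in C2 C3.
  rewrite !runD E1 (runS _ _ _ C2) /= (runS _ _ _ C3) /= V1' updE.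
  have -> : r1 0 = L by case: R1.
  eexists; split; [by apply: pc_eq; lia | by do !apply: rel_upd | |].
    rewrite updE modn_small; last by lia.
    by case: R => _ _ _ [_ H _]; rewrite addnC H.
  by move=> d' h; rewrite !updN ?K1 //; lia.
Qed.

Lemma ctest_ok s b l : wf s -> eok s (Tl b) -> eok s (Tr b) ->
  forall o r m, represents s r m -> code_at o (ctest b l) ->
  exists r', [/\ run w A (ct b + 1) (State o r m) =
      State (if evt s b then l else o + ct b + 1) r' m & represents s r' m].
Proof.
move=> W ok1 ok2 o r m R /code_cat[C1 /code_cat[C2 /code_cons[C3 _]]].
have [r1 [E1 R1 V1' K1]] := cexp_ok W ok1 R C1.
rewrite !size_cexp in C2 C3.
have [r2 [E2 R2 V2 K2]] := cexp_ok W ok2 R1 C2.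
rewrite /ct !runD E1 E2 (runS _ _ _ C3) /=; exists r2; split=> //.
have {}K2 := K2 0 isT; rewrite V1' in K2.
by case: b {ok1 ok2 C1 C2 C3 E1 E2} V1' V2 K2 => e1 e2 /= V1' V2 K2;
  rewrite V2 K2 !addnA addn1.
Qed.

Lemma wf_setv s x v : wf s -> v < B -> wf (setv s x v).
Proof. by move=> [h1 h2 h3] hv; split=> //= y; case: ifP. Qed.

Lemma wf_sta s j i v : wf s -> v < B -> wf (sta s j i v).
Proof.
by move=> [h1 h2 h3] hv; split=> //= y i'; case: ifP => // _; case: ifP.
Qed.

Lemma wf_wro s i v : wf s -> v < B -> wf (wro s i v).
Proof. by move=> [h1 h2 h3] hv; split=> //= y; case: ifP. Qed.

Lemma bs_wf c s t s' : bs c s t s' -> wf s -> wf s'.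
Proof.
elim=> {c s t s'}; try by auto.
- by move=> s x e h W; apply: wf_setv => //; apply: ev_lt.
- by move=> s j a b h1 h2 _ W; apply: wf_sta => //; apply: ev_lt.
- by move=> s a b h1 h2 _ W; apply: wf_wro => //; apply: ev_lt.
Qed.

Lemma compile_ok c s t s' : bs c s t s' -> wf s -> forall o r m, represents s r m ->
  code_at o (compile o c) ->
  exists r' m', run w A t (State o r m) = State (o + csize c) r' m' /\ represents s' r' m'.
Proof.
elim=> {c s t s'}.
- by move=> s _ o r m R _; exists r, m; rewrite /= addn0.
- move=> s x e ok W o r m R /code_cat[C1 /code_cons[C2 _]].
  have [r1 [E1 R1 V1' K1]] := cexp_ok W ok R C1.
  rewrite size_cexp in C2.
  rewrite -addn1 runD E1 (runS _ _ _ C2) /= PeanoNat.Nat.land_diag V1'.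
  exists (upd r1 (vreg x) (ev s e)), m; split; first by rewrite addnS.
  case: R1 => h1 h2 h3 h4; split=> //=.
  + move=> y; rewrite /upd h1 -(inj_eq (f := vreg)); last by move=> a b; rewrite /vreg; lia.
    by case: eqP => [/(_ =P _)|/eqP]; rewrite /vreg => h; case: PeanoNat.Nat.eqb_spec => //; lia.
  + by rewrite /upd eq_sym V0.
  + by rewrite /upd eq_sym V1.
- move=> s j a b ok1 ok2 j32 W o r m R.
  move=> /code_cat[C1 /code_cat[C2 /code_cat[C3 /code_cons[C4 _]]]].
  have [r1 [E1 R1 V1' K1]] := cexp_ok W ok1 R C1.
  rewrite !size_cexp in C2 C3 C4.
  have aB := ev_lt W ok1.
  have [r2 [E2 R2 V2 K2]] := addr_ok R1 V1' aB j32 C2.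
  have [r3 [E3 R3 V3 K3]] := cexp_ok W ok2 R2 C3.
  rewrite (_ : ce a + ce b + 6 = ce a + (5 + (ce b + 1))); last by lia.
  rewrite !runD E1 E2 E3 (runS _ _ _ C4) /=.
  exists r3, (upd m (r3 (treg 0)) (r3 (treg 1))); split; first by apply: pc_eq; lia.
  case: R3 => h1 h2 h3 [h4 h5 h6]; split=> //; split.
  + move=> j' i hj hi; rewrite /upd /= (K3 0) // V2 V3.
    case: PeanoNat.Nat.eqb_spec => [->|ne].
      have -> : (D + 32 * i + j == D + 32 * ev s a + j) = (i == ev s a).
        by apply/eqP/eqP; lia.
      by case: ifP => // _; exact: h4.
    have -> : (D + 32 * i + j' == D + 32 * ev s a + j) = false.
      by apply/eqP; lia.
    exact: h4.
  + move=> i hi; rewrite /upd (K3 0) // V2 ifN; [exact: h5 | lia].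
  + move=> i hi; rewrite /upd (K3 0) // V2 ifN; [exact: h6 | lia].
- move=> s a b ok1 ok2 hO W o r m R.
  move=> /code_cat[C1 /code_cons[C2 /code_cat[C3 /code_cons[C4 _]]]].
  have [r1 [E1 R1 V1' K1]] := cexp_ok W ok1 R C1.
  rewrite !size_cexp in C2 C3 C4.
  have aB := ev_lt W ok1.
  have R2 := rel_upd 0 (eval_binop w Badd (r1 (treg 0)) (r1 0)) R1.
  have [r3 [E3 R3 V3 K3]] := cexp_ok W ok2 R2 C3.
  rewrite (_ : ce a + ce b + 2 = ce a + (1 + (ce b + 1))); last by lia.
  rewrite !runD E1 (run1 _ _ C2) E3 (run1 _ _ C4) /=.
  exists r3, (upd m (r3 (treg 0)) (r3 (treg 1))); split; first by apply: pc_eq; lia.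
  have hL : r1 0 = L by case: R1.
  have e0 : r3 (treg 0) = L + ev s a.
    by rewrite (K3 0) // updE /= V1' hL modn_small; lia.
  case: R3 => h1 h2 h3 [h4 h5 h6]; split=> //; split.
  + move=> j i hj hi; rewrite /upd /= e0 ifN; [exact: h4 | lia].
  + by move=> i hi; rewrite /upd /= e0 eqn_add2l V3; case: ifP => // _; exact: h5.
  + move=> i hi; rewrite /upd e0 ifN; [exact: h6 | lia].
- move=> s1 s2 s3 a b t1 t2 B1 IH1 _ IH2 W o r m R /= /code_cat[C1 C2].
  have [r1 [m1 [E1 R1]]] := IH1 W _ _ _ R C1.
  rewrite size_compile in C2.
  have [r2 [m2 [E2 R2]]] := IH2 (bs_wf B1 W) _ _ _ R1 C2.
  by exists r2, m2; split=> //; rewrite runD E1 E2 addnA.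
- move=> s s' b a1 a2 t ok1 ok2 tb _ IH W o r m R /= /code_cat[C1 /code_cat[_ /code_cons[_ C3]]].
  have [r1 [E1 R1]] := ctest_ok W ok1 ok2 R C1.
  have sz : size (ctest b (o + ct b + csize a2 + 2)) = ct b + 1.
    by rewrite /ctest !size_cat !size_cexp /ct /=; lia.
  rewrite sz size_compile in C3.
  rewrite (_ : (_ + _).+1 = o + ct b + csize a2 + 2) in C3; last by lia.
  rewrite tb in E1.
  have [r2 [m2 [E2 R2]]] := IH W _ _ _ R1 C3.
  exists r2, m2; split=> //; rewrite runD E1 E2; apply: pc_eq; lia.
- move=> s s' b a1 a2 t ok1 ok2 tb _ IH W o r m R /= /code_cat[C1 /code_cat[C2 /code_cons[C3 _]]].
  have [r1 [E1 R1]] := ctest_ok W ok1 ok2 R C1.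
  have sz : size (ctest b (o + ct b + csize a2 + 2)) = ct b + 1.
    by rewrite /ctest !size_cat !size_cexp /ct /=; lia.
  rewrite sz ?size_compile in C2 C3.
  rewrite (negbTE tb) in E1.
  rewrite (_ : o + (_ + 1) = o + ct b + 1) in C2 C3; last by lia.
  have [r2 [m2 [E2 R2]]] := IH W _ _ _ R1 C2.
  exists r2, m2; split=> //.
  rewrite (_ : ct b + 2 + t = ct b + 1 + (t + 1)); last by lia.
  rewrite runD E1 runD E2 (runS _ _ _ C3) /=; apply: pc_eq; lia.
- move=> s b a ok1 ok2 tb W o r m R /= /code_cat[C1 /code_cons[C2 _]].
  have [r1 [E1 R1]] := ctest_ok W ok1 ok2 R C1.
  have sz : size (ctest b (o + ct b + 2)) = ct b + 1.
    by rewrite /ctest !size_cat !size_cexp /ct /=; lia.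
  rewrite sz (_ : o + (_ + 1) = o + ct b + 1) in C2; last by lia.
  rewrite (negbTE tb) in E1.
  exists r1, m; split=> //.
  rewrite (_ : ct b + 2 = ct b + 1 + 1); last by lia.
  by rewrite runD E1 (run1 _ _ C2).
- move=> s s' s'' b a t t' ok1 ok2 tb Ba IHa _ IHw W o r m R H.
  have := H; move=> /= /code_cat[C1 /code_cons[_ /code_cat[C2 /code_cons[C3 _]]]].
  have [r1 [E1 R1]] := ctest_ok W ok1 ok2 R C1.
  have sz : size (ctest b (o + ct b + 2)) = ct b + 1.
    by rewrite /ctest !size_cat !size_cexp /ct /=; lia.
  rewrite sz ?size_compile in C2 C3; rewrite tb in E1.
  rewrite (_ : (_ + _).+1 = o + ct b + 2) in C2 C3; last by lia.
  have [r2 [m2 [E2 R2]]] := IHa W _ _ _ R1 C2.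
  have [r3 [m3 [E3 R3]]] := IHw (bs_wf Ba W) _ _ _ R2 H.
  exists r3, m3; split=> //.
  rewrite (_ : ct b + 2 + t + t' = ct b + 1 + (t + (1 + t'))); last by lia.
  by rewrite runD E1 runD E2 runD (runS _ _ _ C3) /= E3.
Qed.

End Simulation.

(** * Program logic *)

Fixpoint mv (c : cmd) : seq nat :=
  match c with
  | Set_ x _ => [:: x]
  | Seq a b | If _ a b => mv a ++ mv b
  | While _ a => mv a
  | _ => [::]
  end.

Fixpoint ma (c : cmd) : seq nat :=
  match c with
  | St j _ _ => [:: j]
  | Seq a b | If _ a b => ma a ++ ma b
  | While _ a => ma a
  | _ => [::]
  end.

Fixpoint mo (c : cmd) : bool :=
  match c with
  | Wr _ _ => true
  | Seq a b | If _ a b => mo a || mo b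
  | While _ a => mo a
  | _ => false
  end.

(** The footprint is read off the syntax, so that a loop invariant has to mention only what the loop
    body changes. *)
Definition frame (c : cmd) (s s' : st) :=
  [/\ forall x, x \notin mv c -> vr s' x = vr s x,
      forall j, j \notin ma c -> ar s' j = ar s j &
      ~~ mo c -> ou s' = ou s].

Lemma frame_trans c s1 s2 s3 : frame c s1 s2 -> frame c s2 s3 -> frame c s1 s3.
Proof.
move=> [h1 h2 h3] [g1 g2 g3]; split=> [x h|j h|h]; first by rewrite g1 ?h1.
  by rewrite g2 ?h2.
by rewrite g3 ?h3.
Qed.

Lemma frame_sub c c' s1 s2 : {subset mv c <= mv c'} -> {subset ma c <= ma c'} ->
  (mo c -> mo c') -> frame c s1 s2 -> frame c' s1 s2.
Proof.
move=> S1 S2 S3 [h1 h2 h3]; split=> [x h|j h|h].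
- by apply: h1; apply: contra h => /S1.
- by apply: h2; apply: contra h => /S2.
- by apply: h3; apply: contra h => /S3.
Qed.

Lemma bs_frame c s t s' : bs c s t s' -> frame c s s'.
Proof.
elim=> {c s t s'} //=.
- move=> s x e _; split=> //= y; rewrite inE => h.
  by case: PeanoNat.Nat.eqb_spec => // ?; subst; rewrite eqxx in h.
- move=> s j a b _ _ _; split=> //= y; rewrite inE => h.
  by case: PeanoNat.Nat.eqb_spec => // ?; subst; rewrite eqxx in h.
- move=> s1 s2 s3 a b t1 t2 _ F1 _ F2.
  apply: (@frame_trans _ _ s2).
    by apply: frame_sub F1 => //= [x|x|] h; rewrite ?mem_cat h.
  by apply: frame_sub F2 => //= [x|x|] h; rewrite ?mem_cat h orbT.
- by move=> s s' b a1 a2 t _ _ _ _; apply: frame_sub => //= [x|x|] h; rewrite ?mem_cat ?h ?orbT.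
- by move=> s s' b a1 a2 t _ _ _ _; apply: frame_sub => //= [x|x|] h; rewrite ?mem_cat ?h ?orbT.
- by move=> s s1 s2 b a t t' _ _ _ _ F1 _ F2; apply: (@frame_trans _ _ s1).
Qed.

(* The clock [t] counts up, so a bound on it in an invariant proves both the
   time bound and termination. *)
Definition wp c (Q : nat -> st -> Prop) t s :=
  exists t' s', bs c s t' s' /\ Q (t + t') s'.

Lemma wp_mono c (Q Q' : nat -> st -> Prop) t s :
  (forall t' s', frame c s s' -> Q t' s' -> Q' t' s') -> wp c Q t s -> wp c Q' t s.
Proof.
by move=> H [t' [s' [h1 h2]]]; exists t', s'; split=> //; apply: H => //; apply: bs_frame h1.
Qed.

Lemma wp_framed c (Q : nat -> st -> Prop) t s :
  wp c (fun t' s' => frame c s s' -> Q t' s') t s -> wp c Q t s.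
Proof. by apply: wp_mono => t' s' F; apply. Qed.

Lemma wp_skip (Q : nat -> st -> Prop) t s : Q t s -> wp Skip Q t s.
Proof. by move=> h; exists 0, s; rewrite addn0; split=> //; constructor. Qed.

Lemma wp_set x e (Q : nat -> st -> Prop) t s : eok s e ->
  (forall v, v = ev s e -> Q (t + (ce e).+1) (setv s x v)) -> wp (Set_ x e) Q t s.
Proof. by move=> h /(_ _ erefl) H; do 2 eexists; split; [exact: bs_set | exact: H]. Qed.

Lemma wp_st j a b (Q : nat -> st -> Prop) t s : eok s a -> eok s b -> j < 32 ->
  (forall i v, i = ev s a -> v = ev s b -> Q (t + (ce a + ce b + 6)) (sta s j i v)) ->
  wp (St j a b) Q t s.
Proof.
by move=> h h' hj /(_ _ _ erefl erefl) H; do 2 eexists; split; [exact: bs_st | exact: H].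
Qed.

Lemma wp_wr a b (Q : nat -> st -> Prop) t s : eok s a -> eok s b -> ev s a < OS ->
  (forall i v, i = ev s a -> v = ev s b -> Q (t + (ce a + ce b + 2)) (wro s i v)) ->
  wp (Wr a b) Q t s.
Proof.
by move=> h h' hj /(_ _ _ erefl erefl) H; do 2 eexists; split; [exact: bs_wr | exact: H].
Qed.

Lemma wp_seq a b Q t s : wp a (wp b Q) t s -> wp (Seq a b) Q t s.
Proof.
move=> [t1 [s1 [h1 [t2 [s2 [h2 q]]]]]]; exists (t1 + t2), s2.
by rewrite addnA; split=> //; apply: bs_seq h1 h2.
Qed.

Lemma wp_if b a1 a2 Q t s : eok s (Tl b) -> eok s (Tr b) ->
  (evt s b -> wp a1 Q (t + (ct b + 1)) s) ->
  (~~ evt s b -> wp a2 Q (t + (ct b + 2)) s) -> wp (If b a1 a2) Q t s.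
Proof.
move=> h1 h2 H1 H2; case: (boolP (evt s b)) => hb.
  have [t' [s' [hs q]]] := H1 hb; exists (ct b + 1 + t'), s'; rewrite addnA.
  by split=> //; apply: bs_ift.
have [t' [s' [hs q]]] := H2 hb; exists (ct b + 2 + t'), s'; rewrite addnA.
by split=> //; apply: bs_iff.
Qed.

(** Induction on the distance of the clock from [M]: an iteration costs at least its test. The frame
    relative to the entry state [s0] is supplied on top of the invariant. *)
Lemma wp_while b a (I : nat -> st -> Prop) M Q t s0 :
  I t s0 ->
  (forall t s, frame a s0 s -> I t s -> [/\ t <= M, eok s (Tl b) & eok s (Tr b)]) ->
  (forall t s, frame a s0 s -> I t s -> evt s b -> wp a I (t + (ct b + 2)) s) ->
  (forall t s, frame a s0 s -> I t s -> ~~ evt s b -> Q (t + (ct b + 2)) s) ->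
  wp (While b a) Q t s0.
Proof.
move=> I0 H1 H2 H3.
have: forall m t s, M < t + m -> frame a s0 s -> I t s -> wp (While b a) Q t s.
  elim=> [|m IH] {I0} t' s hm F It; have [tM ok1 ok2] := H1 _ _ F It; first by lia.
  case: (boolP (evt s b)) => hb.
    have [t1 [s1 [hs I1]]] := H2 _ _ F It hb.
    have F1 := frame_trans F (bs_frame hs).
    have [|t2 [s2 [h2 q]]] := IH (t' + (ct b + 2) + t1) s1 _ F1 I1; first by lia.
    exists (ct b + 2 + t1 + t2), s2; split; first exact: bs_wht hs h2.
    by rewrite !addnA in q *.
  by exists (ct b + 2), s; split; [apply: bs_whf | apply: H3].
by move=> /(_ M.+1 t s0); apply=> //; lia.
Qed.

End Semantics.

(** * Rooting the tree *)

Lemma traverses_mem n (x : 'I_n) q e : traverses x q e ->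
  e.1 \in x :: q /\ e.2 \in x :: q.
Proof.
elim: q x => // z q IH x; rewrite /traverses /= => /orP[|/IH].
  by case: e {IH} => a b /=; rewrite !xpair_eqE => /orP[] /andP[/eqP-> /eqP->];
    rewrite !inE !eqxx ?orbT.
by rewrite !(in_cons x) => -[-> ->]; rewrite !orbT.
Qed.

(** Only [e] joins the two sides, and a simple path uses it at most once: after a crossing, the end
    of [e] left behind cannot be visited again. *)
Lemma traverses_sides n (T : seq ('I_n * 'I_n)) (f : 'I_n -> bool) e :
  (forall d, d \in T -> d != e -> f d.1 = f d.2) -> f e.1 != f e.2 ->
  forall x y q, simple_path T x y q -> traverses x q e = (f x != f y).
Proof.
move=> H He x y q; elim: q x => [|z q IH] x.
  by rewrite /simple_path /= andbT => /eqP->; rewrite eqxx.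
case/and3P => /= /andP[xz pq] lq /andP[xq uq].
have /IH{}IH : simple_path T z y q by rewrite /simple_path pq lq.
have -> : traverses x (z :: q) e =
    (((x, z) == e) || ((x, z) == (e.2, e.1))) || traverses z q e by [].
case: (boolP (((x, z) == e) || ((x, z) == (e.2, e.1)))) => [st|] /=.
  have nt : traverses z q e = false.
    apply/negP => /traverses_mem[m1 m2]; case: e {H He IH} st m1 m2 => a b /=.
    by rewrite !xpair_eqE => /orP[] /andP[/eqP h1 /eqP h2] m1 m2;
      subst; rewrite ?m1 ?m2 in xq.
  rewrite nt in IH; move/esym/negbFE/eqP: IH => <-.
  case: e {H nt} He st => a b /= He.
  by rewrite !xpair_eqE => /orP[] /andP[/eqP-> /eqP->]; rewrite // eq_sym.
rewrite negb_or IH /= => /andP[n1 n2]; congr (_ != _).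
case/orP: xz => h; first by rewrite -(H _ h).
rewrite (H _ h) //; apply: contra n2; case: e {H He IH n1} => a b /=.
by rewrite !xpair_eqE andbC.
Qed.

Section Rooting.

Variables (n : nat) (T : seq ('I_n.+1 * 'I_n.+1)).
Hypothesis treeT : is_tree T.

Let r : 'I_n.+1 := ord0.

Lemma adj_sym : symmetric (adj T).
Proof. by move=> x y; rewrite /adj /= orbC. Qed.

(** Walks of length [m] form a finite type of tuples, which makes this a boolean to which [ex_minn]
    applies. The depth is thus the length of a shortest walk to the root. *)
Definition reaches (v : 'I_n.+1) m :=
  [exists s : m.-tuple 'I_n.+1, path (adj T) v s && (last v s == r)].

Lemma reachesP v : exists m, reaches v m.
Proof.
case: treeT => _ _ /(_ v r)/connectP[q pq lq] _; exists (size q).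
by apply/existsP; exists (in_tuple q); rewrite pq -lq eqxx.
Qed.

Definition depth v := ex_minn (reachesP v).

Lemma closer v : v != r -> exists w, adj T v w && (depth w < depth v).
Proof.
move=> vr; rewrite {2}/depth; case: ex_minnP => m /existsP[[s /= /eqP sm] /andP[ps /eqP ls]] _.
case: s sm ps ls => [|w s] /= sm; first by move=> _ h; rewrite h eqxx in vr.
move=> /andP[vw ps] ls; exists w; rewrite vw /=; rewrite -sm ltnS /depth.
case: ex_minnP => m' _ /(_ (size s)); apply.
by apply/existsP; exists (in_tuple s); rewrite ps ls eqxx.
Qed.

Definition parent v := odflt r [pick w | adj T v w && (depth w < depth v)].

Lemma parentP v : v != r -> adj T v (parent v) /\ depth (parent v) < depth v.
Proof.
move=> /closer[w hw]; rewrite /parent; case: pickP => /=.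
  by move=> x /andP[].
by move/(_ w); rewrite hw.
Qed.

Definition tadj : rel 'I_n.+1 := [rel x y | (x != r) && (y == parent x) || (y != r) && (x == parent y)].

Lemma tadj_sym : symmetric tadj.
Proof. by move=> x y; rewrite /tadj /= orbC. Qed.

Lemma tadj_adj x y : tadj x y -> adj T x y.
Proof.
case/orP => /andP[/parentP[h _] /eqP->] //.
by rewrite adj_sym.
Qed.

Lemma connect_root v : connect tadj v r.
Proof.
have [m] := ubnP (depth v); elim: m v => // m IH v hv.
case: (eqVneq v r) => [->|vr]; first exact: connect0.
have [_ h] := parentP vr.
apply: (@connect_trans _ _ (parent v)); last by apply: IH; lia.
by apply: connect1; rewrite /tadj /= vr eqxx.
Qed.

(** Otherwise a simple path from [x] to [y] along parent edges has at least two edges, and the edge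
    [xy] closes it to a cycle on at least three vertices. *)
Lemma adj_tadj x y : x != y -> adj T x y -> tadj x y.
Proof.
move=> xy axy; apply/negPn/negP => nt.
have : connect tadj x y.
  apply: connect_trans (connect_root x) _.
  by rewrite (sym_connect_sym tadj_sym) connect_root.
case/connectP => q pq lq; case/shortenP: pq lq => q' pq' uq' _ lq'.
case: treeT => _ _ _ /(_ (x :: q')) ac.
have : ucycle (adj T) (x :: q').
  rewrite /ucycle uq' andbT /cycle rcons_path -lq' adj_sym axy andbT.
  by apply: sub_path pq' => a b; apply: tadj_adj.
move=> /ac; case: q' pq' lq' {uq' ac} => [|a [|b q']] //=.
  by move=> _ h; rewrite h eqxx in xy.
by rewrite andbT => h e; subst a; rewrite h in nt.
Qed.

Definition joins (v : 'I_n.+1) (e : 'I_n.+1 * 'I_n.+1) :=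
  (e == (v, parent v)) || (e == (parent v, v)).

Definition pedge v := find (joins v) T.

Lemma has_pedge v : v != r -> has (joins v) T.
Proof.
move=> /parentP[h _]; case/orP: h => h; apply/hasP; eexists; try exact: h;
  by rewrite /joins eqxx ?orbT.
Qed.

Lemma joins_set v e : joins v e -> [set e.1; e.2] = [set v; parent v].
Proof. by case/orP => /eqP-> //=; rewrite setUC. Qed.

Lemma joins_inj v w e : v != r -> w != r -> joins v e -> joins w e -> v = w.
Proof.
move=> /parentP[_ dv] /parentP[_ dw] /orP[]/eqP-> /orP[]/eqP[] // e1 e2;
  move: (congr1 depth e1) (congr1 depth e2); lia.
Qed.

Lemma edge_joins e : e \in T -> exists2 v, v != r & joins v e.
Proof.
move=> eT; have [_ [] /(_ e eT) ne _ _ _] := treeT.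
have : tadj e.1 e.2.
  by apply: adj_tadj => //; rewrite /adj /= -surjective_pairing eT.
case: e {eT ne} => a b /= /orP[]/andP[h /eqP->]; [exists a|exists b] => //;
  by rewrite /joins eqxx ?orbT.
Qed.

Lemma pedgeE v i : v != r -> i < size T -> joins v (nth (r, r) T i) -> pedge v = i.
Proof.
move=> vr iT ji.
have hp := has_pedge vr; have jp := nth_find (r, r) hp; rewrite has_find in hp.
have [_ [_ uT] _ _] := treeT; apply/eqP.
have : [set (nth (r, r) T (pedge v)).1; (nth (r, r) T (pedge v)).2] =
       [set (nth (r, r) T i).1; (nth (r, r) T i).2].
  by rewrite (joins_set jp) (joins_set ji).
move=> e; rewrite -(nth_uniq set0 _ _ uT) ?size_map //.
by rewrite !(nth_map (r, r)) // e.
Qed.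

(** [pedge] is a bijection from the vertices other than the root onto the positions in [T]. *)
Lemma size_tree : size T = n.
Proof.
have le v : v != r -> pedge v < size T by move=> /has_pedge; rewrite has_find.
have inj v w : v != r -> w != r -> pedge v = pedge w -> v = w.
  move=> vr wr e; have jv := nth_find (r, r) (has_pedge vr).
  have := nth_find (r, r) (has_pedge wr); rewrite -/(pedge w) -e.
  exact: joins_inj.
have : perm_eq [seq pedge v | v <- enum [pred v | v != r]] (iota 0 (size T)).
  apply: uniq_perm; rewrite ?iota_uniq //.
    rewrite map_inj_in_uniq ?enum_uniq // => v w.
    by rewrite !mem_enum !inE; apply: inj.
  move=> i; rewrite mem_iota add0n /=; apply/mapP/idP.
    by case=> v; rewrite mem_enum inE => vr ->; apply: le.
  move=> iT; have [v vr jv] := edge_joins (mem_nth (r, r) iT).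
  by exists v; rewrite ?mem_enum ?inE // (pedgeE vr iT jv).
move=> /perm_size; rewrite size_map size_iota -cardE => <-.
by rewrite (eq_card (B := predC1 r)) ?cardC1 ?card_ord.
Qed.

End Rooting.

(** All that the program proofs know about the tree, on natural numbers: 0 is the root, [P] the
    parent, [pe c] the position of the edge above [c], and [dep] a measure that makes the parent
    relation well founded. *)
Record rooted (n : nat) (ea eb P dep pe : nat -> nat) : Prop := Rooted {
  rt_par : forall c, 0 < c < n -> P c < n;
  rt_dep : forall c, 0 < c < n -> dep (P c) < dep c;
  rt_pe  : forall c, 0 < c < n -> pe c < n.-1;
  rt_end : forall c, 0 < c < n ->
    ea (pe c) = c /\ eb (pe c) = P c \/ ea (pe c) = P c /\ eb (pe c) = c;
  rt_inj : forall c d, 0 < c < n -> 0 < d < n -> pe c = pe d -> c = d;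
  rt_sur : forall i, i < n.-1 -> exists2 c, 0 < c < n & pe c = i }.

Lemma tree_rooted n (T : seq ('I_n * 'I_n)) : is_tree T ->
  size T = n.-1 /\ exists P dep pe,
  rooted n (nth 0 [seq val e.1 | e <- T]) (nth 0 [seq val e.2 | e <- T]) P dep pe.
Proof.
case: n T => [|n] T treeT; first by case: treeT.
have sz := size_tree treeT; split=> //.
pose io (c : nat) : 'I_n.+1 := inord c.
have ioE c : 0 < c < n.+1 -> val (io c) = c /\ io c != ord0.
  move=> /andP[h1 h2]; have e : val (io c) = c by rewrite /io /= inordK.
  by split=> //; rewrite -(inj_eq val_inj) e /=; lia.
have iov (v : 'I_n.+1) : io v = v by apply: val_inj; rewrite /io /= inordK.
exists (fun c => val (parent treeT (io c))), (fun c => depth treeT (io c)),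
       (fun c => pedge treeT (io c)).
split=> /=.
- by move=> c _; apply: ltn_ord.
- by move=> c /ioE[_ h]; rewrite iov; case: (parentP treeT h).
- move=> c /ioE[_ h]; apply: leq_trans (_ : size T <= n); last by rewrite sz.
  by rewrite /pedge -has_find; apply: has_pedge.
- move=> c /ioE[e h]; have hp := has_pedge treeT h.
  have jp := nth_find (ord0, ord0) hp; rewrite has_find in hp.
  rewrite !(nth_map (ord0, ord0)) //.
  by case/orP: jp => /eqP; rewrite /pedge => -> /=; rewrite e; [left|right].
- move=> c d /ioE[e h] /ioE[e' h'] ep; rewrite -e -e'; congr val.
  have jv := nth_find (ord0, ord0) (has_pedge treeT h).
  have := nth_find (ord0, ord0) (has_pedge treeT h'); rewrite -/(pedge _ _) -ep.
  exact: joins_inj.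
- move=> i iN; have iT : i < size T by rewrite sz.
  have [v vr jv] := edge_joins treeT (mem_nth (ord0, ord0) iT).
  exists (val v); last by rewrite iov (pedgeE vr iT jv).
  by rewrite ltn_ord andbT lt0n; apply: contra vr => /eqP h; apply/eqP/val_inj.
Qed.

(** * The algorithm *)

Coercion Var : nat >-> expr.
Notation "# c" := (Lit c) (at level 1, c at level 0, format "# c").
Notation "a ![ e ]" := (Ld a e) (at level 2, left associativity).
Notation "a +' b" := (Bin Badd a b) (at level 50, left associativity).
Notation "a -' b" := (Bin Bsub a b) (at level 50, left associativity).
Notation "a *' b" := (Bin Bmul a b) (at level 40, left associativity).
Notation "a ;; b" := (Seq a b) (at level 95, right associativity).
Notation "x <-- e" := (Set_ x e) (at level 90).
Notation "a ![ i ] <-- e" := (St a i e) (at level 2).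

Notation vn := 0. Notation vp := 1. Notation vk := 2. Notation vW := 3.
Notation vi := 4. Notation vx := 5. Notation vq := 6. Notation vcnt := 7.
Notation vv := 8. Notation vw := 9. Notation vmw := 10. Notation vc := 11.
Notation vb := 12. Notation vm := 13. Notation vg := 14. Notation vs := 15.
Notation va := 16. Notation vt := 17. Notation vmk := 18. Notation vj := 19.
Notation vy := 20. Notation vz := 21. Notation ve := 22. Notation vla := 23.
Notation vlb := 24. Notation vtt := 25. Notation vh := 26. Notation vs2 := 27.
Notation vu := 28.

Notation aDEG := 0. Notation aNB := 1. Notation aED := 2. Notation aORD := 3.
Notation aPOS := 4. Notation aPAR := 5. Notation aPE := 6. Notation aHEAD := 7.
Notation aNXT := 8. Notation aSRT := 9. Notation aLG := 10. Notation aACC := 11.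
Notation aOG := 12. Notation aGRP := 13. Notation aCL := 14. Notation aMS := 15.
Notation aCS := 16. Notation aANC := 17. Notation aBM := 18. Notation aUNM := 19.
Notation aTBL := 20. Notation aEX := 21. Notation aLAB := 22. Notation aTOP := 23.
Notation aHD := 24. Notation aNX := 25. Notation aSZ := 26.

Definition inc a (i d : expr) : cmd := St a i (Ld a i +' d).
Definition dec a (i d : expr) : cmd := St a i (Ld a i -' d).

(* Degree, sum of the neighbours and sum of the incident edges of each vertex;
   these sums make adjacency lists unnecessary.  The root 0 gets the degree 2
   for free, so that it never looks like a leaf. *)
Definition c_degrees : cmd :=
  St aDEG #0 #2 ;; vi <-- #0 ;;
  While (Tlt (vi +' #1) vn) (
    va <-- Inp (vi +' vi +' #3) ;; vb <-- Inp (vi +' vi +' #4) ;;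
    inc aDEG va #1 ;; inc aNB va vb ;; inc aED va vi ;;
    inc aDEG vb #1 ;; inc aNB vb va ;; inc aED vb vi ;;
    vi <-- vi +' #1).

(* Removes leaves; once [x] is removed, [NB[x]] is its parent and [ED[x]] the
   edge between them.  [POS] numbers the vertices in the order of removal. *)
Definition c_leaves : cmd :=
  St aPOS #0 (vn -' #1) ;; vcnt <-- #0 ;; vv <-- #1 ;;
  While (Tlt vv vn) (
    vx <-- vv ;;
    While (Teq (aDEG![vx]) #1) (
      vq <-- aNB![vx] ;; St aDEG vx #0 ;; dec aDEG vq #1 ;; dec aNB vq vx ;;
      dec aED vq (aED![vx]) ;; St aPOS vx vcnt ;; St aORD vcnt vx ;;
      vcnt <-- vcnt +' #1 ;; vx <-- vq) ;;
    vv <-- vv +' #1).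

Definition c_rename : cmd :=
  vi <-- #0 ;;
  While (Tlt (vi +' #1) vn) (
    vx <-- aORD![vi] ;; St aPAR vi (aPOS![aNB![vx]]) ;; St aPE vi (aED![vx]) ;;
    vi <-- vi +' #1).

(** [vW] is the offset of the path triples in the input. The weight bound is not part of the input,
    so the largest weight is recorded to know how many buckets to visit. *)
Definition c_buckets : cmd :=
  vW <-- vn +' vn +' #1 ;; vi <-- #0 ;; vmw <-- #0 ;;
  While (Tlt vi vp) (
    vw <-- Inp (vW +' vi *' #3 +' #2) ;;
    St aNXT (vi +' #1) (aHEAD![vw]) ;; St aHEAD vw (vi +' #1) ;;
    If (Tlt vmw vw) (vmw <-- vw) Skip ;;
    vi <-- vi +' #1).

Definition c_sort : cmd :=
  vc <-- #0 ;; vw <-- #0 ;;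
  While (Tlt vw (vmw +' #1)) (
    vi <-- aHEAD![vw] ;;
    While (Tlt #0 vi) (
      St aSRT vc (vi -' #1) ;; vc <-- vc +' #1 ;; vi <-- aNXT![vi]) ;;
    vw <-- vw +' #1).

(* [m = 4 ^ b] is about [n]; [LG] tabulates the logarithm below [m]. *)
Definition c_log : cmd :=
  vb <-- #1 ;; vm <-- #4 ;;
  While (Tlt (vm *' #4) (vn +' #1)) (vm <-- vm *' #4 ;; vb <-- vb +' #1) ;;
  vi <-- #2 ;;
  While (Tlt vi vm) (
    St aLG vi (aLG![Bin Bdiv vi #2] +' #1) ;; vi <-- vi +' #1).

(* Bottom-up grouping.  The not yet grouped vertices below [q] form an open
   group, named after its first child of [q]; it is closed when it has at least
   [b] members. *)
Definition c_groups : cmd :=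
  vi <-- #0 ;;
  While (Tlt (vi +' #1) vn) (
    vq <-- aPAR![vi] ;;
    If (Teq (aACC![vq]) #0) (St aOG vq vi) Skip ;;
    vg <-- aOG![vq] ;; St aGRP vi vg ;;
    vs <-- aACC![vq] +' aACC![vi] +' #1 ;;
    If (Tlt vs vb) (St aACC vq vs) (St aACC vq #0 ;; St aCL vg #1) ;;
    vi <-- vi +' #1) ;;
  St aGRP (vn -' #1) (vn -' #1) ;; St aCL (vn -' #1) #1.

(* Top-down: microset [MS], bit mask [BM] and mask of ancestors [ANC] inside the
   microset of each vertex; [UNM] is the mask of the unmarked vertices of a
   microset, [EX] the parent of its top vertices. *)
Definition c_micro : cmd :=
  vi <-- vn ;;
  While (Tlt #0 vi) (
    vi <-- vi -' #1 ;; vq <-- aPAR![vi] ;; vg <-- aGRP![vi] ;;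
    If (Teq (aCL![vg]) #1)
      (vs <-- vg ;; va <-- #0 ;;
       St aEX vg vq ;; St aLAB vg vg ;; St aTOP vg vg ;; St aHD vg (vg +' #1) ;;
       St aSZ vg #1)
      (vs <-- aMS![vq] ;; va <-- aANC![vq]) ;;
    vt <-- aCS![vs] ;; vmk <-- Bin Bshl #1 vt ;;
    St aMS vi vs ;; St aBM vi vmk ;; St aANC vi (Bin Bor va vmk) ;;
    St aUNM vs (Bin Bor (aUNM![vs]) vmk) ;;
    St aTBL (vs *' (vb +' vb) +' vt) vi ;;
    St aCS vs (vt +' #1)).

(* Merges the macro classes of [s] and [s2], relabelling the smaller one. *)
Definition c_union : cmd :=
  vla <-- aLAB![vs] ;; vlb <-- aLAB![vs2] ;; vtt <-- aTOP![vlb] ;;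
  If (Tlt (aSZ![vlb]) (aSZ![vla]))
    (vh <-- vla ;; vla <-- vlb ;; vlb <-- vh) Skip ;;
  vh <-- aHD![vla] ;;
  While (Tlt #0 vh) (
    vg <-- vh -' #1 ;; vu <-- aNX![vg] ;;
    St aLAB vg vlb ;; St aNX vg (aHD![vlb]) ;; St aHD vlb vh ;; vh <-- vu) ;;
  St aSZ vlb (aSZ![vlb] +' aSZ![vla]) ;; St aTOP vlb vtt.

(* [z] becomes its nearest unmarked ancestor. *)
Definition c_find : cmd :=
  vs <-- aMS![vz] ;; vm <-- Bin Band (aANC![vz]) (aUNM![vs]) ;;
  While (Teq vm #0) (
    vs <-- aTOP![aLAB![vs]] ;; vz <-- aEX![vs] ;; vs2 <-- aMS![vz] ;;
    vm <-- Bin Band (aANC![vz]) (aUNM![vs2]) ;;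
    If (Teq vm #0) c_union Skip ;;
    vs <-- vs2) ;;
  vz <-- aTBL![vs *' (vb +' vb) +' aLG![vm]].

(** The loop test [0 < x xor y] expresses [x <> y]. *)
Definition c_path : cmd :=
  vi <-- aSRT![vj] ;;
  vz <-- aPOS![Inp (vW +' vi *' #3)] ;; c_find ;; vx <-- vz ;;
  vz <-- aPOS![Inp (vW +' vi *' #3 +' #1)] ;; c_find ;; vy <-- vz ;;
  While (Tlt #0 (Bin Bxor vx vy)) (
    If (Tlt vy vx) (vh <-- vx ;; vx <-- vy ;; vy <-- vh) Skip ;;
    ve <-- aPE![vx] *' (vk +' #1) ;; vc <-- Out ve +' #1 ;;
    Wr ve vc ;; Wr (ve +' vc) vi ;;
    If (Teq vc vk) (St aUNM (aMS![vx]) (Bin Bxor (aUNM![aMS![vx]]) (aBM![vx]))) Skip ;;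
    vz <-- aPAR![vx] ;; c_find ;; vx <-- vz).

Definition c_main : cmd :=
  vj <-- #0 ;; While (Tlt vj vp) (c_path ;; vj <-- vj +' #1).

Definition algorithm : cmd :=
  c_degrees ;; c_leaves ;; c_rename ;; c_buckets ;; c_sort ;; c_log ;;
  c_groups ;; c_micro ;; c_main.

(* [lia] is slow in the presence of boolean hypotheses that it cannot use. *)
Ltac slia :=
  repeat match goal with
  | H : context [in_mem] |- _ => clear H
  | H : context [uniq] |- _ => clear H
  | H : context [Nat.testbit] |- _ => clear H
  | H : _ \/ _ |- _ => clear H
  end; lia.

Ltac ok :=
  lazymatch goal with
  | |- and3 _ _ _ => split; ok
  | |- and4 _ _ _ _ => split; ok
  | |- and5 _ _ _ _ _ => split; ok
  | |- _ /\ _ => split; ok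
  | |- True => exact Logic.I
  | |- _ -> _ => intro; ok
  | |- _ => slia
  end.

(* One symbolic execution step; the side conditions that [ok] cannot prove come
   first. *)
Ltac step :=
  lazymatch goal with
  | |- wp _ _ _ _ (Seq _ _) _ _ _ => apply: wp_seq; step
  | |- wp _ _ _ _ Skip _ _ _ => apply: wp_skip
  | |- wp _ _ _ _ (Set_ _ _) _ _ _ => apply: wp_set => /=; [try ok|]
  | |- wp _ _ _ _ (St _ _ _) _ _ _ => apply: wp_st => /=; [try ok|try ok|done|]
  | |- wp _ _ _ _ (Wr _ _) _ _ _ => apply: wp_wr => /=; [try ok|try ok|try ok|]
  | |- wp _ _ _ _ (If _ _ _) _ _ _ => apply: wp_if => /=; [try ok|try ok| |]
  | |- wp _ _ _ _ (inc _ _ _) _ _ _ => rewrite /inc; step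
  | |- wp _ _ _ _ (dec _ _ _) _ _ _ => rewrite /dec; step
  end.

(** A linear consequence of the size hypothesis, so that most overflow conditions fall to linear
    arithmetic. *)
Lemma BN1 B N : 2 <= N -> 16 * (N * N) + 64 <= B -> 32 * N + 64 <= B.
Proof. nia. Qed.

(** * Degrees, neighbour sums and sums of incident edges *)

Section Phases.

Variables (B L OS : nat) (inp : nat -> nat) (n p k N : nat).
Hypothesis n0 : 0 < n.
Hypothesis k0 : 0 < k.
Hypothesis NE : n + p + k <= N.
Hypothesis N2 : 2 <= N.
Hypothesis BN : 16 * (N * N) + 64 <= B.

Notation wp := (wp B L OS inp).

Section Degrees.

Variables (ea eb P dep pe : nat -> nat).
Hypothesis rt : rooted n ea eb P dep pe.
Hypothesis Ln : 2 * n + 1 <= L.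
Hypothesis inp_ea : forall i, i < n.-1 -> inp (i + i + 3) = ea i.
Hypothesis inp_eb : forall i, i < n.-1 -> inp (i + i + 4) = eb i.

Lemma ea_lt i : i < n.-1 -> ea i < n /\ eb i < n.
Proof.
move=> /(rt_sur rt)[c hc <-]; have hp := rt_par rt hc.
by case: (rt_end rt hc) => -[-> ->]; lia.
Qed.

Definition deg_to m v := \sum_(i < m) ((ea i == v) + (eb i == v)).
Definition nb_to m v := \sum_(i < m) ((ea i == v) * eb i + (eb i == v) * ea i).
Definition ed_to m v := \sum_(i < m) ((ea i == v) + (eb i == v)) * i.

Lemma sum_le m (F : nat -> nat) K : (forall i, i < m -> F i <= K) ->
  \sum_(i < m) F i <= m * K.
Proof.
move=> H; rewrite -[m in m * K]card_ord -sum_nat_const.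
by apply: leq_sum => i _; apply: H.
Qed.

Lemma deg_le m v : deg_to m v <= m * 2.
Proof. apply: (@sum_le m (fun i => (ea i == v) + (eb i == v))) => i _; case: eqP; case: eqP => //=; lia. Qed.

Lemma nb_le m v : m <= n.-1 -> nb_to m v <= n * (2 * n).
Proof.
move=> hm; apply: leq_trans (_ : m * (2 * n) <= _); last by apply: leq_mul; lia.
apply: (@sum_le m (fun i => (ea i == v) * eb i + (eb i == v) * ea i)) => i hi; have [] := @ea_lt i; first lia.
by case: eqP; case: eqP; lia.
Qed.

Lemma ed_le m v : m <= n.-1 -> ed_to m v <= n * (2 * n).
Proof.
move=> hm; apply: leq_trans (_ : m * (2 * n) <= _); last by apply: leq_mul; lia.
by apply: (@sum_le m (fun i => ((ea i == v) + (eb i == v)) * i)) => i hi; case: eqP; case: eqP; lia.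
Qed.

Lemma degrees_wp (Q : nat -> st -> Prop) t s :
  vr s vn = n ->
  (forall v, ar s aDEG v = 0) -> (forall v, ar s aNB v = 0) ->
  (forall v, ar s aED v = 0) ->
  (forall t' s', frame c_degrees s s' ->
    (forall v, ar s' aDEG v = (v == 0) * 2 + deg_to n.-1 v) ->
    (forall v, ar s' aNB v = nb_to n.-1 v) ->
    (forall v, ar s' aED v = ed_to n.-1 v) ->
    t' <= t + 200 * n -> Q t' s') ->
  wp c_degrees Q t s.
Proof.
move=> En D0 NB0 ED0 HQ; have B1 := BN1 N2 BN.
apply: wp_framed; rewrite {1}/c_degrees.
step=> i v -> ->; step => _ ->.
pose I t' s' := exists2 i, vr s' vi = i /\ i < n & [/\ t' <= t + 15 + 150 * i,
  forall v, ar s' aDEG v = (v == 0) * 2 + deg_to i v,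
  forall v, ar s' aNB v = nb_to i v & forall v, ar s' aED v = ed_to i v].
apply: (@wp_while _ _ _ _ _ _ I (t + 200 * n)).
- exists 0 => //=; split=> [|x|x|x]; first lia.
  + by rewrite D0 /deg_to big_ord0 addn0; case: x.
  + by rewrite NB0 /nb_to big_ord0.
  + by rewrite ED0 /ed_to big_ord0.
- move=> t' s' [Fv _ _] [i' [ei hi] [ht _ _ _]] /=.
  by rewrite ei; ok.
- move=> t' s' [Fv _ _] [i' [ei hi] [ht hd hn he]] /=.
  rewrite (Fv vn isT) /= ei En => hlt.
  have hi' : i' < n.-1 by lia.
  have [ha hb] := ea_lt hi'.
  have nn : n * (2 * n) <= 2 * (N * N) by nia.
  step; rewrite ei => a; rewrite inp_ea // => Ea.
  step; rewrite ei => b; rewrite inp_eb // => Eb.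
  have hdB v0 : ar s' aDEG v0 <= 2 * n + 2.
    by rewrite hd; have := deg_le i' v0; case: eqP; lia.
  have hnB v0 : ar s' aNB v0 <= 2 * (N * N).
    by rewrite hn; apply: leq_trans nn; apply: nb_le; lia.
  have heB v0 : ar s' aED v0 <= 2 * (N * N).
    by rewrite he; apply: leq_trans nn; apply: ed_le; lia.
  step; first by have := hdB a; ok.
  move=> _ _ -> ->.
  step; first by have := hnB a; ok.
  move=> _ _ -> ->.
  step; first by have := heB a; ok.
  move=> _ _ -> ->.
  step; first by have := hdB a; have := hdB b; case: ifP; ok.
  move=> _ _ -> ->.
  step; first by have := hnB a; have := hnB b; case: ifP; ok.
  move=> _ _ -> ->.
  step; first by have := heB a; have := heB b; case: ifP; ok.
  move=> _ _ -> ->.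
  step => _ ->; exists i'.+1; first by rewrite /= ei; lia.
  (* The composition of the updates at the two ends of an edge, in a form that covers all three
     arrays. *)
  have twice (f : nat -> nat) u1 u2 x :
      (if x == b then (if b == a then f a + u1 else f b) + u2
       else if x == a then f a + u1 else f x) =
      f x + (a == x) * u1 + (b == x) * u2.
    rewrite (eq_sym a) (eq_sym b); case: (eqVneq x b) => [->|_].
      by case: eqVneq => [<-|]; lia.
    by case: eqVneq => [->|_]; rewrite ?mul0n ?mul1n ?addn0.
  split=> [|x|x|x] /=; first by rewrite /ct /=; lia.
  + by rewrite twice hd /deg_to big_ord_recr /= -Ea -Eb; lia.
  + by rewrite twice hn /nb_to big_ord_recr /= -Ea -Eb; lia.
  + by rewrite twice he /ed_to big_ord_recr /= -Ea -Eb; lia.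
- move=> t' s' [Fv _ _] [i' [ei hi] [ht hd hn he]] /=.
  rewrite (Fv vn isT) /= ei En => hlt F.
  have e : i' = n.-1 by lia.
  by rewrite e in hd hn he ht; apply: HQ => //; rewrite /ct /=; lia.
Qed.

End Degrees.
End Phases.

(** * Removal of leaves and renaming of the vertices *)

Section Leaves.

Variables (B L OS : nat) (inp : nat -> nat) (n p k N : nat).
Hypothesis n0 : 0 < n.
Hypothesis k0 : 0 < k.
Hypothesis NE : n + p + k <= N.
Hypothesis N2 : 2 <= N.
Hypothesis BN : 16 * (N * N) + 64 <= B.

Notation wp := (wp B L OS inp).

Variables (ea eb P dep pe : nat -> nat).
Hypothesis rt : rooted n ea eb P dep pe.

Lemma sum_single v (g : nat -> nat) :
  \sum_(c <- iota 1 n.-1) (c == v) * g c = (0 < v < n) * g v.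
Proof.
rewrite (eq_bigr (fun c => if c == v then g v else 0)); last first.
  by move=> c _; case: eqP => [->|]; rewrite ?mul1n ?mul0n.
rewrite -big_mkcond big_const_seq iter_addn_0 mulnC; congr (_ * _).
rewrite (eq_count (a2 := pred1 v)) // count_uniq_mem ?iota_uniq // mem_iota.
by congr nat_of_bool; lia.
Qed.

(** [pe] maps the vertices other than the root bijectively to the edges, which turns sums over the
    input into sums over children. *)
Lemma sum_edges (H : nat -> nat) :
  \sum_(i < n.-1) H i = \sum_(c <- iota 1 n.-1) H (pe c).
Proof.
rewrite -(big_mkord xpredT H) /index_iota subn0 -(big_map pe xpredT H).
apply: perm_big; apply: uniq_perm; rewrite ?iota_uniq //.
  rewrite map_inj_in_uniq ?iota_uniq // => c d; rewrite !mem_iota => hc hd.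
  by apply: (rt_inj rt); lia.
move=> i; rewrite mem_iota add0n /=; apply/idP/mapP => [h|[c]].
  have [c hc <-] := rt_sur rt h; exists c; rewrite ?mem_iota //; lia.
by rewrite mem_iota => hc ->; apply: (rt_pe rt); lia.
Qed.

(* [al] is the set of the vertices not yet removed. *)
Definition kids (f : nat -> nat) (al : nat -> bool) v :=
  \sum_(c <- iota 1 n.-1) (al c && (P c == v)) * f c.

Definition rem (al : nat -> bool) x : nat -> bool := fun c => al c && (c != x).

Lemma kids_rem f (al : nat -> bool) x v : 0 < x < n -> al x ->
  kids f al v = kids f (rem al x) v + (P x == v) * f x.
Proof.
move=> hx ax; have := sum_single x (fun c => (P c == v) * f c).
rewrite hx mul1n => <-; rewrite /kids -big_split /=; apply: eq_bigr => c _.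
rewrite /rem; case: (eqVneq c x) => [->|_]; rewrite ?ax ?andbF ?andbT /=; lia.
Qed.

Lemma kids_none f al v : kids (fun=> 1) al v = 0 -> kids f al v = 0.
Proof.
move=> /eqP; rewrite /kids !sum_nat_seq_eq0 => /allP H; apply/eqP.
rewrite big_seq big1 // => c /H /=; rewrite muln_eq0 orbF eqb0 => /negbTE -> //.
Qed.

Lemma kids_some al v : 0 < kids (fun=> 1) al v ->
  exists c, [/\ 0 < c < n, al c & P c = v].
Proof.
rewrite lt0n /kids sum_nat_seq_neq0 => /hasP[c]; rewrite mem_iota /= muln_eq0 orbF eqb0 negbK.
by move=> hc /andP[ac /eqP pc]; exists c; split=> //; lia.
Qed.

(** The two sums of a vertex keep the contribution of its parent and lose those of removed children.
    By [li_up] a removed vertex has no remaining child, so its sums are its parent and the edge to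
    it. [li_lt] will give that children are numbered before parents. *)
Record leaves_inv (al : nat -> bool) cnt (s : st) : Prop := LeavesInv {
  li_root : al 0;
  li_up : forall c, 0 < c < n -> al c -> al (P c);
  li_cnt : cnt + \sum_(c <- iota 1 n.-1) al c = n.-1;
  li_deg : forall v, v < n -> al v ->
    ar s aDEG v = (v == 0) * 2 + (v != 0) + kids (fun=> 1) al v;
  li_dead : forall v, v < n -> ~~ al v -> ar s aDEG v = 0;
  li_nb : forall v, v < n -> ar s aNB v = (v != 0) * P v + kids id al v;
  li_ed : forall v, v < n -> ar s aED v = (v != 0) * pe v + kids pe al v;
  li_pos : forall v, v < n -> ~~ al v -> ar s aPOS v < cnt /\ ar s aORD (ar s aPOS v) = v;
  li_ord : forall j, j < cnt ->
    [/\ 0 < ar s aORD j < n, ~~ al (ar s aORD j) & ar s aPOS (ar s aORD j) = j];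
  li_lt : forall c, 0 < c < n -> ~~ al c ->
    al (P c) || (ar s aPOS c < ar s aPOS (P c));
  li_pos0 : ar s aPOS 0 = n.-1 }.

Lemma leaves_init s : ar s aPOS 0 = n.-1 ->
  (forall v, ar s aDEG v = (v == 0) * 2 + deg_to ea eb n.-1 v) ->
  (forall v, ar s aNB v = nb_to ea eb n.-1 v) ->
  (forall v, ar s aED v = ed_to ea eb n.-1 v) -> leaves_inv (fun v => v < n) 0 s.
Proof.
move=> e0 eD eN eE.
have split_sum (F G : nat -> nat) v : v < n ->
    \sum_(c <- iota 1 n.-1) ((c == v) * F c + (P c == v) * G c) =
    (v != 0) * F v + kids G (fun v => v < n) v.
  move=> hv; rewrite big_split sum_single hv andbT lt0n /kids /=; congr (_ + _).
  rewrite big_seq [RHS]big_seq; apply: eq_bigr => c; rewrite mem_iota => hc.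
  by have -> : c < n by lia.
have ends (H : nat -> nat -> nat) c : (forall a b, H a b = H b a) -> 0 < c < n ->
    H (ea (pe c)) (eb (pe c)) = H c (P c).
  by move=> sym /(rt_end rt)[] [-> ->].
have inr c : c \in iota 1 n.-1 -> 0 < c < n by rewrite mem_iota; lia.
split=> //.
- by move=> c hc _; apply: (rt_par rt).
- rewrite add0n -{2}(size_iota 1 n.-1) -sum1_size big_seq [RHS]big_seq.
  by apply: eq_bigr => c /inr/andP[_ ->].
- move=> v hv _; rewrite eD -addnA -[nat_of_bool (v != 0)]muln1 -split_sum //.
  rewrite /deg_to (sum_edges (fun i => (ea i == v) + (eb i == v))); congr (_ + _).
  rewrite big_seq [RHS]big_seq; apply: eq_bigr => c /inr hc.
  rewrite (ends (fun a b => (a == v) + (b == v))) ?muln1 // => a b; exact: addnC.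
- by move=> v -> .
- move=> v hv; rewrite eN -split_sum //.
  rewrite /nb_to (sum_edges (fun i => (ea i == v) * eb i + (eb i == v) * ea i)).
  rewrite big_seq [RHS]big_seq; apply: eq_bigr => c /inr hc.
  rewrite (ends (fun a b => (a == v) * b + (b == v) * a)) // => a b; exact: addnC.
- move=> v hv; rewrite eE -split_sum //.
  rewrite /ed_to (sum_edges (fun i => ((ea i == v) + (eb i == v)) * i)).
  rewrite big_seq [RHS]big_seq; apply: eq_bigr => c /inr hc.
  rewrite (ends (fun a b => ((a == v) + (b == v)) * pe c)) ?mulnDl // => a b.
  by rewrite addnC.
- by move=> v ->.
- by move=> c /andP[_ ->].
Qed.

(** The edge to the parent accounts for the whole degree 1 of [x], so no child of [x] remains, and
    removing [x] affects only the entries of its parent and its own. *)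
Lemma leaves_step al cnt s x : leaves_inv al cnt s -> 0 < x < n -> al x ->
  ar s aDEG x = 1 -> kids (fun=> 1) al x = 0 /\
  forall s', (forall v, ar s' aDEG v =
       if v == P x then ar s aDEG v - 1 else if v == x then 0 else ar s aDEG v) ->
    (forall v, ar s' aNB v = if v == P x then ar s aNB v - x else ar s aNB v) ->
    (forall v, ar s' aED v = if v == P x then ar s aED v - pe x else ar s aED v) ->
    (forall v, ar s' aPOS v = if v == x then cnt else ar s aPOS v) ->
    (forall v, ar s' aORD v = if v == cnt then x else ar s aORD v) ->
    leaves_inv (rem al x) cnt.+1 s'.
Proof.
move=> [i1 i2 i3 i4 i5 i6 i7 i8 i9 i10 i11] hx ax d1.
have xn : x < n by lia.
have kx : kids (fun=> 1) al x = 0 by have := i4 _ xn ax; rewrite d1; case: eqP; lia.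
have nox c : 0 < c < n -> al c -> P c != x.
  move=> hc ac; apply/eqP => pc; have := kids_rem (fun=> 1) x hc ac.
  by rewrite kx pc eqxx; lia.
have px : P x != x by apply: nox.
split=> // s' e1 e2 e3 e4 e5; split; rewrite /rem.
- by rewrite i1 /=; case: eqP hx => // <-.
- by move=> c hc /andP[ac cx]; rewrite i2 // nox.
- have := sum_single x (fun=> 1); rewrite hx mul1n => h1.
  have := i3; have -> : \sum_(c <- iota 1 n.-1) al c =
      \sum_(c <- iota 1 n.-1) (al c && (c != x)) + \sum_(c <- iota 1 n.-1) (c == x) * 1.
    rewrite -big_split /=; apply: eq_bigr => c _.
    by case: (eqVneq c x) => [->|_]; rewrite ?ax ?andbF ?andbT //= ?addn0.
  by rewrite h1; lia.
- move=> v vn /andP[av vx]; rewrite e1 (negbTE vx) (i4 _ vn av).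
  by rewrite (kids_rem _ v hx ax) -/(rem al x) (eq_sym v); case: (P x == v); lia.
- move=> v vn; rewrite e1 negb_and negbK => /orP[av|/eqP->].
    by rewrite (i5 _ vn av); case: (v == P x) => //; case: (v == x).
  by rewrite eq_sym (negbTE px) eqxx.
- move=> v vn; rewrite e2 (i6 _ vn) (kids_rem _ v hx ax) -/(rem al x) (eq_sym v).
  by case: (P x == v); lia.
- move=> v vn; rewrite e3 (i7 _ vn) (kids_rem _ v hx ax) -/(rem al x) (eq_sym v).
  by case: (P x == v); lia.
- move=> v vn; rewrite e4 negb_and negbK => /orP[av|/eqP->].
    have [h1 h2] := i8 _ vn av.
    have -> : (v == x) = false by apply: contraNF av => /eqP->.
    by rewrite e5 ifN ?h2; lia.
  by rewrite eqxx e5 eqxx.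
- move=> j jc; rewrite !e5; case: (eqVneq j cnt) => [->|ne].
    by rewrite eqxx andbF e4 eqxx.
  have [|h1 h2 h3] := i9 j; first by lia.
  split=> //; first by rewrite (negbTE h2).
  by rewrite e4 ifN ?h3 //; apply: contraNneq h2 => ->.
- move=> c hc; rewrite negb_and negbK !e4 => /orP[ac|/eqP->]; last first.
    by rewrite i2 // px.
  have cx : (c == x) = false by apply: contraNF ac => /eqP->.
  rewrite cx; case: (eqVneq (P c) x) => [e|_] /=; last by rewrite andbT; apply: i10.
  by rewrite andbF /=; have [] := i8 c _ ac; first by lia.
- by rewrite e4 ifN //; lia.
Qed.

(** A remaining vertex other than the root whose degree is not 1 has a remaining child, which is
    deeper. This cannot go on beyond the maximal depth. *)
Lemma leaves_done al cnt s : leaves_inv al cnt s ->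
  (forall u, 0 < u < n -> al u -> ar s aDEG u != 1) ->
  cnt = n.-1 /\ forall u, 0 < u < n -> ~~ al u.
Proof.
move=> I nd.
have D u : 0 < u < n -> ~~ al u.
  have bd c : c < n -> dep c <= \max_(c < n) dep c.
    by move=> h; apply: (@leq_bigmax _ (fun c : 'I_n => dep c) (Ordinal h)).
  move: {2}(_ - _) (leqnn (\max_(c < n) dep c - dep u)) => m.
  have K w : 0 < w < n -> al w -> exists c, [/\ 0 < c < n, al c & P c = w].
    move=> hu au; apply: kids_some; have := nd _ hu au.
    by rewrite (li_deg I) //; [case: eqP; lia | lia].
  elim: m u => [|m IH] u hm hu; apply/negP => /(K _ hu)[c [hc ac pc]].
    by have := rt_dep rt hc; rewrite pc; have := bd c; lia.
  have := rt_dep rt hc; have [_ /bd bc] := andP hc; rewrite pc => dc.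
  by apply/negP: ac; apply: IH hc; lia.
split=> //; have := li_cnt I.
rewrite big_seq big1 ?addn0 // => c; rewrite mem_iota => hc.
by rewrite (negbTE (D c _)) //; lia.
Qed.

Lemma leaves_wp (Q : nat -> st -> Prop) t s :
  vr s vn = n ->
  (forall v, ar s aDEG v = (v == 0) * 2 + deg_to ea eb n.-1 v) ->
  (forall v, ar s aNB v = nb_to ea eb n.-1 v) ->
  (forall v, ar s aED v = ed_to ea eb n.-1 v) ->
  (forall t' s', frame c_leaves s s' ->
    [/\ forall c, 0 < c < n -> ar s' aNB c = P c /\ ar s' aED c = pe c,
        forall c, 0 < c < n -> ar s' aPOS c < ar s' aPOS (P c),
        forall c, 0 < c < n -> ar s' aPOS c < n.-1 /\ ar s' aORD (ar s' aPOS c) = c,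
        forall j, j < n.-1 -> 0 < ar s' aORD j < n /\ ar s' aPOS (ar s' aORD j) = j &
        ar s' aPOS 0 = n.-1] ->
    t' <= t + 250 * n -> Q t' s') ->
  wp c_leaves Q t s.
Proof.
move=> En ED EN EE HQ; have B1 := BN1 N2 BN.
apply: wp_framed; rewrite {1}/c_leaves.
step=> _ _ -> ->; step=> _ ->; step=> _ ->.
pose I t' s' := exists al cnt v, [/\ vr s' vcnt = cnt, vr s' vv = v, 0 < v <= n &
   [/\ t' <= t + 30 + 40 * v + 150 * cnt, leaves_inv al cnt s' &
   forall u, 0 < u < v -> al u -> ar s' aDEG u != 1]].
apply: (@wp_while _ _ _ _ _ _ I (t + 190 * n + 60)).
- exists (fun v => v < n), 0, 1; split=> //=; split; [lia | | by move=> u; lia].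
  by apply: leaves_init => //=; rewrite En subn1.
- move=> t' s' [Fv _ _] [al [cnt [v [e1 e2 hv [ht li hu]]]]].
  have := li_cnt li; rewrite /=; ok.
- move=> t' s' [Fv _ _] [al [cnt [v [e1 e2 hv [ht li hu]]]]] /=.
  rewrite (Fv vn isT) /= e2 En => hlt.
  step=> _ ->.
  (* Removing a leaf can turn only its parent into a leaf, so among the vertices scanned so far the
     current [x] is the only possible leaf. *)
  pose J t2 s2 := exists al cnt x, [/\ vr s2 vcnt = cnt, vr s2 vx = x, x < n &
   [/\ t2 <= t' + 10 + 150 * (cnt - vr s' vcnt) & leaves_inv al cnt s2 /\ vr s' vcnt <= cnt] /\
   forall u, 0 < u <= v -> u != x -> al u -> ar s2 aDEG u != 1].
  apply: wp_seq.
  apply: (@wp_while _ _ _ _ _ _ J (t' + 10 + 150 * n)).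
  + exists al, cnt, v; split=> //=; split; last first.
      by move=> u h1 h2; apply: hu; lia.
    split; first by rewrite /ct /=; lia.
    by split; [case: li; split | lia].
  + move=> t2 s2 _ [al2 [cnt2 [x [f1 f2 hx [[ht2 [li2 _]] hu2]]]]] /=.
    by have := li_cnt li2; ok.
  + move=> t2 s2 [Fv2 _ _] [al2 [cnt2 [x [f1 f2 hx [[ht2 [li2 hc2]] hu2]]]]] /= /eqP.
    rewrite f2 => dx.
    have ax : al2 x by apply: contraPT dx => /(li_dead li2 hx) ->.
    have x0 : 0 < x < n.
      rewrite hx andbT lt0n; apply: contraPneq dx => e.
      by rewrite (li_deg li2) // e /=; lia.
    have [kx0 nxt] := leaves_step li2 x0 ax dx.
    have px := rt_par rt x0.
    have dpx := rt_dep rt x0.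
    have pxx : P x == x = false by apply/negP => /eqP e; rewrite e in dpx; lia.
    have nbx : ar s2 aNB x = P x.
      by rewrite (li_nb li2) // (kids_none _ kx0); case: eqP x0 => //; lia.
    have edx : ar s2 aED x = pe x.
      by rewrite (li_ed li2) // (kids_none _ kx0); case: eqP x0 => //; lia.
    have rm f := kids_rem f (P x) x0 ax.
    have apx := li_up li2 x0 ax.
    have := li_cnt li2 => cnt2E.
    have d0 : 1 <= ar s2 aDEG (P x) by rewrite (li_deg li2) // rm eqxx; lia.
    have nb0 : x <= ar s2 aNB (P x) by rewrite (li_nb li2) // rm eqxx /=; lia.
    have ed0 : pe x <= ar s2 aED (P x) by rewrite (li_ed li2) // rm eqxx /=; lia.
    step; rewrite f2 nbx => _ ->.
    step; rewrite f2 => _ _ -> ->.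
    step; first by rewrite pxx; ok.
    rewrite pxx => _ _ -> ->.
    step; rewrite f2 => _ _ -> ->.
    step; first by rewrite f2 edx; ok.
    rewrite f2 edx => _ _ -> ->.
    step; rewrite f2 f1 => _ _ -> ->.
    step; rewrite f2 f1 => _ _ -> ->.
    step; rewrite f1 => _ ->.
    step=> _ ->.
    have pcnt : 0 < \sum_(c <- iota 1 n.-1) al2 c.
      rewrite lt0n sum_nat_seq_neq0; apply/hasP; exists x; rewrite ?mem_iota ?ax //; lia.
    exists (rem al2 x), cnt2.+1, (P x); split=> //; first by rewrite /= addn1.
    split; last first.
      move=> u hu3 ux /andP[au uxx] /=; rewrite (negbTE ux) (negbTE uxx).
      by apply: hu2.
    split; first by rewrite /ct /=; lia.
    split; last by lia.
    by apply: nxt => u /=; try by case: eqP => // ->.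
  + move=> t2 s2 [Fv2 _ _] [al2 [cnt2 [x [f1 f2 hx [[ht2 [li2 hc2]] hu2]]]]] /=.
    rewrite f2 => dx.
    have := li_cnt li2 => cnt2E.
    have e3 : vr s2 vv = v by rewrite (Fv2 vv isT).
    step; rewrite e3 => _ ->.
    exists al2, cnt2, v.+1; split=> //=; rewrite ?addn1 //.
    split; first by rewrite /ct /=; lia.
    * by case: li2; split.
    * by move=> u hu3 au; case: (eqVneq u x) => [->//|ux]; apply: hu2 => //; lia.
- move=> t' s' [Fv _ _] [al [cnt [v [e1 e2 hv [ht li hu]]]]] /=.
  rewrite (Fv vn isT) /= e2 En => hlt F.
  have vE : v = n by lia.
  rewrite vE in hu.
  have [cE D] := leaves_done li hu.
  apply: HQ => //; last by rewrite /ct /=; lia.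
  split.
  + move=> c hc; have cn : c < n by lia.
    have kc f : kids f al c = 0.
      by rewrite /kids big_seq big1 // => d; rewrite mem_iota => hd; rewrite (negbTE (D d _)) //; lia.
    by rewrite (li_nb li) // (li_ed li) // !kc; case: eqP hc => //; lia.
  + move=> c hc; have := li_lt li hc (D _ hc); case: (posnP (P c)) => [->|h].
      by rewrite (li_pos0 li) -cE; case: (li_pos li _ (D _ hc)) => //; lia.
    by rewrite (negbTE (D _ _)) // h /=; apply: (rt_par rt).
  + by move=> c hc; rewrite -cE; apply: (li_pos li); [lia | apply: D].
  + by move=> j; rewrite -cE => /(li_ord li)[].
  + exact: (li_pos0 li).
Qed.

Lemma rename_wp (Q : nat -> st -> Prop) t s :
  vr s vn = n ->
  (forall j, j < n.-1 -> ar s aORD j < n) ->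
  (forall t' s', frame c_rename s s' ->
    (forall j, j < n.-1 -> ar s' aPAR j = ar s aPOS (ar s aNB (ar s aORD j)) /\
                           ar s' aPE j = ar s aED (ar s aORD j)) ->
    t' <= t + 100 * n -> Q t' s') ->
  wp c_rename Q t s.
Proof.
move=> En ho HQ; have B1 := BN1 N2 BN.
apply: wp_framed; rewrite {1}/c_rename.
step=> _ ->.
pose I t' s' := exists i, [/\ vr s' vi = i, i < n, t' <= t + 10 + 80 * i &
   forall j, j < i -> ar s' aPAR j = ar s aPOS (ar s aNB (ar s aORD j)) /\
                      ar s' aPE j = ar s aED (ar s aORD j)].
apply: (@wp_while _ _ _ _ _ _ I (t + 90 * n)).
- by exists 0; split=> //=; lia.
- by move=> t' s' [Fv _ _] [i [ei hi ht _]] /=; ok.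
- move=> t' s' [Fv Fa _] [i [ei hi ht hp]] /=.
  rewrite (Fv vn isT) /= ei En => hlt.
  rewrite /= in Fa.
  step; rewrite ei (Fa aORD isT) /= => _ ->.
  step; rewrite ei (Fa aPOS isT) (Fa aNB isT) /= => _ _ -> ->.
  step; rewrite ei (Fa aED isT) /= => _ _ -> ->.
  step; rewrite ei /= => _ ->.
  exists (i + 1); split=> //=; first by rewrite /ct /=; lia.
  by move=> j hj; case: eqVneq => [->//|ne]; apply: hp; lia.
- move=> t' s' [Fv _ _] [i [ei hi ht hp]] /=.
  rewrite (Fv vn isT) /= ei En => hlt F; apply: HQ => //; last by rewrite /ct /=; lia.
  by move=> j hj; apply: hp; lia.
Qed.

End Leaves.

(* [h] heads a linked list of the elements of [l], each stored as its
   successor, so that 0 is the null pointer. *)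
Fixpoint chain (nx : nat -> nat) h (l : seq nat) : Prop :=
  if l is x :: l' then h = x.+1 /\ chain nx (nx x) l' else h = 0.

Lemma eq_chain nx nx' h l : {in l, nx =1 nx'} -> chain nx h l -> chain nx' h l.
Proof.
elim: l h => //= x l IH h H [-> c]; split=> //; rewrite -H ?inE ?eqxx //.
by apply: IH => // y hy; apply: H; rewrite inE hy orbT.
Qed.

(** * Bucket sort of the paths by weight *)

Section Sorting.

Variables (B L OS : nat) (inp : nat -> nat) (n p k C N : nat).
Hypothesis n0 : 0 < n.
Hypothesis k0 : 0 < k.
Hypothesis NE : n + p + k + C <= N.
Hypothesis N2 : 2 <= N.
Hypothesis BN : 16 * (N * N) + 64 <= B.

Notation wp := (wp B L OS inp).

Variable wt : nat -> nat.
Hypothesis Lp : 2 * n + 1 + 3 * p <= L.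
Hypothesis inp_wt : forall i, i < p -> inp (2 * n + 1 + i * 3 + 2) = wt i.
Hypothesis wtC : forall i, i < p -> wt i <= C.

(** Reversed because every path is pushed at the head of its list. *)
Definition bucket m w := rev [seq i <- iota 0 m | wt i == w].

Lemma bucketS m w : bucket m.+1 w = if wt m == w then m :: bucket m w else bucket m w.
Proof.
rewrite /bucket -addn1 iotaD filter_cat rev_cat /= add0n.
by case: eqP.
Qed.

Lemma buckets_wp (Q : nat -> st -> Prop) t s :
  vr s vn = n -> vr s vp = p -> (forall w, ar s aHEAD w = 0) ->
  (forall t' s', frame c_buckets s s' -> vr s' vW = 2 * n + 1 -> vr s' vmw <= C ->
    (forall i, i < p -> wt i <= vr s' vmw) ->
    (forall w, chain (fun x => ar s' aNXT x.+1) (ar s' aHEAD w) (bucket p w)) ->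
    t' <= t + 100 * (n + p) -> Q t' s') ->
  wp c_buckets Q t s.
Proof.
move=> En Ep H0 HQ; have B1 := BN1 N2 BN.
apply: wp_framed; rewrite {1}/c_buckets.
step; rewrite En => _ ->; step=> _ ->; step=> _ ->.
pose I t' s' := exists i, [/\ vr s' vi = i, i <= p, t' <= t + 20 + 80 * i & [/\ vr s' vmw <= C,
   forall j, j < i -> wt j <= vr s' vmw &
   forall w, chain (fun x => ar s' aNXT x.+1) (ar s' aHEAD w) (bucket i w)]].
apply: (@wp_while _ _ _ _ _ _ I (t + 20 + 80 * p)).
- exists 0; split=> //=; lia.
- by move=> t' s' [Fv _ _] [i [ei hi ht _]] /=; ok.
- move=> t' s' [Fv _ _] [i [ei hi ht [hm hw hc]]] /=.
  rewrite ei (Fv vp isT) /= Ep => ip; have wC := wtC ip.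
  have eW : vr s' vW = n + n + 1 by rewrite (Fv vW isT).
  step; rewrite eW ei (_ : n + n + 1 = 2 * n + 1) ?inp_wt //; last by lia.
  move=> _ ->.
  step; rewrite ei addn1 => _ _ -> ->.
  step; rewrite ei addn1 => _ _ -> ->.
  have hc' x : chain (fun x0 => (if x0.+1 == i.+1 then ar s' aHEAD (wt i) else ar s' aNXT x0.+1))
      ((if x == wt i then i.+1 else ar s' aHEAD x)) (bucket i.+1 x).
    rewrite bucketS eq_sym; case: (eqVneq (wt i) x) => [<-|_] /=; rewrite ?eqxx.
      split=> //; apply: eq_chain (hc _) => y; rewrite /bucket mem_rev mem_filter mem_iota.
      by move=> /andP[_ yi]; rewrite eqSS ifN //; lia.
    apply: eq_chain (hc x) => y; rewrite /bucket mem_rev mem_filter mem_iota.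
    by move=> /andP[_ yi]; rewrite eqSS ifN //; lia.
  apply: wp_seq; step => hlt; [step => _ -> | step];
    (step; rewrite ei => _ ->; exists i.+1; split=> //=; rewrite ?addn1 //;
     first by rewrite /ct /=; lia).
  + split=> // j ji; case: (eqVneq j i) => [->//|ne].
    by apply: leq_trans (hw j _) (ltnW hlt); lia.
  + split=> // j ji; case: (eqVneq j i) => [->|ne]; first by lia.
    by apply: hw; lia.
- move=> t' s' [Fv _ _] [i [ei hi ht [hm hw hc]]] /=.
  rewrite ei (Fv vp isT) /= Ep => hip F.
  have e : i = p by lia.
  rewrite e in hw hc ht; apply: HQ => //; last by rewrite /ct /=; lia.
  by rewrite (Fv vW isT) /=; lia.
Qed.

Definition flat w := flatten [seq bucket p x | x <- iota 0 w].

Lemma flatS w : flat w.+1 = flat w ++ bucket p w.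
Proof. by rewrite /flat -addn1 iotaD map_cat flatten_cat /= cats0. Qed.

Lemma mem_bucket i w : (i \in bucket p w) = (i < p) && (wt i == w).
Proof. by rewrite mem_rev mem_filter mem_iota andbC. Qed.

Lemma mem_flat i w : (i \in flat w) = (i < p) && (wt i < w).
Proof.
elim: w => [|w IH]; first by rewrite andbF.
by rewrite flatS mem_cat IH mem_bucket -andb_orr [wt i < w.+1]ltnS [wt i <= w]leq_eqVlt orbC.
Qed.

Lemma uniq_flat w : uniq (flat w).
Proof.
elim: w => // w IH; rewrite flatS cat_uniq IH rev_uniq filter_uniq ?iota_uniq // andbT.
by apply/hasPn => i; rewrite mem_bucket mem_flat => /andP[_ /eqP->]; rewrite ltnn andbF.
Qed.

Lemma size_flat w : size (flat w) <= p.
Proof.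
rewrite -[X in _ <= X](size_iota 0); apply: uniq_leq_size; first exact: uniq_flat.
by move=> i; rewrite mem_flat mem_iota => /andP[->].
Qed.

Lemma perm_flat w : (forall i, i < p -> wt i < w) -> perm_eq (flat w) (iota 0 p).
Proof.
move=> H; apply: uniq_perm; rewrite ?uniq_flat ?iota_uniq // => i.
by rewrite mem_flat mem_iota /=; case: ltnP => // /H ->.
Qed.

Lemma pairwise_flat w : pairwise (fun i j => wt i <= wt j) (flat w).
Proof.
elim: w => // w IH; rewrite flatS pairwise_cat IH /=; apply/andP; split.
  apply/allrelP => i j; rewrite mem_flat mem_bucket => /andP[_ h] /andP[_ /eqP->].
  exact: ltnW.
have : {in bucket p w, forall i, wt i = w} by move=> i; rewrite mem_bucket => /andP[_ /eqP].
elim: (bucket p w) => //= i l IHl H; apply/andP; split.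
  by apply/allP => j hj; rewrite !H ?inE ?eqxx ?hj ?orbT.
by apply: IHl => j hj; apply: H; rewrite inE hj orbT.
Qed.

Lemma sort_wp (Q : nat -> st -> Prop) t s : vr s vmw <= C ->
  (forall i, i < p -> wt i <= vr s vmw) ->
  (forall w, chain (fun x => ar s aNXT x.+1) (ar s aHEAD w) (bucket p w)) ->
  (forall t' s' ord, frame c_sort s s' -> perm_eq ord (iota 0 p) ->
    pairwise (fun i j => wt i <= wt j) ord ->
    (forall j, j < p -> ar s' aSRT j = nth 0 ord j) ->
    t' <= t + 100 * (n + p + C) -> Q t' s') ->
  wp c_sort Q t s.
Proof.
move=> hmw hw hc HQ; have B1 := BN1 N2 BN.
apply: wp_framed; rewrite {1}/c_sort.
step=> _ ->; step=> _ ->.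
pose sv (s' : st) l := vr s' vc = size l /\ (forall j, j < size l -> ar s' aSRT j = nth 0 l j).
pose I t' s' := exists w, [/\ vr s' vw = w, w <= (vr s vmw).+1,
  t' <= t + 20 + 40 * w + 40 * size (flat w) & sv s' (flat w)].
apply: (@wp_while _ _ _ _ _ _ I (t + 20 + 40 * C.+1 + 40 * p)).
- by exists 0; split=> //=; lia.
- move=> t' s' [Fv _ _] [w [ew hw' ht _]] /=; have := size_flat w.
  by rewrite (Fv vmw isT) /=; ok.
- move=> t' s' [Fv Fa _] [w [ew hw' ht hsv]] /=.
  have emw : vr s' vmw = vr s vmw by rewrite (Fv vmw isT).
  rewrite ew emw => hlt.
  step; rewrite ew (Fa aHEAD isT) /= => _ ->.
  pose J t2 s2 := exists l r, [/\ bucket p w = l ++ r,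
    chain (fun x => ar s aNXT x.+1) (vr s2 vi) r, t2 <= t' + 20 + 40 * size l & sv s2 (flat w ++ l)].
  have sz l r : bucket p w = l ++ r -> size (flat w) + size l + size r <= p.
    by move=> e; have := size_flat w.+1; rewrite flatS e !size_cat; lia.
  apply: wp_seq; apply: (@wp_while _ _ _ _ _ _ J (t' + 20 + 40 * p)).
  + exists [::], (bucket p w); split=> //=; last by rewrite cats0.
    by rewrite /ct /=; lia.
  + by move=> t2 s2 _ [l [r [e _ ht2 _]]] /=; have := sz _ _ e; ok.
  + move=> t2 s2 [Fv2 Fa2 _] [l [[|x r] [e ch ht2 [ec hs]]]] /=.
      by rewrite [vr _ _]ch.
    case: ch => ei ch _; rewrite size_cat in ec hs.
    have sze := sz _ _ e; rewrite /= in sze.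
    have xp : x < p.
      by have := mem_bucket x w; rewrite e mem_cat inE eqxx orbT; case: (x < p).
    step; rewrite ec ei subn1 /= => _ _ -> ->.
    step; rewrite ec => _ ->.
    step; rewrite ei (Fa2 aNXT isT) (Fa aNXT isT) /= => _ ->.
    exists (rcons l x), r; split=> //=; rewrite ?cat_rcons // ?size_rcons; first by rewrite /ct /=; lia.
    split; rewrite /= -?cats1 !size_cat /=; first by lia.
    move=> j hj; rewrite catA nth_cat size_cat; case: eqVneq => [->|ne].
      by rewrite ltnn subnn.
    by rewrite ifT; [apply: hs | ]; lia.
  + move=> t2 s2 [Fv2 Fa2 _] [l [[|x r] [e ch ht2 hs]]] /=; last first.
      by case: ch => ->.
    move=> _; rewrite cats0 in e; rewrite -e -flatS in hs.
    have sze : size (flat w.+1) = size (flat w) + size l by rewrite flatS size_cat e.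
    have ew2 : vr s2 vw = w by rewrite (Fv2 vw isT).
    step; rewrite ew2 => _ ->.
    exists w.+1; split=> //=; rewrite ?addn1 // ?sze /ct /=; lia.
- move=> t' s' [Fv _ _] [w [ew hw' ht [hs1 hs2]]] /=.
  rewrite (Fv vmw isT) /= ew => hlt F.
  have pf : perm_eq (flat w) (iota 0 p).
    by apply: perm_flat => i /hw; lia.
  have := perm_size pf; rewrite size_iota => szf.
  apply: (HQ _ _ (flat w)) => //; first exact: pairwise_flat.
    by move=> j jp; apply: hs2; rewrite szf.
  by rewrite [size _]szf in ht; rewrite /ct /=; lia.
Qed.

End Sorting.

(** * The microset size and the table of logarithms *)

Lemma log2_half i : 1 < i -> Nat.log2 i = (Nat.log2 (i %/ 2)).+1.
Proof.
move=> i1; have h : 0 < i %/ 2 by rewrite divn_gt0.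
rewrite {1}(divn_eq i 2); have : i %% 2 < 2 by rewrite ltn_mod.
case: (i %% 2) => [|[|//]] _; rewrite mulnC.
  by rewrite addn0 PeanoNat.Nat.log2_double //; lia.
by rewrite addn1 -[_.+1]addn1 PeanoNat.Nat.log2_succ_double //; lia.
Qed.

Section Log.

Variables (B L OS : nat) (inp : nat -> nat) (n N : nat).
Hypothesis n0 : 0 < n.
Hypothesis NE : n <= N.
Hypothesis N2 : 2 <= N.
Hypothesis BN : 16 * (N * N) + 64 <= B.

Notation wp := (wp B L OS inp).

(** The bound is [n + 3] because the search for [b] starts at [b = 1], where [4 ^ b] is 4 even for
    [n = 1]. The table covers the masks of [b + b] bits, the maximal size of a microset. *)
Lemma log_wp (Q : nat -> st -> Prop) t s : vr s vn = n ->
  (forall i, ar s aLG i = 0) ->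
  (forall t' s' b, frame c_log s s' -> vr s' vb = b -> 0 < b -> 2 ^ (b + b) <= n + 3 ->
    n < 2 ^ (b + b).+2 ->
    (forall i, 0 < i < 2 ^ (b + b) -> ar s' aLG i = Nat.log2 i) ->
    t' <= t + 500 * n -> Q t' s') ->
  wp c_log Q t s.
Proof.
move=> En L0 HQ; have B1 := BN1 N2 BN.
apply: wp_framed; rewrite {1}/c_log.
step=> _ ->; step=> _ ->.
pose I t' s' := exists b, [/\ vr s' vb = b, vr s' vm = 2 ^ (b + b), 0 < b &
  2 ^ (b + b) <= n + 3 /\ t' <= t + 10 + 30 * b].
have small b : b <= 2 ^ (b + b) by apply: leq_trans (ltnW (ltn_expl _ (ltnSn 1))); lia.
apply: wp_seq; apply: (@wp_while _ _ _ _ _ _ I (t + 20 + 30 * (n + 3))).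
- by exists 1; split=> //=; split; [lia | rewrite /ct /=; lia].
- move=> t' s' [Fv _ _] [b [eb em b0 [hm ht]]] /=.
  by rewrite em (Fv vn isT) /= En; have := small b; ok.
- move=> t' s' [Fv _ _] [b [eb em b0 [hm ht]]] /=.
  rewrite em (Fv vn isT) /= En => hlt; have sb := small b.
  step; rewrite em => _ ->; step; rewrite eb => _ ->.
  have e4 : 2 ^ (b.+1 + b.+1) = 2 ^ (b + b) * 4.
    by rewrite addSn addnS 2!expnS; lia.
  exists b.+1; split=> //=; rewrite ?addn1 ?e4 //.
  by split; [lia | rewrite /ct /=; lia].
move=> t1 s1 [Fv Fa _] [b [eb em b0 [hm ht]]] /=.
rewrite em (Fv vn isT) /= En => hlt; have sb := small b.
step=> _ ->.
pose J t' s' := exists i, [/\ vr s' vi = i, 2 <= i <= 2 ^ (b + b), t' <= t1 + 20 + 60 * i &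
  forall j, 0 < j < i -> ar s' aLG j = Nat.log2 j].
have four : 4 <= 2 ^ (b + b) by rewrite (@leq_exp2l 2 2) //; lia.
have lg_lt i : 0 < i -> Nat.log2 i < i.
  by move=> i0; have := @PeanoNat.Nat.log2_lt_lin i; lia.
apply: (@wp_while _ _ _ _ _ _ J (t1 + 20 + 60 * (n + 3))).
- exists 2; split=> //=; [lia | rewrite /ct /=; lia |].
  by case=> [|[|j]] // _; rewrite (Fa aLG isT) /= L0.
- by move=> t' s' _ [i [ei hi ht' _]] /=; ok.
- move=> t' s' [Fv2 _ _] [i [ei hi ht' hl]] /=.
  rewrite ei (Fv2 vm isT) /= em => him.
  have hd : 0 < i %/ 2 < i by rewrite divn_gt0 ?ltn_Pdiv //; lia.
  have lgd := lg_lt _ (proj1 (andP hd)).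
  step; first by rewrite ei hl //; ok.
  rewrite ei hl // => _ _ -> ->.
  step; rewrite ei => _ ->.
  exists i.+1; split=> //=; rewrite ?addn1 //; [lia|rewrite /ct /=; lia|].
  move=> j hj; case: eqVneq => [->|ne]; first by rewrite -log2_half //; lia.
  by apply: hl; lia.
- move=> t' s' [Fv2 _ _] [i [ei hi ht' hl]] /=.
  rewrite ei (Fv2 vm isT) /= em => him F.
  apply: (HQ _ _ b) => //; first by rewrite (Fv2 vb isT).
  + by rewrite 2!expnS; lia.
  + by move=> j hj; apply: hl; lia.
  + by rewrite /ct /= in ht' *; lia.
Qed.

End Log.

(** * Partition of the tree into microsets *)

Definition cnt (h : nat -> nat) m g := \sum_(j < m) (h j == g).

Lemma cntS h m g : cnt h m.+1 g = cnt h m g + (h m == g).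
Proof. by rewrite /cnt big_ord_recr. Qed.

Lemma eq_cnt h h' m g : (forall j, j < m -> (h j == g) = (h' j == g)) ->
  cnt h m g = cnt h' m g.
Proof. by move=> H; apply: eq_bigr => j _; rewrite H. Qed.

Lemma cnt0 h m g : (forall j, j < m -> h j != g) -> cnt h m g = 0.
Proof. by move=> H; rewrite /cnt big1 // => j _; rewrite (negbTE (H _ _)). Qed.

Lemma cntU h h1 h2 m g g1 g2 :
  (forall j, j < m -> (h j == g : nat) = (h1 j == g1) + (h2 j == g2)) ->
  cnt h m g = cnt h1 m g1 + cnt h2 m g2.
Proof. by move=> H; rewrite /cnt -big_split; apply: eq_bigr => j _; rewrite H. Qed.

Section Groups.

Variables (B L OS : nat) (inp : nat -> nat) (n N b : nat) (par : nat -> nat).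
Hypothesis n0 : 0 < n.
Hypothesis NE : n <= N.
Hypothesis N2 : 2 <= N.
Hypothesis BN : 16 * (N * N) + 64 <= B.
Hypothesis b0 : 0 < b.
Hypothesis bn : b <= n + 3.
Hypothesis hpar : forall i, i < n.-1 -> i < par i < n.

Notation wp := (wp B L OS inp).

(* [hd j] says where [j < i] ended up: in the closed group [g] if [hd j = g], in
   the open group of the vertex [q] if [hd j = n + q]. *)
Record groups_inv i (ACC OG GRP CL hd : nat -> nat) : Prop := GroupsInv {
  gi_acc : forall q, i <= q < n -> ACC q = cnt hd i (n + q) /\ ACC q < b;
  gi_cl : forall g, CL g = 1 -> [/\ g < i, g < n.-1, b <= cnt hd i g & cnt hd i g <= b + b];
  gi_hd : forall j, j < i -> hd j = if CL (GRP j) == 1 then GRP j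
            else if par j < i then hd (par j) else n + par j;
  gi_grp : forall j, j < i -> GRP j <= j /\ par (GRP j) = par j;
  gi_og : forall q, i <= q < n -> ACC q != 0 ->
            [/\ OG q < i, par (OG q) = q & CL (OG q) != 1];
  gi_open : forall j, j < i -> i <= par j -> CL (GRP j) != 1 ->
            GRP j = OG (par j) /\ ACC (par j) != 0;
  gi_val : forall j, j < i -> hd j < n -> CL (hd j) = 1 }.

(** The open groups of [q] and of [i] both have fewer than [b] members, so together with [i] they
    have fewer than [2 * b]: a group that gets closed has between [b] and [2 * b] members. *)
Lemma groups_step i ACC OG GRP CL hd : i < n.-1 -> groups_inv i ACC OG GRP CL hd ->
  let q := par i in let g := if ACC q == 0 then i else OG q in
  let s := ACC q + ACC i + 1 in
  [/\ g < i.+1, s <= b + b &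
  forall ACC' OG' GRP' CL' : nat -> nat,
  (forall x, ACC' x = if x == q then if s < b then s else 0 else ACC x) ->
  (forall x, OG' x = if x == q then g else OG x) ->
  (forall x, GRP' x = if x == i then g else GRP x) ->
  (forall x, CL' x = if ~~ (s < b) && (x == g) then 1 else CL x) ->
  exists hd', groups_inv i.+1 ACC' OG' GRP' CL' hd'].
Proof.
move=> hi [i1 i2 i3 i4 i5 i6 i7] q g s.
have hq : i < q < n by apply: hpar.
have nq x y : (n + x == n + y) = (x == y) by rewrite eqn_add2l.
have [aq aqb] := i1 q ltac:(lia); have [ai aib] := i1 i ltac:(lia).
have [gi pg clg] : [/\ g < i.+1, par g = q & CL g != 1].
  rewrite /g; case: eqP => [_|/eqP a0]; last first.
    by have [h1 h2 h3] := i5 q ltac:(lia) a0; split=> //; lia.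
  by split=> //; apply/eqP => /i2[]; lia.
split=> //; first by rewrite /s; lia.
(* The vertex [i] and the open group below it join the open group of [q]. *)
pose h1 j := if (j == i) || (hd j == n + i) then n + q else hd j.
have ni j g' : g' < n -> (n + j == g') = false by lia.
have c1 : cnt h1 i.+1 (n + q) = s.
  rewrite cntS /h1 eqxx /= eqxx /s aq ai; congr (_ + _).
  apply: cntU => j ji; have -> : (j == i) = false by lia.
  by case: (eqVneq (hd j) (n + i)) => [->|] //=; rewrite ?eqxx ?nq; case: eqP; lia.
have c2 q' : i < q' -> q' != q -> cnt h1 i.+1 (n + q') = cnt hd i (n + q').
  move=> h nqq; rewrite cntS /h1 eqxx /= nq eq_sym (negbTE nqq) addn0.
  apply: eq_cnt => j ji; have -> : (j == i) = false by lia.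
  case: (eqVneq (hd j) (n + i)) => [->|] //=; rewrite !nq eq_sym (negbTE nqq).
  by case: eqP; lia.
have c3 g' : g' < n -> cnt h1 i.+1 g' = cnt hd i g'.
  move=> hg; rewrite cntS /h1 eqxx /= ni // addn0.
  apply: eq_cnt => j ji; have -> : (j == i) = false by lia.
  by case: (eqVneq (hd j) (n + i)) => [->|] //=; rewrite !ni.
have hdcl j : j < i -> CL (GRP j) == 1 -> h1 j = GRP j.
  move=> ji cl; have [gj _] := i4 j ji; have := i3 j ji; rewrite cl /h1 => ->.
  have -> : (j == i) = false by lia.
  by have -> : (GRP j == n + i) = false by lia.
have hdo j : j < i -> CL (GRP j) == 1 = false ->
    h1 j = if par j < i.+1 then h1 (par j) else n + par j.
  move=> ji cl; have := i3 j ji; rewrite cl => e.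
  have nji : (j == i) = false by lia.
  case: (ltngtP (par j) i) e => [h|h|->] e; rewrite /h1 nji e.
  - have -> : (par j == i) = false by lia.
    by have -> : par j < i.+1 by lia.
  - rewrite nq; have -> : (par j == i) = false by lia.
    by have -> : par j < i.+1 = false by lia.
  - by rewrite eqxx ltnSn eqxx.
move=> ACC' OG' GRP' CL' eA eO eG eC.
have gn : g < n by lia.
have G' j : j < i -> GRP' j = GRP j by move=> h; rewrite eG ifN //; lia.
have Gi : GRP' i = g by rewrite eG eqxx.
have g4 j : j < i.+1 -> GRP' j <= j /\ par (GRP' j) = par j.
  rewrite ltnS leq_eqVlt => /orP[/eqP->|ji]; first by rewrite Gi pg; lia.
  by rewrite G' //; apply: i4.
have Oq : OG' q = g by rewrite eO eqxx.
have grpq j : j < i -> par j = q -> CL (GRP j) != 1 -> GRP j = g.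
  move=> ji pj cl; have [|e a0] := i6 j ji _ cl; first by rewrite pj; lia.
  by rewrite pj in e a0; rewrite e /g (negbTE a0).
case: (ltnP s b) => sb in eA eC.
  exists h1; split.
  - move=> q' hq'; rewrite eA; case: (eqVneq q' q) => [->|ne]; first by rewrite c1.
    by rewrite c2 //; [apply: i1|]; lia.
  - move=> g'; rewrite eC /= => cl; have [p1 p2 p3 p4] := i2 _ cl.
    by rewrite c3; [split=> //|]; lia.
  - move=> j; rewrite ltnS leq_eqVlt !eC /= => /orP[/eqP->|ji].
      rewrite Gi (negbTE clg) ifN; last by rewrite -/q; lia.
      by rewrite /h1 eqxx.
    rewrite G' //; case: (boolP (CL (GRP j) == 1)) => cl; first exact: hdcl.
    by apply: hdo => //; apply: negbTE.
  - exact: g4.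
  - move=> q' hq'; rewrite eA eC eO /=; case: (eqVneq q' q) => [-> _|ne a0].
      by split=> //; lia.
    by have [|h2 h3 h4] := i5 q' _ a0; [lia | split=> //; lia].
  - move=> j; rewrite eC /= ltnS leq_eqVlt => /orP[/eqP->|ji] hp cl.
      by rewrite Gi -/q Oq eA eqxx; split=> //; rewrite /s; lia.
    rewrite G' // in cl *; rewrite eO eA; case: (eqVneq (par j) q) => [e|ne].
      by rewrite (grpq j) //; split=> //; rewrite /s; lia.
    by apply: i6 => //; lia.
  - move=> j; rewrite ltnS leq_eqVlt => /orP[/eqP->|ji]; rewrite /h1 ?eqxx /=; first lia.
    by rewrite eC /=; case: ifP => _ h; [lia | apply: i7].
(* The open group of [q] is large enough and is closed under the name [g]. *)
pose h2 j := if h1 j == n + q then g else h1 j.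
have nh1 j : j < i.+1 -> h1 j != g.
  rewrite ltnS leq_eqVlt /h1 => /orP[/eqP->|ji]; first by rewrite eqxx /=; lia.
  case: ifP => _; first by lia.
  by apply/eqP => e; have := i7 j ji; rewrite e => /(_ gn) h; rewrite h eqxx in clg.
exists h2; split.
- move=> q' hq'; rewrite eA; case: (eqVneq q' q) => [->|ne].
    rewrite cnt0 // => j ji; rewrite /h2; case: (eqVneq (h1 j) (n + q)) => // _.
    by rewrite eq_sym ni.
  have -> : cnt h2 i.+1 (n + q') = cnt h1 i.+1 (n + q').
    apply: eq_cnt => j ji; rewrite /h2; case: (eqVneq (h1 j) (n + q)) => [->|//].
    by rewrite nq (eq_sym q) (negbTE ne) (eq_sym g) ni.
  by rewrite c2 //; [apply: i1|]; lia.
- move=> g'; rewrite eC /=; case: (eqVneq g' g) => [-> _|ne cl].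
    have -> : cnt h2 i.+1 g = cnt h1 i.+1 (n + q) + 0.
      rewrite -(@cnt0 h1 i.+1 g nh1); apply: cntU => j ji; rewrite /h2.
      by rewrite (negbTE (nh1 j ji)); case: (eqVneq (h1 j) (n + q)) => [_|_]; rewrite ?eqxx // (negbTE (nh1 j ji)).
    by rewrite c1 addn0; split=> //; rewrite /s; lia.
  have [p1 p2 p3 p4] := i2 _ cl.
  have -> : cnt h2 i.+1 g' = cnt hd i g'.
    rewrite -c3; last lia; apply: eq_cnt => j ji; rewrite /h2.
    by case: (eqVneq (h1 j) (n + q)) => [->|//]; rewrite (eq_sym g) (negbTE ne) ni //; lia.
  by split=> //; lia.
- move=> j; rewrite ltnS leq_eqVlt !eC /= => /orP[/eqP->|ji].
    by rewrite Gi eqxx /= /h2 /h1 eqxx /= eqxx.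
  rewrite G' //; case: (eqVneq (GRP j) g) => [e|ne] /=.
    have [_ pj] := i4 j ji; rewrite e pg in pj.
    have := hdo j ji; rewrite e (negbTE clg) => /(_ erefl).
    rewrite -pj ifN; last by lia.
    by move=> e1; rewrite /h2 e1 eqxx.
  case: (boolP (CL (GRP j) == 1)) => cl.
    rewrite /h2 hdcl // ifN //; have [h _] := i4 j ji; lia.
  have := hdo j ji (negbTE cl); case: ifP => [_|hp] e; first by rewrite /h2 e.
  rewrite /h2 e nq ifN //; apply: contra ne => /eqP pj.
  by rewrite (grpq j).
- exact: g4.
- move=> q' hq'; rewrite eA eC eO /=; case: (eqVneq q' q) => [-> //|ne a0].
  have [|h3 h4 h5] := i5 q' _ a0; first lia.
  rewrite ifN; first by split=> //; lia.
  by apply: contra ne => /eqP e; rewrite -h4 e pg.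
- move=> j; rewrite eC /= ltnS leq_eqVlt => /orP[/eqP->|ji] hp.
    by rewrite Gi eqxx.
  rewrite G' //; case: (eqVneq (GRP j) g) => [//|ne] cl.
  have npq : (par j == q) = false.
    by apply: contraNF ne => /eqP pj; rewrite (grpq j).
  by rewrite eO eA npq; apply: i6 => //; lia.
- move=> j ji; rewrite eC /= /h2; case: (eqVneq (h1 j) (n + q)) => [_|_]; first by rewrite eqxx.
  case: (eqVneq (h1 j) g) => // _; move: ji.
  rewrite ltnS leq_eqVlt => /orP[/eqP->|ji]; rewrite /h1 ?eqxx /=; first lia.
  by case: ifP => _ h; [lia | apply: i7].
Qed.

Record grouped (GRP CL hd : nat -> nat) : Prop := Grouped {
  gr_hd : forall j, j < n -> hd j = if CL (GRP j) == 1 then GRP j else hd (par j);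
  gr_par : forall j, j < n.-1 -> GRP j <= j /\ par (GRP j) = par j;
  gr_root : GRP n.-1 = n.-1 /\ CL n.-1 = 1;
  gr_big : forall g, g < n.-1 -> CL g = 1 -> b <= cnt hd n g;
  gr_small : forall g, g < n -> cnt hd n g <= b + b;
  gr_lt : forall j, j < n -> hd j < n /\ CL (hd j) = 1 }.

(** The group still open below the root is united with the root to the microset [n.-1]. It may have
    fewer than [b] members, which is why [gr_big] leaves it out. *)
Lemma groups_done ACC OG GRP CL hd GRP' CL' : groups_inv n.-1 ACC OG GRP CL hd ->
  (forall x, GRP' x = if x == n.-1 then n.-1 else GRP x) ->
  (forall x, CL' x = if x == n.-1 then 1 else CL x) ->
  exists hd', grouped GRP' CL' hd'.
Proof.
move=> [i1 i2 i3 i4 i5 i6 i7] eG eC.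
pose h j := if (j == n.-1) || (hd j == n + n.-1) then n.-1 else hd j.
have E m : n.-1 < m <= n -> m = n.-1.+1 by lia.
have c g : g < n.-1 -> cnt h n g = cnt hd n.-1 g.
  move=> hg; rewrite (E n) ?cntS; last lia.
  rewrite {2}/h eqxx /= [n.-1 == g]eq_sym ltn_eqF // addn0; apply: eq_cnt => j hj.
  rewrite /h (ltn_eqF hj) /=; case: (eqVneq (hd j) (n + n.-1)) => [->|//].
  by rewrite !gtn_eqF //; lia.
have c' : cnt h n n.-1 = ACC n.-1 + 1.
  rewrite (E n) ?cntS; last lia.
  have [-> _] := i1 n.-1 ltac:(lia); rewrite {2}/h eqxx /= eqxx; congr (_ + _).
  rewrite /cnt; apply: eq_bigr => -[x hx] _ /=; congr nat_of_bool.
  rewrite /h (ltn_eqF hx) /=; case: (eqVneq (hd x) (n + n.-1)) => [_|ne]; first by rewrite eqxx.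
  apply: negbTE; apply/eqP => e; have := i7 x hx; rewrite e => /(_ ltac:(lia)) /i2[]; lia.
have val j : j < n.-1 -> hd j < n.-1 \/ hd j = n + n.-1.
  have [m] := ubnP (n - j); elim: m j => // m IH j hm hj.
  rewrite i3 //; case: ifP => [/eqP /i2[]|_]; first by left.
  case: ifP => h1; first by apply: IH; have := hpar hj; lia.
  by right; have := hpar hj; lia.
exists h; split.
- move=> j hj; rewrite eG eC; case: (eqVneq j n.-1) => [->|ne].
    by rewrite eqxx /= /h eqxx.
  have jn : j < n.-1 by lia.
  have := i3 j jn; have [gj pj] := i4 j jn.
  have -> : (GRP j == n.-1) = false by lia.
  have -> : h j = if hd j == n + n.-1 then n.-1 else hd j by rewrite /h (ltn_eqF jn).
  case: ifP => [cl ->|cl].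
    by rewrite ifN //; lia.
  have := hpar jn => hp; case: ifP => [hp' ->|hp' ->].
    by rewrite /h (ltn_eqF hp').
  have -> : par j = n.-1 by lia.
  by rewrite /h !eqxx.
- by move=> j hj; rewrite eG ltn_eqF //; apply: i4.
- by rewrite eG eC eqxx.
- by move=> g hg; rewrite eC ltn_eqF // c // => /i2[].
- move=> g hg; case: (eqVneq g n.-1) => [->|ne].
    by rewrite c'; have [_] := i1 n.-1 ltac:(lia); lia.
  rewrite c; last lia; case: (eqVneq (CL g) 1) => [/i2[]//|cl].
  rewrite cnt0 // => j hj; apply: contra cl => /eqP e.
  by rewrite -e i7 //; lia.
- move=> j hj; rewrite eC /h; case: ifP => [_|/negbT]; first by rewrite eqxx; lia.
  rewrite negb_or => /andP[jn hd1]; have [|h1|h1] := val j; first lia; last first.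
    by rewrite h1 eqxx in hd1.
  by rewrite ltn_eqF // i7; lia.
Qed.

Lemma groups_wp (Q : nat -> st -> Prop) t s : vr s vn = n -> vr s vb = b ->
  (forall i, i < n.-1 -> ar s aPAR i = par i) ->
  (forall x, ar s aACC x = 0) -> (forall x, ar s aCL x = 0) ->
  (forall t' s' hd, frame c_groups s s' -> grouped (ar s' aGRP) (ar s' aCL) hd ->
    t' <= t + 200 * n -> Q t' s') ->
  wp c_groups Q t s.
Proof.
move=> En Eb Ep A0 C0 HQ; have B1 := BN1 N2 BN.
apply: wp_framed; rewrite {1}/c_groups.
step=> _ ->.
pose I t' s' := exists i hd, [/\ vr s' vi = i, i < n, t' <= t + 10 + 150 * i &
   groups_inv i (ar s' aACC) (ar s' aOG) (ar s' aGRP) (ar s' aCL) hd].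
apply: wp_seq; apply: (@wp_while _ _ _ _ _ _ I (t + 160 * n)).
- exists 0, id; split=> //=; first lia.
  split=> //=.
  + by move=> q hq; rewrite A0 /cnt big_ord0.
  + by move=> g; rewrite C0.
  + by move=> q; rewrite A0.
- by move=> t' s' [Fv _ _] [i [hd [ei hi ht _]]] /=; ok.
- move=> t' s' [Fv Fa _] [i [hd [ei hi ht gi]]] /=.
  rewrite ei (Fv vn isT) /= En => hlt.
  have i1 : i < n.-1 by lia.
  have pi := hpar i1.
  have [g1 s2b nxt] := groups_step i1 gi.
  set q := par i in g1 s2b nxt pi *; set g := (if _ then _ else _) in g1 nxt.
  set ss := _ + _ + 1 in s2b nxt.
  have eb : vr s' vb = b by rewrite (Fv vb isT).
  step; rewrite ei (Fa aPAR isT) /= Ep // => _ ->.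
  have rest t2 S : t2 <= t' + 40 -> vr S vi = i -> vr S vq = q -> vr S vb = b ->
      ar S aACC = ar s' aACC -> ar S aGRP = ar s' aGRP -> ar S aCL = ar s' aCL ->
      (forall x, ar S aOG x = if x == q then g else ar s' aOG x) ->
    wp (vg <-- aOG![vq] ;; St aGRP vi vg ;;
    vs <-- aACC![vq] +' aACC![vi] +' #1 ;;
    If (Tlt vs vb) (St aACC vq vs) (St aACC vq #0 ;; St aCL vg #1) ;;
    vi <-- vi +' #1) I t2 S.
    move=> ht2 Si Sq Sb SA SG SC SO.
    step; rewrite Sq SO eqxx => _ ->.
    step; rewrite Si => _ _ -> ->.
    step; rewrite Sq Si SA -/ss; first by ok.
    move=> _ ->.
    have fin t3 S3 : t3 <= t' + 130 -> vr S3 vi = i ->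
        (forall x, ar S3 aACC x = if x == q then if ss < b then ss else 0 else ar s' aACC x) ->
        (forall x, ar S3 aOG x = if x == q then g else ar s' aOG x) ->
        (forall x, ar S3 aGRP x = if x == i then g else ar s' aGRP x) ->
        (forall x, ar S3 aCL x = if ~~ (ss < b) && (x == g) then 1 else ar s' aCL x) ->
        wp (vi <-- vi +' #1) I t3 S3.
      move=> ht3 Ti TA TO TG TC; step; rewrite Ti => _ ->.
      have [hd' H] := nxt _ _ _ _ TA TO TG TC.
      by exists i.+1, hd'; split=> //=; rewrite ?addn1 //; lia.
    apply: wp_seq; step; rewrite /= Sb => sb.
      step; rewrite Sq => _ _ -> ->.
      apply: fin => //=; rewrite ?sb ?SG ?SC ?SA //; by rewrite /ct /=; lia.
    step; rewrite Sq => _ _ -> ->; step => _ _ -> ->.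
    apply: fin => //=; rewrite ?(negbTE sb) ?SG ?SC ?SA //; by rewrite /ct /=; lia.
  apply: wp_seq; step => a0.
    step => _ _ -> ->; apply: rest => //=; first by rewrite /ct /=; lia.
    by move=> x; rewrite ei /g a0.
  step; apply: rest => //=; first by rewrite /ct /=; lia.
  by move=> x; rewrite /g (negbTE a0); case: eqP => [->|].
move=> t1 s1 [Fv Fa _] [i [hd [ei hi ht gi]]] /=.
rewrite ei (Fv vn isT) /= En => hlt.
have e : i = n.-1 by lia.
rewrite e in gi ht.
have en1 : vr s1 vn = n by rewrite (Fv vn isT).
step; rewrite en1 subn1 => _ _ -> ->.
step; rewrite en1 subn1 => _ _ -> -> F.
have [|| hd' G] := groups_done gi (GRP' := fun x => if x == n.-1 then n.-1 else ar s1 aGRP x)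
  (CL' := fun x => if x == n.-1 then 1 else ar s1 aCL x); [by []|by []|].
by apply: (HQ _ _ hd') => //; rewrite /ct /=; lia.
Qed.

End Groups.

Lemma testbit_pow k t : Nat.testbit (2 ^ k) t = (k == t).
Proof.
rewrite -pow_nat PeanoNat.Nat.pow2_bits_eqb.
by case: PeanoNat.Nat.eqb_spec => [->|]; rewrite ?eqxx //; case: eqP.
Qed.

(** * Ancestors in the renumbered tree *)

Section Ancestors.

Variables (n : nat) (par : nat -> nat).
Hypothesis hpar : forall i, i < n.-1 -> i < par i < n.

(** [c] is [x] or an ancestor of [x]. The fuel [n] is enough because [par] increases, and [ancE] is
    the equation without fuel. *)
Fixpoint ancf f c x :=
  (c == x) || (if f is f'.+1 then (x < n.-1) && ancf f' c (par x) else false).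

Definition anc c x := ancf n c x.

Lemma up_ind (Q : nat -> Prop) :
  (forall x, x < n -> (x < n.-1 -> Q (par x)) -> Q x) -> forall x, x < n -> Q x.
Proof.
move=> H x; have [m] := ubnP (n - x); elim: m x => // m IH x hm hx.
by apply: H => // hx'; have := hpar hx' => hp; apply: IH; lia.
Qed.

Lemma ancE c x : x < n -> anc c x = (c == x) || (x < n.-1) && anc c (par x).
Proof.
have E f f' y : n - y <= f -> n - y <= f' -> y < n -> ancf f c y = ancf f' c y.
  elim: f f' y => [|f IH] [|f'] y; try lia.
  move=> h1 h2 hy /=; case: (ltnP y n.-1) => //= h3; have := hpar h3 => h4.
  by rewrite (IH f') //; lia.
move=> hx; have nE : n = n.-1.+1 by lia.
rewrite /anc {1}nE /=; congr (_ || _); case: (ltnP x n.-1) => //= h.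
by apply: E; have := hpar h; lia.
Qed.

Lemma anc_refl x : anc x x. Proof. by rewrite /anc; case: {1}n => [|m] /=; rewrite eqxx. Qed.

Lemma anc_par c x : x < n.-1 -> anc c (par x) -> anc c x.
Proof. by move=> hx h; rewrite ancE ?hx ?h ?orbT //; lia. Qed.

Lemma anc_step c x : x < n -> anc c x -> c <> x -> x < n.-1 /\ anc c (par x).
Proof. by move=> hx; rewrite ancE // => /orP[/eqP //|/andP[]]. Qed.

Lemma anc_le c x : x < n -> anc c x -> x <= c < n.
Proof.
move: x; apply: up_ind => x hx IH; rewrite ancE // => /orP[/eqP->|/andP[h a]].
  by rewrite leqnn.
by have := IH h a; have := hpar h; lia.
Qed.

Lemma anc_trans a c x : x < n -> anc c x -> anc a c -> anc a x.
Proof.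
move: x; apply: up_ind => x hx IH; rewrite {1}ancE // => /orP[/eqP->//|/andP[h cp] ac].
by apply: anc_par => //; apply: IH.
Qed.

Lemma anc_total a c x : x < n -> anc a x -> anc c x -> a <= c -> anc c a.
Proof.
move: x; apply: up_ind => x hx IH; rewrite {1}ancE // => /orP[/eqP->//|/andP[h ap]].
rewrite ancE // => /orP[/eqP-> le|/andP[_ cp]]; last exact: IH.
have := anc_le _ ap; have := hpar h => h1 h2.
have : a = x by lia.
by move->; apply: anc_refl.
Qed.

Lemma anc_root x : x < n -> anc n.-1 x.
Proof.
move: x; apply: up_ind => x hx IH; rewrite ancE //; case: (ltnP x n.-1) => h.
  by rewrite IH // orbT.
have -> : n.-1 = x by lia.
by rewrite eqxx.
Qed.

End Ancestors.

Lemma cnt_mono h m m' g : m <= m' -> cnt h m g <= cnt h m' g.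
Proof.
move=> /subnKC <-; elim: (m' - m) => [|d IH]; first by rewrite addn0.
by rewrite addnS cntS; lia.
Qed.

(** * Bits, tops and exits of microsets *)

Section MicroFacts.

Variables (n b : nat) (par : nat -> nat).
Hypothesis hpar : forall i, i < n.-1 -> i < par i < n.

Notation anc := (anc n par).

Variables (GRP CL hd : nat -> nat).
Hypothesis gr : grouped n b par GRP CL hd.

(* The bit of [j] counts the larger members of its microset, so that ancestors
   have smaller bits. *)
Definition bt j := cnt hd n (hd j) - cnt hd j.+1 (hd j).

Lemma bt_lt j : j < n -> bt j < b + b.
Proof.
move=> hj; have [h _] := gr_lt gr hj; have := gr_small gr h.
by have := cnt_mono hd (hd j) hj; rewrite /bt cntS eqxx; lia.
Qed.

Lemma bt_mono i j : i < j -> j < n -> hd i = hd j -> bt j < bt i.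
Proof.
move=> ij jn e; rewrite /bt e.
have := cnt_mono hd (hd j) ij; have := cnt_mono hd (hd j) jn.
by rewrite cntS eqxx; lia.
Qed.

Lemma bt_inj i j : i < n -> j < n -> hd i = hd j -> bt i = bt j -> i = j.
Proof.
move=> hi hj e eb; case: (ltngtP i j) => // h.
  by have := bt_mono h hj e; lia.
by have := bt_mono h hi (esym e); lia.
Qed.

Lemma hd_top j : j < n -> exists i, [/\ i < n, anc i j, CL (GRP i) = 1 & GRP i = hd j].
Proof.
move: j; apply: (up_ind hpar) => j hj IH; have := gr_hd gr hj.
case: eqP => [cl e|cl e]; first by exists j; split=> //; apply: anc_refl.
have jn : j < n.-1.
  case: (ltnP j n.-1) => // h; case: cl; have [r1 r2] := gr_root gr.
  have -> : j = n.-1 by lia.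
  by rewrite r1.
have [i [h1 h2 h3 h4]] := IH jn; exists i; split=> //; last by rewrite e.
exact: (anc_par hpar).
Qed.

(** All tops of a microset are siblings. If [c] were a proper ancestor of [i], then a top [i'] above
    [c] would satisfy [par i' = par i <= c <= i'], although [i' < par i']. *)
Lemma hd_closed i c : i < n -> CL (GRP i) = 1 -> anc c i -> hd c = GRP i -> c = i.
Proof.
move=> hi cl ac e; case: (c =P i) => // ne.
have [hi' ap] := anc_step hpar hi ac ne.
have [g1 g2] := gr_par gr hi'; have p1 := hpar hi'.
have hp : par i < n by lia.
have h1 := anc_le hpar hp ap.
have hc : c < n by lia.
have [i' [k1 k2 k3 k4]] := hd_top hc.
have h2 := anc_le hpar hc k2.
have i'n : i' < n.-1.
  case: (ltnP i' n.-1) => // h; have e' : i' = n.-1 by lia.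
  by have [r1 _] := gr_root gr; rewrite e' r1 e in k4; lia.
have [g3 g4] := gr_par gr i'n; have p2 := hpar i'n.
by rewrite k4 e g2 in g4; lia.
Qed.

Definition exit_ok (EX : nat -> nat) := forall i, i < n.-1 -> CL (GRP i) = 1 -> EX (GRP i) = par i.

(** The tops of a microset have a common parent, so every way up leaves the microset to the same
    vertex. *)
Lemma exit_anc EX j : exit_ok EX -> j < n -> hd j != n.-1 ->
  [/\ hd j < n.-1, EX (hd j) < n, j < EX (hd j), anc (EX (hd j)) j &
      forall c, anc c j -> hd c != hd j -> anc c (EX (hd j))].
Proof.
move=> He; move: j; apply: (up_ind hpar) => j hj IH hr.
have [h1 _] := gr_lt gr hj; have := gr_hd gr hj.
have jn : j < n.-1.
  case: (ltnP j n.-1) => // h; have [r1 r2] := gr_root gr; have e : j = n.-1 by lia.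
  by move: hr; rewrite e (gr_hd gr) ?r1 ?r2 ?eqxx //; lia.
have hp := hpar jn.
case: eqP => [cl e|cl e].
  rewrite !e (He _ jn cl); split; try lia.
    by apply: (anc_par hpar) => //; apply: anc_refl.
  move=> c ac hc; have [|_ //] := anc_step hpar hj ac.
  by move=> ec; rewrite ec e eqxx in hc.
have [|k1 k2 k3 k4 k5] := IH jn; first by rewrite -e.
rewrite !e; split=> //; try lia; first exact: (anc_par hpar).
move=> c ac hc; apply: k5 => //; have [|_ //] := anc_step hpar hj ac.
by move=> ec; rewrite ec e eqxx in hc.
Qed.

Definition in_micro j t := exists c, [/\ c < n, anc c j, hd c = hd j & bt c = t].

End MicroFacts.

(** * Construction of the microset tables *)

Section Micro.

Variables (B L OS : nat) (inp : nat -> nat) (n N b : nat) (par : nat -> nat).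
Hypothesis n0 : 0 < n.
Hypothesis NE : n <= N.
Hypothesis N2 : 2 <= N.
Hypothesis BN : 16 * (N * N) + 64 <= B.
Hypothesis b0 : 0 < b.
Hypothesis bn : 2 ^ (b + b) <= n + 3.
Hypothesis hpar : forall i, i < n.-1 -> i < par i < n.

Notation wp := (wp B L OS inp).
Notation anc := (anc n par).

Variables (GRP CL hd : nat -> nat).
Hypothesis gr : grouped n b par GRP CL hd.

Notation bt := (bt n hd).
Notation in_micro := (in_micro n par hd).

Let bt_lt := bt_lt gr.
Let hd_closed := hd_closed hpar gr.

Record micro_inv i (s : st) : Prop := MicroInv {
  mi_ms : forall j, i <= j < n -> ar s aMS j = hd j;
  mi_bm : forall j, i <= j < n -> ar s aBM j = 2 ^ bt j;
  mi_tbl : forall j, i <= j < n -> ar s aTBL (hd j * (b + b) + bt j) = j;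
  mi_anc : forall j t, i <= j < n -> Nat.testbit (ar s aANC j) t <-> in_micro j t;
  mi_unm : forall j, i <= j < n -> Nat.testbit (ar s aUNM (hd j)) (bt j);
  mi_cs : forall g, ar s aCS g + cnt hd i g = cnt hd n g;
  mi_grp : forall j, i <= j < n.-1 -> CL (GRP j) = 1 ->
    [/\ ar s aEX (GRP j) = par j, ar s aLAB (GRP j) = GRP j, ar s aTOP (GRP j) = GRP j &
        ar s aHD (GRP j) = (GRP j).+1 /\ ar s aSZ (GRP j) = 1] }.

Lemma micro_wp (Q : nat -> st -> Prop) t s : vr s vn = n -> vr s vb = b ->
  (forall i, i < n.-1 -> ar s aPAR i = par i) ->
  ar s aGRP = GRP -> ar s aCL = CL ->
  (forall x, ar s aCS x = 0) ->
  (forall t' s', frame c_micro s s' -> micro_inv 0 s' -> t' <= t + 300 * n -> Q t' s') ->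
  wp c_micro Q t s.
Proof.
move=> En Eb Ep EG EC C0 HQ; have B1 := BN1 N2 BN.
apply: wp_framed; rewrite {1}/c_micro.
step; rewrite En => _ ->.
pose I t' s' := exists i, [/\ vr s' vi = i, i <= n, t' <= t + 10 + 200 * (n - i) & micro_inv i s'].
have bb : b + b <= n + 3 by apply: leq_trans (ltnW (ltn_expl _ (ltnSn 1))) bn.
apply: (@wp_while _ _ _ _ _ _ I (t + 210 * n)).
- exists n; split=> //=; first lia.
  by split=> //=; try (by move=> j; lia); move=> g; rewrite C0.
- by move=> t' s' [Fv _ _] [i [ei hi ht _]] /=; ok.
- move=> t' s' [Fv Fa _] [i1 [ei hi ht mi]] /=; rewrite ei => h0.
  have [i eI] : exists i, i1 = i.+1 by exists i1.-1; lia.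
  rewrite {}eI in ei hi ht mi h0.
  have hpi : i < n.-1 -> ar s' aPAR i = par i.
    by move=> h; rewrite (Fa aPAR isT) /= Ep.
  have eG : ar s' aGRP = GRP by rewrite (Fa aGRP isT).
  have eC : ar s' aCL = CL by rewrite (Fa aCL isT).
  have eb : vr s' vb = b by rewrite (Fv vb isT).
  have [hdl hdc] := gr_lt gr hi; have hde := gr_hd gr hi.
  step; rewrite ei subn1 /= => _ ->.
  step=> _ ->; step; rewrite eG => _ ->.
  set q := ar s' aPAR i.
  have rest t2 S : t2 <= t' + 90 -> vr S vi = i -> vr S vb = b -> vr S vs = hd i ->
      (forall u, Nat.testbit (Nat.lor (vr S va) (2 ^ bt i)) u <-> in_micro i u) ->
      ar S aMS = ar s' aMS -> ar S aBM = ar s' aBM -> ar S aTBL = ar s' aTBL ->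
      ar S aANC = ar s' aANC -> ar S aUNM = ar s' aUNM -> ar S aCS = ar s' aCS ->
      (forall j, i <= j < n.-1 -> CL (GRP j) = 1 ->
    [/\ ar S aEX (GRP j) = par j, ar S aLAB (GRP j) = GRP j, ar S aTOP (GRP j) = GRP j &
        ar S aHD (GRP j) = (GRP j).+1 /\ ar S aSZ (GRP j) = 1]) ->
    wp (vt <-- aCS![vs] ;; vmk <-- Bin Bshl #1 vt ;;
    St aMS vi vs ;; St aBM vi vmk ;; St aANC vi (Bin Bor va vmk) ;;
    St aUNM vs (Bin Bor (aUNM![vs]) vmk) ;;
    St aTBL (vs *' (vb +' vb) +' vt) vi ;;
    St aCS vs (vt +' #1)) I t2 S.
    move=> ht2 Si Sb Ss Sa SMS SBM STBL SANC SUNM SCS Sg.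
    (* Vertices are visited downwards from the root, so the counter of a microset has counted
       exactly the members larger than [i]. *)
    have tE : ar s' aCS (hd i) = bt i by have := mi_cs mi (hd i); rewrite /bt; lia.
    have bti := bt_lt hi.
    have pw : 2 ^ bt i <= n + 3 by apply: leq_trans bn; rewrite leq_exp2l //; lia.
    have ml : hd i * (b + b) <= 4 * (N * N).
      apply: leq_trans (_ : N * (4 * N) <= _); last by lia.
      by apply: leq_mul; lia.
    step; rewrite Ss SCS tE => _ ->.
    step; rewrite mul1n => _ ->.
    step; rewrite Si Ss => _ _ -> ->.
    step; rewrite Si => _ _ -> ->.
    step; rewrite Si => _ _ -> ->.
    step; rewrite Ss SUNM => _ _ -> ->.
    step; try by (rewrite Ss Sb; ok).
    rewrite Ss Sb Si => _ _ -> ->.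
    step; rewrite Ss => _ _ -> ->.
    exists i; split=> //=; first by rewrite ltnW.
      by rewrite /ct /=; lia.
    split=> /=; rewrite ?SMS ?SBM ?STBL ?SANC ?SUNM ?SCS.
    + by move=> j hj; case: eqVneq => [->//|ne]; apply: (mi_ms mi); lia.
    + by move=> j hj; case: eqVneq => [->//|ne]; apply: (mi_bm mi); lia.
    (* Bits are below [b + b], so a table cell determines the microset and the bit, and these
       determine the vertex. *)
    + move=> j hj; case: eqVneq => [e|ne].
        case: (ltngtP j i) => // h; first lia.
        have jn : j < n by lia.
        have btj := bt_lt jn.
        have e1 : hd j = hd i.
          have := congr1 (divn^~ (b + b)) e; rewrite !divnMDl ?(divn_small bti) ?(divn_small btj); lia.
        by have := bt_mono h jn (esym e1); rewrite e1 in e; lia.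
      by apply: (mi_tbl mi); case: (ltngtP j i) => h; [lia|lia|]; rewrite h eqxx in ne.
    + by move=> j u hj; case: eqVneq => [->|ne]; [apply: Sa | apply: (mi_anc mi); lia].
    + move=> j hj; case: (eqVneq j i) => [->|ne].
        by rewrite eqxx PeanoNat.Nat.lor_spec testbit_pow eqxx; case: Nat.testbit.
      have u := mi_unm mi (_ : i < j < n); case: eqVneq => [e|_]; last by apply: u; lia.
      by rewrite PeanoNat.Nat.lor_spec -e u //; lia.
    + move=> g; have := mi_cs mi g; rewrite cntS (eq_sym (hd i)).
      by case: eqVneq => [->|_] /=; rewrite ?tE; lia.
    + exact: Sg.
  have lorb a u : Nat.testbit (Nat.lor a (2 ^ bt i)) u = Nat.testbit a u || (u == bt i).
    by rewrite PeanoNat.Nat.lor_spec testbit_pow eq_sym; case: Nat.testbit.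
  apply: wp_seq; step; rewrite /= eC => cl.
    rewrite cl in hde; move/eqP: cl => cl.
    step=> _ ->; step=> _ ->; step=> _ _ -> ->; step=> _ _ -> ->; step=> _ _ -> ->.
    step; try by (rewrite -hde; ok).
    move=> _ _ -> ->; step=> _ _ -> ->.
    apply: rest => //=; first by rewrite /ct /=; lia.
    + move=> u; rewrite lorb PeanoNat.Nat.bits_0 /=; split=> [/eqP->|[c [h1 h2 h3 h4]]].
        by exists i; split=> //; apply: anc_refl.
      by rewrite -h4 (hd_closed (i := i) (c := c)) // h3.
    (* A microset with several tops is initialised several times, always with the same values, since
       its tops have the same parent. *)
    + move=> j hj clj; case: (eqVneq (GRP j) (GRP i)) => [e|ne].
        rewrite ?addn1; split; rewrite ?e //; case: (ltnP i n.-1) => hin; last by lia.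
        have [_ p1] := gr_par gr hin; have [|_ p2] := @gr_par _ _ _ _ _ _ gr j; first lia.
        by rewrite /q hpi // -p1 -p2 e.
      apply: (mi_grp mi) => //; case: (eqVneq j i) => [ej|]; last lia.
      by rewrite ej eqxx in ne.
  rewrite (negbTE cl) in hde.
  have hin : i < n.-1.
    case: (ltnP i n.-1) => // h; have [r1 r2] := gr_root gr.
    have ie : i = n.-1 by lia.
    by move: cl; rewrite ie r1 r2 eqxx.
  have := hpar hin => hp; rewrite /q hpi // in rest *.
  step=> _ ->; step=> _ ->.
  apply: rest => //=; first by rewrite /ct /=; lia.
  + by rewrite (mi_ms mi) //; lia.
  + move=> u; rewrite lorb; split=> [/orP[/(mi_anc mi)|/eqP->]|[c [h1 h2 h3 h4]]].
    * case; first lia.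
      by move=> c [h1 h2 h3 h4]; exists c; rewrite hde; split=> //; apply: (anc_par hpar).
    * by exists i; split=> //; apply: anc_refl.
    * case: (c =P i) => [<-|ne]; first by rewrite h4 eqxx orbT.
      have [_ ap] := anc_step hpar hi h2 ne.
      have -> // : Nat.testbit (ar s' aANC (par i)) u.
      by apply/(mi_anc mi); [lia | exists c; rewrite -hde].
  + move=> j hj clj; apply: (mi_grp mi) => //; case: (eqVneq j i) => [ej|]; last lia.
    by move/eqP: cl; rewrite -ej clj.
- move=> t' s' [Fv Fa _] [i [ei hi ht mi]] /=; rewrite ei => h0 F.
  have e : i = 0 by lia.
  by rewrite e in mi ht; apply: HQ => //; rewrite /ct /=; lia.
Qed.

End Micro.

Lemma trunc_logD a c : 0 < a -> a <= c -> trunc_log 2 a < trunc_log 2 (a + c).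
Proof.
by move=> a0 ac; rewrite -trunc_log2_double //; apply: leq_trunc_log; lia.
Qed.

(** * Union and find *)

Section Union.

Variables (B L OS : nat) (inp : nat -> nat) (n N : nat).
Hypothesis NE : n <= N.
Hypothesis N2 : 2 <= N.
Hypothesis BN : 16 * (N * N) + 64 <= B.

Notation wp := (wp B L OS inp).

Variable el : seq nat.
Hypothesis uel : uniq el.
Hypothesis el_lt : forall g, g \in el -> g < n.

Lemma size_el : size el <= n.
Proof.
rewrite -[X in _ <= X](size_iota 0); apply: uniq_leq_size => // g /el_lt.
by rewrite mem_iota.
Qed.

Definition classes (LAB NX HD SZ : nat -> nat) := forall s, s \in el -> exists C,
  [/\ chain NX (HD (LAB s)) C, uniq C, SZ (LAB s) = size C &
      forall h, (h \in C) = (h \in el) && (LAB h == LAB s)].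

Lemma size_filter_sum (P : pred nat) : size [seq g <- el | P g] = \sum_(g <- el) P g.
Proof. by rewrite -sum1_size big_filter big_mkcond; apply: eq_bigr => g _; case: (P g). Qed.

(** The potential of relabelling the smaller class: how often the class of each element can still
    double. *)
Definition phi (LAB SZ : nat -> nat) :=
  \sum_(g <- el) (trunc_log 2 n - trunc_log 2 (SZ (LAB g))).

(** Each of the [a] elements of the smaller class ends in a class at least twice as large, so its
    term drops. The bound [n] on the united size keeps the subtraction from truncating. *)
Lemma phi_union (LAB SZ LAB' SZ' : nat -> nat) la lb a :
  a = \sum_(g <- el) (LAB g == la) -> 0 < a -> SZ la = a -> SZ la <= SZ lb ->
  SZ la + SZ lb <= n -> SZ' lb = SZ la + SZ lb -> la != lb ->
  (forall x, x != lb -> SZ' x = SZ x) ->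
  (forall g, g \in el -> LAB' g = if LAB g == la then lb else LAB g) ->
  phi LAB' SZ' + a <= phi LAB SZ.
Proof.
move=> ea a0 sa le len e ne eS eL.
rewrite /phi ea -big_split /= big_seq [X in _ <= X]big_seq; apply: leq_sum => g hg.
rewrite eL //; case: (eqVneq (LAB g) la) => [->|_] /=.
  rewrite e; have := trunc_logD (_ : 0 < SZ la) le; rewrite sa => /(_ a0).
  by have := @leq_trunc_log 2 _ _ len; rewrite sa; lia.
rewrite addn0; case: (eqVneq (LAB g) lb) => [->|h]; last by rewrite eS.
rewrite e; have := @leq_trunc_log 2 (SZ lb) (SZ la + SZ lb); lia.
Qed.

(** Sizes decide only which label survives; the top is always that of the class of [g2], which the
    search uses as the upper one. The drop of [phi] pays for the relabelling and leaves 100 units to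
    the iteration of the search that calls it. *)
Lemma union_wp (Q : nat -> st -> Prop) t s g1 g2 l1 l2 :
  vr s vs = g1 -> vr s vs2 = g2 -> g1 \in el -> g2 \in el ->
  ar s aLAB g1 = l1 -> ar s aLAB g2 = l2 -> l1 != l2 ->
  classes (ar s aLAB) (ar s aNX) (ar s aHD) (ar s aSZ) ->
  (forall t' s' l, frame c_union s s' ->
     classes (ar s' aLAB) (ar s' aNX) (ar s' aHD) (ar s' aSZ) ->
     l = l1 \/ l = l2 ->
     (forall g, g \in el -> ar s' aLAB g =
        if (ar s aLAB g == l1) || (ar s aLAB g == l2) then l else ar s aLAB g) ->
     (forall x, ar s' aTOP x = if x == l then ar s aTOP l2 else ar s aTOP x) ->
     phi (ar s' aLAB) (ar s' aSZ) < phi (ar s aLAB) (ar s aSZ) ->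
     t' + 400 * phi (ar s' aLAB) (ar s' aSZ) + 100 <= t + 400 * phi (ar s aLAB) (ar s aSZ) ->
     Q t' s') ->
  wp c_union Q t s.
Proof.
move=> es es2 g1e g2e L1 L2 l12 cl HQ; have B1 := BN1 N2 BN.
have szn l : (exists2 g, g \in el & ar s aLAB g = l) -> ar s aSZ l <= n.
  case=> g ge <-; have [C [_ uC -> mC]] := cl g ge.
  apply: leq_trans size_el; apply: uniq_leq_size => // h.
  by rewrite mC => /andP[].
apply: wp_framed; rewrite {1}/c_union.
step; rewrite es L1 => _ ->; step; rewrite es2 L2 => _ ->; step=> _ ->.
have rest la lb ga gb t1 s1 : t1 <= t + 60 -> vr s1 vla = la -> vr s1 vlb = lb ->
    vr s1 vtt = ar s aTOP l2 -> ga \in el -> gb \in el ->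
    ar s aLAB ga = la -> ar s aLAB gb = lb ->
    (la = l1 /\ lb = l2 \/ la = l2 /\ lb = l1) -> ar s aSZ la <= ar s aSZ lb ->
    ar s1 = ar s ->
  wp (vh <-- aHD![vla] ;;
  While (Tlt #0 vh) (
    vg <-- vh -' #1 ;; vu <-- aNX![vg] ;;
    St aLAB vg vlb ;; St aNX vg (aHD![vlb]) ;; St aHD vlb vh ;; vh <-- vu) ;;
  St aSZ vlb (aSZ![vlb] +' aSZ![vla]) ;; St aTOP vlb vtt)
   (fun t' s' => frame c_union s s' -> Q t' s') t1 s1.
  move=> ht1 ela elb ett gae gbe La Lb lab le ea.
  have ne : la != lb by case: lab => -[-> ->] //; rewrite eq_sym.
  have [Ca [ca ua sa ma]] := cl _ gae; have [Cb [cb ub sb mb]] := cl _ gbe.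
  rewrite La in ca sa ma; rewrite Lb in cb sb mb.
  have dis x : x \in Ca -> x \notin Cb.
    by rewrite ma mb => /andP[_ /eqP->]; rewrite (negbTE ne) andbF.
  step; rewrite ela ea => _ ->.
  (* [D] consists of the elements already relabelled; they were pushed one by one on the list of
     [lb], hence [rev D]. *)
  pose J t2 s2 := exists D E, [/\ Ca = D ++ E, t2 <= t1 + 20 + 60 * size D,
    chain (ar s2 aNX) (vr s2 vh) E, chain (ar s2 aNX) (ar s2 aHD lb) (rev D ++ Cb) &
    [/\ forall x, ar s2 aLAB x = if x \in D then lb else ar s aLAB x,
        forall x, x \notin D -> ar s2 aNX x = ar s aNX x &
        forall x, x != lb -> ar s2 aHD x = ar s aHD x]].
  apply: wp_seq; apply: (@wp_while _ _ _ _ _ _ J (t1 + 20 + 60 * size Ca)).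
  - by exists [::], Ca; rewrite /= ea; split=> //; rewrite /=; slia.
  - by move=> t2 s2 _ [D [E [-> h _ _ _]]] /=; rewrite size_cat; ok.
  - move=> t2 s2 [Fv2 Fa2 _] [D [[|x E] [e ht2 ch1 ch2 [k1 k2 k3]]]] /=.
      by rewrite [vr _ _]ch1.
    case: ch1 => ex ch1 _.
    have elb2 : vr s2 vlb = lb by rewrite (Fv2 vlb isT).
    have xn : x < n.
      by apply: el_lt; have := ma x; rewrite e mem_cat inE eqxx orbT; case: (x \in el).
    step; rewrite ex subn1 /= => _ ->.
    step=> _ ->; step; rewrite elb2 => _ _ -> ->.
    step; rewrite elb2 => _ _ -> ->.
    step; rewrite elb2 ex => _ _ -> ->.
    step=> _ ->.
    have := ua; rewrite e cat_uniq /= negb_or => /and3P[_ /andP[xD _] /andP[xE _]].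
    have xCb : x \notin Cb by apply: dis; rewrite e mem_cat inE eqxx orbT.
    exists (rcons D x), E; split; rewrite /= ?cat_rcons ?size_rcons //.
    + by rewrite /ct /=; slia.
    + by apply: eq_chain ch1 => y yE; case: eqVneq => // ey; rewrite -ey yE in xE.
    + rewrite eqxx rev_rcons /= eqxx; split=> //.
      apply: eq_chain ch2 => y; rewrite mem_cat mem_rev => hy; case: eqVneq => // ey.
      by move: hy; rewrite ey (negbTE xD) (negbTE xCb).
    + split=> y.
      * by rewrite mem_rcons inE; case: eqP => //= _; apply: k1.
      * by rewrite mem_rcons inE negb_or => /andP[/negbTE-> h]; apply: k2.
      * by move=> h; rewrite (negbTE h); apply: k3.
  - move=> t2 s2 [Fv2 Fa2 _] [D [[|x E] [e ht2 ch1 ch2 [k1 k2 k3]]]] /=; last first.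
      by case: ch1 => ->.
    move=> _; rewrite cats0 in e; rewrite -{}e in k1 k2 ch2 ht2; clear ch1.
    have elb2 : vr s2 vlb = lb by rewrite (Fv2 vlb isT).
    have ela2 : vr s2 vla = la by rewrite (Fv2 vla isT).
    have ett2 : vr s2 vtt = ar s aTOP l2 by rewrite (Fv2 vtt isT).
    have eS2 : ar s2 aSZ = ar s aSZ by rewrite (Fa2 aSZ isT) /= ea.
    have eT2 : ar s2 aTOP = ar s aTOP by rewrite (Fa2 aTOP isT) /= ea.
    have sza : ar s aSZ la <= n by apply: szn; exists ga.
    have szb : ar s aSZ lb <= n by apply: szn; exists gb.
    step; first by rewrite elb2 ela2 eS2; ok.
    rewrite elb2 ela2 eS2 => _ _ -> ->.
    step; rewrite elb2 ett2 => _ _ -> -> F.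
    have eL' g : g \in el -> ar s2 aLAB g = if ar s aLAB g == la then lb else ar s aLAB g.
      by move=> ge; rewrite k1 ma ge.
    have Ca0 : 0 < size Ca.
      by case: Ca {ca ua sa dis J k1 k2 ch2 ht2} ma => // /(_ ga); rewrite gae La eqxx.
    have phi_lt : phi (ar s2 aLAB) (fun x => if x == lb then ar s aSZ lb + ar s aSZ la else ar s aSZ x)
        + size Ca <= phi (ar s aLAB) (ar s aSZ).
      apply: (@phi_union _ _ _ _ la lb) => //; rewrite ?eqxx.
      * rewrite -(size_filter_sum (fun g => ar s aLAB g == la)); apply: perm_size; apply: uniq_perm => //.
          exact: filter_uniq.
        by move=> h; rewrite ma mem_filter andbC.
      * rewrite sa sb -size_cat; apply: leq_trans size_el; apply: uniq_leq_size.
          by rewrite cat_uniq ua ub andbT; apply/hasPn => h; apply: contraL => /dis.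
        by move=> h; rewrite mem_cat ma mb => /orP[]/andP[].
      * by rewrite addnC.
      * by move=> x /negbTE->.
    apply: (HQ _ _ lb) => //=; rewrite ?eS2 ?eT2 //.
    + move=> g ge; rewrite /= eL' //; case: (eqVneq (ar s aLAB g) la) => [eg|nla].
        exists (rev Ca ++ Cb); rewrite eqxx size_cat size_rev cat_uniq rev_uniq ua ub andbT.
        split=> //; [|slia|].
          by apply/hasPn => h; rewrite mem_rev; apply: contraL => /dis.
        move=> h; rewrite mem_cat mem_rev ma mb; case he : (h \in el) => //=.
        by rewrite eL' //; case: (eqVneq (ar s aLAB h) la); rewrite ?eqxx.
      case: (eqVneq (ar s aLAB g) lb) => [eg|nlb].
        exists (rev Ca ++ Cb); rewrite eg size_cat size_rev cat_uniq rev_uniq ua ub andbT.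
        split=> //; [|slia|].
          by apply/hasPn => h; rewrite mem_rev; apply: contraL => /dis.
        move=> h; rewrite mem_cat mem_rev ma mb; case he : (h \in el) => //=.
        by rewrite eL' //; case: (eqVneq (ar s aLAB h) la); rewrite ?eqxx.
      have [C [cC uC sC mC]] := cl _ ge; exists C; split=> //.
        rewrite k3 //; apply: eq_chain cC => h hC; rewrite k2 // ma.
        by move: hC; rewrite mC => /andP[_ /eqP->]; rewrite (negbTE nla) andbF.
      move=> h; rewrite mC; case he : (h \in el) => //=; rewrite eL' //.
      case: (eqVneq (ar s aLAB h) la) => // ->.
      by rewrite eq_sym (negbTE nla) eq_sym (negbTE nlb).
    + by case: lab => -[_ ->]; [right|left].
    + move=> g ge; rewrite eL' //.
      by case: lab => -[-> ->]; case: eqP => //= h1; case: eqP => //= h2; rewrite ?h2.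
    + apply: leq_trans phi_lt; slia.
    + rewrite /ct /=; slia.
apply: wp_seq; step => hlt.
  step=> _ ->; step=> _ ->; step=> _ ->.
  by apply: (rest l2 l1 g2 g1) => //=; [rewrite /ct /=; slia | right | apply: ltnW].
step; apply: (rest l1 l2 g1 g2) => //=; [rewrite /ct /=; slia | left | rewrite leqNgt]; done.
Qed.

End Union.

(** * Search for the nearest unmarked ancestor *)

Section Find.

Variables (B L OS : nat) (inp : nat -> nat) (n N b : nat) (par : nat -> nat).
Hypothesis n0 : 0 < n.
Hypothesis NE : n <= N.
Hypothesis N2 : 2 <= N.
Hypothesis BN : 16 * (N * N) + 64 <= B.
Hypothesis b0 : 0 < b.
Hypothesis bn : 2 ^ (b + b) <= n + 3.
Hypothesis hpar : forall i, i < n.-1 -> i < par i < n.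

Notation wp := (wp B L OS inp).
Notation anc := (anc n par).

Variables (GRP CL hd : nat -> nat).
Hypothesis gr : grouped n b par GRP CL hd.

Notation bt := (bt n hd).
Notation in_micro := (in_micro n par hd).

Record static (s : st) : Prop := Static {
  sc_b : vr s vb = b;
  sc_ms : forall j, j < n -> ar s aMS j = hd j;
  sc_tbl : forall j, j < n -> ar s aTBL (hd j * (b + b) + bt j) = j;
  sc_anc : forall j t, j < n -> Nat.testbit (ar s aANC j) t <-> in_micro j t;
  sc_lg : forall i, 0 < i < 2 ^ (b + b) -> ar s aLG i = Nat.log2 i;
  sc_ex : exit_ok n par GRP CL (ar s aEX) }.

(** The microset of the root is left out: it has no exit, and a search that reaches it stops there
    because the root is never marked. *)
Definition els := [seq g <- iota 0 n.-1 | CL g == 1].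

Lemma mem_els g : (g \in els) = (CL g == 1) && (g < n.-1).
Proof. by rewrite mem_filter mem_iota. Qed.

Lemma uniq_els : uniq els. Proof. by rewrite filter_uniq ?iota_uniq. Qed.

Lemma els_lt g : g \in els -> g < n. Proof. by rewrite mem_els; lia. Qed.

Lemma hd_els j : j < n -> hd j != n.-1 -> hd j \in els.
Proof.
move=> hj ne; have [h1 h2] := gr_lt gr hj; rewrite mem_els h2 eqxx /=.
by move: ne h1; case: ltngtP; lia.
Qed.

Lemma hd_root z d : z < n -> hd z = n.-1 -> anc d z -> hd d = n.-1.
Proof.
move: z; apply: (up_ind hpar) => z hz IH e ad.
case: (d =P z) => [->//|ne]; have [hz' ap] := anc_step hpar hz ad ne.
apply: IH => //; have := gr_hd gr hz; rewrite e; case: eqP => // _ e'.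
by have [h _] := gr_par gr hz'; lia.
Qed.

(* All vertices from [x] up to its ancestor [y], excluded, are marked. *)
Definition cov (mk : nat -> bool) x y := anc y x /\ forall c, anc c x -> ~~ anc c y -> mk c.

Lemma cov_refl mk x : cov mk x x.
Proof. by split=> [|c ->//]; apply: anc_refl. Qed.

Lemma cov_trans mk x y z : x < n -> cov mk x y -> cov mk y z -> cov mk x z.
Proof.
move=> hx [a1 c1] [a2 c2]; split; first exact: (anc_trans hpar) a1 a2.
by move=> c cx cz; case: (boolP (anc c y)) => cy; [apply: c2 | apply: c1].
Qed.

Definition unmasks (s : st) (mk : nat -> bool) := forall j, j < n ->
  Nat.testbit (ar s aUNM (hd j)) (bt j) = ~~ mk j.

(** [uf_cov] compares exits only, so it is preserved when more vertices get marked: marking does not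
    touch the classes. *)
Record uf (mk : nat -> bool) (s : st) : Prop := Uf {
  uf_top : forall g, g \in els -> ar s aTOP (ar s aLAB g) \in els /\
    ar s aLAB (ar s aTOP (ar s aLAB g)) = ar s aLAB g;
  uf_cov : forall g, g \in els -> cov mk (ar s aEX g) (ar s aEX (ar s aTOP (ar s aLAB g)));
  uf_cls : classes els (ar s aLAB) (ar s aNX) (ar s aHD) (ar s aSZ) }.

Definition phis (s : st) := phi n els (ar s aLAB) (ar s aSZ).

Section Query.

Variables (mk : nat -> bool).
Hypothesis mk_root : ~~ mk n.-1.

Lemma els_exit s g : static s -> g \in els -> ar s aEX g < n.
Proof.
move=> sc; rewrite mem_els => /andP[/eqP cl hg].
have c0 : 0 < cnt hd n g by apply: leq_trans (gr_big gr hg cl).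
have [j hj e] : exists2 j, j < n & hd j = g.
  move: c0; rewrite lt0n /cnt sum_nat_eq0 negb_forall => /existsP[[j hj]] /=.
  by rewrite eqb0 negbK => /eqP e; exists j.
have ne : hd j != n.-1 by rewrite e; lia.
by have [_ + _ _ _] := exit_anc hpar gr (sc_ex sc) hj ne; rewrite e.
Qed.

(** Ancestors have smaller bits, so the highest bit of the mask is the nearest unmarked ancestor
    inside the microset. If the mask is zero, everything up to the exit is marked, and the microset
    cannot be that of the root. *)
Lemma micro_mask s z : static s -> unmasks s mk -> z < n ->
  let m := Nat.land (ar s aANC z) (ar s aUNM (hd z)) in
  (m = 0 -> hd z != n.-1 /\ cov mk z (ar s aEX (hd z))) /\
  (m <> 0 -> exists r, [/\ r < n, ~~ mk r, cov mk z r, 0 < m < 2 ^ (b + b) &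
     hd z * (b + b) + Nat.log2 m = hd r * (b + b) + bt r]).
Proof.
move=> sc um hz m.
have bit c : c < n -> anc c z -> hd c = hd z -> ~~ mk c -> Nat.testbit m (bt c).
  move=> hc ac e mc; rewrite PeanoNat.Nat.land_spec; apply/andP; split.
    by apply/(sc_anc sc) => //; exists c.
  by rewrite -e um.
have tib t : Nat.testbit m t -> exists c, [/\ c < n, anc c z, hd c = hd z, bt c = t & ~~ mk c].
  rewrite PeanoNat.Nat.land_spec => /andP[/(sc_anc sc) h h2].
  by have [c [h3 h4 h5 h6]] := h hz; exists c; split=> //; rewrite -um // h6 h5.
split=> [m0|m1].
  have mkc c : c < n -> anc c z -> hd c = hd z -> mk c.
    move=> hc ac e; apply/negPn/negP => /(bit _ hc ac e).
    by rewrite m0 PeanoNat.Nat.bits_0.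
  have ne : hd z != n.-1.
    apply/eqP => e; have := mk_root; rewrite mkc ?anc_root //; first lia.
    have [r1 r2] := gr_root gr.
    by rewrite e (gr_hd gr) ?r1 ?r2 ?eqxx //; lia.
  have [h1 h2 h3 h4 h5] := exit_anc hpar gr (sc_ex sc) hz ne.
  split=> //; split=> // c ac nac; have := anc_le hpar hz ac => hc.
  apply: mkc => //; first by lia.
  by apply/eqP; apply: contraNT nac; apply: h5.
have tb := PeanoNat.Nat.bit_log2 m m1.
have [c [hc ac e bc mc]] := tib _ tb.
have mlt : m < 2 ^ (b + b).
  apply: bits_lt => i hi; apply/negP => /tib[d [hd' _ _ bd _]].
  by have := bt_lt gr hd'; lia.
exists c; split=> //; [|by lia|by rewrite e bc].
split=> // d ad nad; apply/negPn/negP => md.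
have hd' := anc_le hpar hz ad; have hc' := anc_le hpar hz ac.
have dc : d < c.
  rewrite ltnNge; apply: contra nad => cd; exact: (anc_total hpar hz ac ad).
have dn : d < n by lia.
(* [d] would be an unmarked ancestor of [z] below the vertex [c] found. In the microset of [z] its
   bit would exceed [log2 m]; in another one it would lie at or above the exit, which is above
   [c]. *)
case: (eqVneq (hd d) (hd z)) => ed.
  have := bt_mono dc hc (etrans ed (esym e)).
  have := bit _ dn ad ed md => tbd lt.
  have : ~ (Nat.log2 m < bt d).
    by move=> /ltP /PeanoNat.Nat.bits_above_log2; rewrite tbd.
  by rewrite -bc; lia.
have ne : hd z != n.-1.
  by apply/eqP => er; case/eqP: ed; rewrite er; apply: hd_root ad.
have [h1 h2 h3 h4 h5] := exit_anc hpar gr (sc_ex sc) hz ne.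
have hcz : hd c != n.-1 by rewrite e.
have [_ _ k3 _ _] := exit_anc hpar gr (sc_ex sc) hc hcz; rewrite e in k3.
have dz := h5 _ ad ed; have := anc_le hpar h2 dz; lia.
Qed.

Lemma find_wp (Q : nat -> st -> Prop) t s z : vr s vz = z -> z < n ->
  static s -> unmasks s mk -> uf mk s ->
  (forall t' s', frame c_find s s' -> uf mk s' -> vr s' vz < n -> ~~ mk (vr s' vz) ->
    cov mk z (vr s' vz) -> t' + 400 * phis s' <= t + 400 * phis s + 400 -> Q t' s') ->
  wp c_find Q t s.
Proof.
move=> ez hz sc0 um0 uf0 HQ; have B1 := BN1 N2 BN.
apply: wp_framed; rewrite {1}/c_find.
step; rewrite ez (sc_ms sc0) // => _ ->; step; rewrite ez => _ ->.
(* Iterations that unite classes are paid by the potential. At most one iteration, the last, does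
   not; the 200 units held back while the mask is zero pay for it. *)
pose I t' s' := exists z', [/\ vr s' vz = z', z' < n, vr s' vs = hd z', cov mk z z' & 
  [/\ vr s' vm = Nat.land (ar s aANC z') (ar s aUNM (hd z')), uf mk s' &
  t' + 400 * phis s' + (vr s' vm == 0) * 200 <= t + 400 * phis s + 250]].
have sub s' : frame c_find s s' -> static s'.
  move=> [Fv Fa _]; case: sc0 => h1 h2 h3 h4 h5 h6.
  by split; rewrite ?(Fa aMS isT) ?(Fa aTBL isT) ?(Fa aANC isT) ?(Fa aLG isT) ?(Fa aEX isT) ?(Fv vb isT).
apply: wp_seq; apply: (@wp_while _ _ _ _ _ _ I (t + 400 * phis s + 250)).
- exists z; split=> //=; first exact: cov_refl.
  split=> //; first by case: uf0.
  by rewrite /phis /=; case: (_ == 0); slia.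
- by move=> t' s' _ [z' [_ _ _ _ [_ _ h]]] /=; ok.
- move=> t1 s1 [Fv Fa Fo] [z1 [ez1 hz1 es1 cv1 [em1 uf1 ht1]]] /= /eqP m0.
  rewrite m0 /= in ht1; rewrite {}em1 in m0.
  have sc1 : static s1.
    case: sc0 => h1 h2 h3 h4 h5 h6.
    by split; rewrite ?(Fa aMS isT) ?(Fa aTBL isT) ?(Fa aANC isT) ?(Fa aLG isT) ?(Fa aEX isT) ?(Fv vb isT).
  have [/(_ m0)[hr cv2] _] := micro_mask sc0 um0 hz1.
  have he := hd_els hz1 hr.
  have eEX : ar s1 aEX = ar s aEX by rewrite (Fa aEX isT).
  have [te teq] := uf_top uf1 he; set tp := ar s1 aTOP _ in te teq.
  have cv3 := uf_cov uf1 he; rewrite -/tp eEX in cv3.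
  have hx := els_exit sc0 he; have hz2 := els_exit sc0 te.
  have cv4 : cov mk z (ar s aEX tp).
    by apply: cov_trans cv1 _ => //; apply: cov_trans cv2 _.
  step; rewrite es1 -/tp => _ ->.
  step; rewrite eEX => _ ->.
  step; rewrite (Fa aMS isT) /= (sc_ms sc0) // => _ ->.
  set z2 := ar s aEX tp in hz2 cv3 cv4 *.
  step; rewrite (Fa aANC isT) (Fa aUNM isT) /= => _ ->.
  have [mm0 mm1] := micro_mask sc0 um0 hz2.
  apply: wp_seq; step => hm; last first.
    step; step=> _ ->.
    exists z2; split=> //; split=> //=; first by case: uf1.
    by rewrite (negbTE hm); rewrite /phis /ct /= in ht1 *; slia.
  have {mm0}[hr2 cv5] := mm0 (eqP hm).
  have he2 := hd_els hz2 hr2; have [te2 teq2] := uf_top uf1 he2.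
  have cv6 := uf_cov uf1 he2; rewrite eEX in cv6.
  have hx2 := els_exit sc0 he2; have hz3 := els_exit sc0 te2.
  (* In a common class the top would be [tp], with exit [z2]; but the exit of the top lies at or
     above the exit of the microset of [z2], hence above [z2]. *)
  have ne : ar s1 aLAB tp != ar s1 aLAB (hd z2).
    apply/eqP => e; have [a6 _] := cv6.
    have e2 : ar s1 aTOP (ar s1 aLAB (hd z2)) = tp by rewrite -e teq.
    rewrite e2 -/z2 in a6; have := anc_le hpar hx2 a6.
    by have [_ _ k _ _] := exit_anc hpar gr (sc_ex sc0) hz2 hr2; slia.
  apply: (@union_wp _ _ _ _ _ _ NE N2 BN _ uniq_els els_lt _ _ _ tp (hd z2)
    (ar s1 aLAB tp) (ar s1 aLAB (hd z2))) => //=.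
    exact: (uf_cls uf1).
  move=> t2 s2 l [Fv2 Fa2 _] cls2 hl eL eT ph ht2.
  step; rewrite (Fv2 vs2 isT) /= => _ ->.
  have eEX2 : ar s2 aEX = ar s aEX by rewrite (Fa2 aEX isT) /= eEX.
  exists z2; split=> //=; first by rewrite (Fv2 vz isT).
  split; first by rewrite (Fv2 vm isT).
  + split=> //=; rewrite ?eEX2 -/z2.
    * move=> g ge; rewrite eL // eT; have [ge1 ge2] := uf_top uf1 ge.
      case: (boolP (_ || _)) => [h|/negbTE h] /=.
        rewrite eqxx; split=> //; rewrite eL //.
        by rewrite teq2 eqxx orbT.
      have -> : (ar s1 aLAB g == l) = false.
        by apply/negP => /eqP e; move: h; rewrite e; case: hl => ->; rewrite eqxx ?orbT.
      by split=> //; rewrite eL // ge2 h.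
    * move=> g ge; rewrite eL // eT; have := uf_cov uf1 ge; rewrite eEX => cg.
      have hg := els_exit sc0 ge.
      case: (eqVneq (ar s1 aLAB g) (ar s1 aLAB tp)) => [e1|n1] /=.
        rewrite eqxx; apply: cov_trans (cov_trans _ cv5 cv6) => //.
        by move: cg; rewrite e1 teq.
      case: (eqVneq (ar s1 aLAB g) (ar s1 aLAB (hd z2))) => [e2|n2] /=.
        by rewrite eqxx -e2.
      case: eqP => // e; exfalso; move: n1 n2; rewrite e.
      by case: hl => ->; rewrite eqxx.
  + rewrite (Fv2 vm isT) /= (eqP hm) /= /phis /=.
    by rewrite /phis /ct /= in ht1 ht2 *; slia.
move=> t1 s1 [Fv Fa Fo] [z1 [ez1 hz1 es1 cv1 [em1 uf1 ht1]]] /= m0.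
have [_ mm] := micro_mask sc0 um0 hz1; rewrite em1 in m0.
have [r [hr mr cr mlt er]] := mm (fun e => negP m0 (introT eqP e)).
have vb1 : vr s1 vb = b by rewrite (Fv vb isT) /= (sc_b sc0).
have eLG : ar s1 aLG (vr s1 vm) = Nat.log2 (vr s1 vm).
  by rewrite (Fa aLG isT) /= em1 (sc_lg sc0).
have bb : b + b <= n + 3 by apply: leq_trans (ltnW (ltn_expl _ (ltnSn 1))) bn.
have [hdl _] := gr_lt gr hr; have btl := bt_lt gr hr.
have ml : hd r * (b + b) <= 4 * (N * N).
  apply: leq_trans (_ : N * (4 * N) <= _); last by lia.
  by apply: leq_mul; slia.
step; first by rewrite es1 vb1 eLG em1; ok.
rewrite es1 vb1 eLG em1 er (Fa aTBL isT) /= (sc_tbl sc0) // => _ -> F.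
apply: HQ => //=; rewrite ?em1 ?(negbTE m0) in ht1 *.
- by case: uf1.
- exact: cov_trans cv1 cr.
- by rewrite /phis /ct /= in ht1 *; slia.
Qed.

End Query.
End Find.

(** * Processing the paths *)

Section Paths.

Variables (B L OS : nat) (inp : nat -> nat) (n p k N b : nat) (par : nat -> nat).
Hypothesis n0 : 0 < n.
Hypothesis k0 : 0 < k.
Hypothesis NE : n + p + k <= N.
Hypothesis N2 : 2 <= N.
Hypothesis BN : 16 * (N * N) + 64 <= B.
Hypothesis b0 : 0 < b.
Hypothesis bn : 2 ^ (b + b) <= n + 3.
Hypothesis hpar : forall i, i < n.-1 -> i < par i < n.
Hypothesis OSE : n.-1 * k.+1 <= OS.
Hypothesis Lp : 2 * n + 1 + 3 * p <= L.

Notation wp := (wp B L OS inp).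
Notation anc := (anc n par).

Variables (GRP CL hd : nat -> nat).
Hypothesis gr : grouped n b par GRP CL hd.

Notation bt := (bt n hd).
Notation static := (static n b par GRP CL hd).
Notation unmasks := (unmasks n hd).
Notation uf := (uf n par CL).
Notation phis := (phis n CL).
Notation cov := (cov n par).

Variables (PE X Y : nat -> nat).
Hypothesis PE_lt : forall c, c < n.-1 -> PE c < n.-1.
Hypothesis PE_inj : forall c d, c < n.-1 -> d < n.-1 -> PE c = PE d -> c = d.
Hypothesis X_lt : forall i, i < p -> X i < n.
Hypothesis Y_lt : forall i, i < p -> Y i < n.

(** The edge from [c] to its parent lies on the path between [x] and [y]. *)
Definition on c x y := anc c x != anc c y.

(** These are the marked vertices, whose parent edge is contracted. The root has no such edge, so
    every search ends. *)
Definition full (r : nat -> seq nat) c := (c < n.-1) && (size (r c) == k).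

Definition total (r : nat -> seq nat) := \sum_(c < n.-1) size (r c).

Record setup (s : st) : Prop := Setup {
  su_sc : static s;
  su_par : forall j, j < n.-1 -> ar s aPAR j = par j;
  su_pe : forall j, j < n.-1 -> ar s aPE j = PE j;
  su_bm : forall j, j < n -> ar s aBM j = 2 ^ bt j;
  su_k : vr s vk = k;
  su_p : vr s vp = p;
  su_W : vr s vW = 2 * n + 1;
  su_X : forall i, i < p -> ar s aPOS (inp (2 * n + 1 + i * 3)) = X i;
  su_Y : forall i, i < p -> ar s aPOS (inp (2 * n + 1 + i * 3 + 1)) = Y i }.

Record rows (r : nat -> seq nat) (s : st) : Prop := Rows {
  ro_size : forall c, c < n.-1 -> size (r c) <= k;
  ro_cnt : forall c, c < n.-1 -> ou s (PE c * k.+1) = size (r c);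
  ro_nth : forall c j, c < n.-1 -> j < size (r c) -> ou s (PE c * k.+1 + j.+1) = nth 0 (r c) j;
  ro_mask : unmasks s (full r);
  ro_uf : uf (full r) s }.

Definition add (r : nat -> seq nat) x i := fun c => if c == x then rcons (r c) i else r c.

Lemma total_add r x i : x < n.-1 -> total (add r x i) = (total r).+1.
Proof.
move=> hx; rewrite /total (bigD1 (Ordinal hx)) //= [in RHS](bigD1 (Ordinal hx)) //=.
rewrite /add eqxx size_rcons addSn; congr (_ + _).+1.
by apply: eq_bigr => -[c hc]; rewrite -(inj_eq val_inj) /= => /negbTE->.
Qed.

Lemma cov_sub (mk mk' : nat -> bool) x y : (forall c, mk c -> mk' c) -> cov mk x y -> cov mk' x y.
Proof. by move=> H [h1 h2]; split=> // c cx cy; apply/H/h2. Qed.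

Lemma uf_sub (mk mk' : nat -> bool) s : (forall c, mk c -> mk' c) -> uf mk s -> uf mk' s.
Proof. by move=> H [h1 h2 h3]; split=> // g hg; apply: cov_sub (h2 _ hg). Qed.

Lemma setup_frame c s s' : frame c s s' ->
  {subset ma c <= [:: aLAB; aNX; aHD; aSZ; aTOP; aUNM]} ->
  {subset mv c <= [:: vi; vz; vs; vm; vs2; vx; vy; vh; ve; vc; vg; vu; vla; vlb; vtt; vj]} ->
  setup s -> setup s'.
Proof.
move=> [Fv Fa _] Sa Sv [[h1 h2 h3 h4 h5 h6] h7 h8 h9 h10 h11 h12 h13 h14].
have A j : j \notin [:: aLAB; aNX; aHD; aSZ; aTOP; aUNM] -> ar s' j = ar s j.
  by move=> h; apply: Fa; apply: contra h => /Sa.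
have V x : x \notin [:: vi; vz; vs; vm; vs2; vx; vy; vh; ve; vc; vg; vu; vla; vlb; vtt; vj] -> vr s' x = vr s x.
  by move=> h; apply: Fv; apply: contra h => /Sv.
split; rewrite ?(A aPAR isT) ?(A aPE isT) ?(A aBM isT) ?(A aPOS isT) ?(V vk isT) ?(V vp isT) ?(V vW isT) //.
by split; rewrite ?(V vb isT) ?(A aMS isT) ?(A aTBL isT) ?(A aANC isT) ?(A aLG isT) ?(A aEX isT).
Qed.

(** Dividing an offset by [k.+1] recovers the row, so different rows do not interfere. *)
Lemma rows_out r s x i c : rows r s -> x < n.-1 -> size (r x) < k -> c < n.-1 ->
  let o := fun a => if a == PE x * k.+1 + (size (r x)).+1 then i
           else if a == PE x * k.+1 then (size (r x)).+1 else ou s a in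
  o (PE c * k.+1) = size (add r x i c) /\
  forall j, j < size (add r x i c) -> o (PE c * k.+1 + j.+1) = nth 0 (add r x i c) j.
Proof.
move=> R hx sx hc o.
have dv q a : a <= k -> (q * k.+1 + a) %/ k.+1 = q.
  by move=> h; rewrite divnMDl // divn_small ?addn0.
have sep a a' : a <= k -> a' <= k -> c != x -> (PE c * k.+1 + a == PE x * k.+1 + a') = false.
  move=> h h' ne; apply: contraNF ne => /eqP/(congr1 (divn^~ k.+1)).
  by rewrite !dv // => /(PE_inj hc hx)->.
rewrite /o /add; case: (eqVneq c x) => [->|ne].
  rewrite size_rcons; split.
    by rewrite eqxx ifN //; lia.
  move=> j; rewrite ltnS leq_eqVlt => /orP[/eqP->|hj].
    by rewrite eqxx nth_rcons ltnn eqxx.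
  rewrite nth_rcons hj ifN; last by lia.
  by rewrite ifN ?(ro_nth R) //; lia.
have sc := ro_size R hc.
have [s1 s2 s3] : [/\ (PE c * k.+1 == PE x * k.+1 + (size (r x)).+1) = false,
    (PE c * k.+1 == PE x * k.+1) = false &
    forall j, j.+1 <= k -> (PE c * k.+1 + j.+1 == PE x * k.+1) = false].
  split=> [||j jk]; [have := sep 0 (size (r x)).+1|have := sep 0 0|have := sep j.+1 0];
    by rewrite ?addn0; apply.
split; first by rewrite s1 s2 (ro_cnt R).
by move=> j hj; rewrite sep ?s3 ?(ro_nth R) //; lia.
Qed.

Lemma full_add r x i c : x < n.-1 -> size (r x) < k ->
  full (add r x i) c = full r c || (c == x) && ((size (r x)).+1 == k).
Proof.
move=> hx sx; rewrite /full /add; case: (eqVneq c x) => [->|]; last by rewrite orbF.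
by rewrite size_rcons hx /= (ltn_eqF sx).
Qed.

Definition step_rows (r : nat -> seq nat) i c :=
  if (size (r c) < k) && on c (X i) (Y i) then rcons (r c) i else r c.

Let mk_root r : ~~ full r n.-1. Proof. by rewrite /full ltnn. Qed.

Let nN : n <= N. Proof. lia. Qed.

Lemma rows_find r s s' : frame c_find s s' -> uf (full r) s' -> rows r s -> rows r s'.
Proof.
move=> [_ Fa Fo] u [h1 h2 h3 h4 _]; split; rewrite ?(Fo isT) //.
by rewrite /unmasks (Fa aUNM isT).
Qed.

Lemma setup_find s s' : frame c_find s s' -> setup s -> setup s'.
Proof. by move=> F; apply: (setup_frame F); apply/allP. Qed.

(* What remains to be done between [x] and [y] of the path from [x0] to [y0]. *)
Record walk (r0 r : nat -> seq nat) i x0 y0 x y : Prop := Walk {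
  wa_x : x < n;
  wa_y : y < n;
  wa_le : forall c, c < n.-1 -> size (r0 c) <= k;
  wa_nx : ~~ full r x;
  wa_ny : ~~ full r y;
  wa_anc : anc x x0 /\ anc y y0 \/ anc x y0 /\ anc y x0;
  wa_on : forall c, c < n.-1 -> size (r0 c) < k ->
    (on c x y -> on c x0 y0) /\
    r c = if on c x0 y0 && ~~ on c x y then rcons (r0 c) i else r0 c;
  wa_full : forall c, c < n.-1 -> k <= size (r0 c) -> r c = r0 c }.

Lemma onC c x y : on c x y = on c y x. Proof. by rewrite /on eq_sym. Qed.

Lemma walk_sym r0 r i x0 y0 x y : walk r0 r i x0 y0 x y -> walk r0 r i x0 y0 y x.
Proof.
move=> [h1 h2 hs h3 h4 h5 h6 h7]; split=> //; first by case: h5 => -[a c]; [right|left].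
by move=> c hc sc; rewrite (onC c y x); apply: h6.
Qed.

Lemma walk_start r i x0 y0 x y : x0 < n -> y0 < n -> x < n -> y < n ->
  (forall c, c < n.-1 -> size (r c) <= k) ->
  ~~ full r x -> ~~ full r y -> cov (full r) x0 x -> cov (full r) y0 y ->
  walk r r i x0 y0 x y.
Proof.
move=> hx0 hy0 hx hy sz fx fy [ax cx] [ay cy]; split=> //; first by left.
move=> c hc sc.
have nf : ~~ full r c by rewrite /full hc (ltn_eqF sc).
have e z0 z : z0 < n -> anc z z0 -> (forall d, anc d z0 -> ~~ anc d z -> full r d) -> anc c z = anc c z0.
  move=> hz0 az cz; apply/idP/idP => h; first exact: (anc_trans hpar) az h.
  by apply: contraNT nf => h'; apply: cz.
by rewrite /on (e x0 x) // (e y0 y) //; case: (_ != _).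
Qed.

Lemma walk_step r0 r i x0 y0 x y x' : x0 < n -> y0 < n ->
  walk r0 r i x0 y0 x y -> x < y -> let r1 := add r x i in
  x < n.-1 /\ size (r x) < k /\
  (x' < n -> ~~ full r1 x' -> cov (full r1) (par x) x' -> walk r0 r1 i x0 y0 x' y).
Proof.
move=> hx0 hy0 [hx hy hs fx fy ha ho hf] xy r1.
have hx1 : x < n.-1 by lia.
have hp := hpar hx1; have hpn : par x < n by lia.
have nayx : anc x y = false.
  by apply/negP => /(anc_le hpar hy); lia.
have onx : on x x y by rewrite /on anc_refl nayx.
have sx0 : size (r0 x) < k.
  rewrite ltnNge; apply/negP => h; have e := hf _ hx1 h.
  by move: fx; rewrite /full hx1 e eqn_leq hs // h.
have [on0 rx] := ho _ hx1 sx0.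
have srx : size (r x) < k by rewrite rx onx andbF.
split=> //; split=> // hx' fx' [ax' cx']; split=> //.
- rewrite full_add // (negbTE fy) /=; apply/negP => /andP[/eqP e _].
  by rewrite e ltnn in xy.
- case: ha => -[a c]; [left|right]; split=> //.
    by apply: (anc_trans hpar) a _ => //; apply: (anc_par hpar).
  by apply: (anc_trans hpar) a _ => //; apply: (anc_par hpar).
- move=> c hc sc; case: (eqVneq c x) => [->|ne].
    have -> : on x x' y = false.
      rewrite /on nayx; have -> // : anc x x' = false.
      by apply/negP => /(anc_le hpar hx'); have := anc_le hpar hpn ax'; slia.
    by rewrite (on0 onx) /r1 /add eqxx rx onx andbF.
  have [h1 h2] := ho _ hc sc.
  have r1c : r1 c = r c by rewrite /r1 /add (negbTE ne).
  have acx : anc c x = anc c (par x).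
    by rewrite (ancE hpar) // (negbTE ne) hx1.
  have e : anc c x' = anc c x.
    rewrite acx; apply/idP/idP => h; first exact: (anc_trans hpar) ax' h.
    (* A skipped [c] whose row had room in [r0] was filled by this walk, so it is on the whole path
       but not between [x] and [y]. Being above [x], it is then above [y] and both ends of the path,
       which contradicts its being on the path. *)
    apply: contraT => nc; have := cx' _ h nc; rewrite full_add // (negbTE ne) orbF.
    rewrite /full hc h2; case: ifP => [/andP[o1 o2] _|_]; last by rewrite (ltn_eqF sc).
    rewrite -acx in h; rewrite /on h negbK eq_sym eqb_id in o2.
    by case: ha o1 => -[a a']; rewrite /on (anc_trans hpar _ a h) // (anc_trans hpar _ a' o2).
  by rewrite r1c /on e.
- move=> c hc sc; rewrite /r1 /add; case: eqP => [e|_]; last exact: hf.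
  by rewrite e in sc; slia.
Qed.

Lemma walk_end r0 r i x0 y0 x c : walk r0 r i x0 y0 x x -> c < n.-1 ->
  r c = if (size (r0 c) < k) && on c x0 y0 then rcons (r0 c) i else r0 c.
Proof.
move=> W hc; case: (ltnP (size (r0 c)) k) => sc /=; last exact: (wa_full W).
by have [_ ->] := wa_on W hc sc; rewrite /(on c x x) eqxx andbT.
Qed.

Lemma total_le r : (forall c, c < n.-1 -> size (r c) <= k) -> total r <= n * k.
Proof.
move=> h; apply: leq_trans (_ : n.-1 * k <= _); last by apply: leq_mul; lia.
by apply: (@sum_le n.-1 (fun c => size (r c))).
Qed.

(** The row of [x] had room, so its mask bit is set and the exclusive or clears it. *)
Lemma mask_step r s s' x i : setup s -> rows r s -> x < n.-1 -> size (r x) < k ->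
  (forall g, ar s' aUNM g = if (size (r x)).+1 == k then
     if g == hd x then Nat.lxor (ar s aUNM (hd x)) (ar s aBM x) else ar s aUNM g
     else ar s aUNM g) ->
  unmasks s' (full (add r x i)).
Proof.
move=> su ro hx sx e j hj; rewrite e full_add //; have := ro_mask ro hj.
case: eqP => _; last by rewrite andbF orbF.
rewrite andbT; case: (eqVneq (hd j) (hd x)) => [eh|ne] h.
  rewrite -eh PeanoNat.Nat.lxor_spec h (su_bm su) ?testbit_pow; last by lia.
  case: (eqVneq j x) => [->|nx]; first by rewrite eqxx /full (ltn_eqF sx) andbF.
  have -> : (bt x == bt j) = false.
    case: eqP => // eb; case/eqP: nx.
    by apply: (bt_inj hj _ eh (esym eb)); lia.
  by rewrite orbF; case: (full r j).
have -> : (j == x) = false by apply: contraNF ne => /eqP->.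
by rewrite orbF.
Qed.

(** Each insertion earns 1000 units for its iteration, including the 400 of a search. The 2000 fixed
    units cover the two initial searches and the end of the loop. *)
Lemma path_wp (Q : nat -> st -> Prop) t s r i :
  ar s aSRT (vr s vj) = i -> i < p -> setup s -> rows r s ->
  (forall c, c < n.-1 -> PE c * k.+1 + k.+1 <= n * k.+1) ->
  (forall t' s' r', frame c_path s s' -> setup s' -> rows r' s' ->
    (forall c, c < n.-1 -> r' c = step_rows r i c) ->
    t' + 400 * phis s' + 1000 * total r <= t + 400 * phis s + 2000 + 1000 * total r' ->
    Q t' s') ->
  (forall x, x < p -> inp (2 * n + 1 + x * 3) < n /\ inp (2 * n + 1 + x * 3 + 1) < n) ->
  wp c_path Q t s.
Proof.
move=> ei ip su ro pek HQ hin; have B1 := BN1 N2 BN.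
have FW r0 := find_wp L OS inp n0 nN N2 BN b0 bn hpar gr (mk_root r0).
have hx0 := X_lt ip; have hy0 := Y_lt ip.
have hkk : n * k.+1 <= N * N by apply: leq_mul; lia.
apply: wp_framed; rewrite {1}/c_path.
step; rewrite ei => _ ->.
step; first by rewrite (su_W su); ok.
rewrite (su_W su) (su_X su) // => _ ->.
apply: wp_seq; apply: (FW r _ _ _ _ _ hx0).
- by [].
- by case: (su_sc su); split.
- exact: (ro_mask ro).
- by case: (ro_uf ro); split.
move=> t1 s1 F1 u1 x1n x1f c1 ht1.
have su1 : setup s1 by apply: (setup_find F1); case: su => -[*]; split.
have ro1 : rows r s1 by apply: (rows_find F1) => //; case: ro => [a1 a2 a3 a4 [a5 a6 a7]]; split.
have [F1v _ _] := F1.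
step=> x ex; step; first by rewrite (su_W su1) (F1v vi isT) /=; ok.
rewrite (su_W su1) (F1v vi isT) /= (su_Y su1) // => _ ->.
rewrite -ex in x1n x1f c1.
apply: wp_seq; apply: (FW r _ _ _ _ _ hy0).
- by [].
- by case: (su_sc su1); split.
- exact: (ro_mask ro1).
- by case: u1; split.
move=> t2 s2 F2 u2 y2n y2f c2 ht2.
have su2 : setup s2 by apply: (setup_find F2); case: su1 => -[*]; split.
have ro2 : rows r s2 by apply: (rows_find F2) => //; case: ro1 => [a1 a2 a3 a4 [a5 a6 a7]]; split.
have [F2v _ _] := F2.
step=> y ey; rewrite -ey in y2n y2f c2.
have W0 : walk r r i (X i) (Y i) x y by apply: walk_start => //; apply: (ro_size ro).
pose I t' s' := exists x y r', [/\ vr s' vx = x, vr s' vy = y, vr s' vi = i & [/\ setup s', rows r' s',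
   walk r r' i (X i) (Y i) x y &
   t' + 400 * phis s' + 1000 * total r <= t + 400 * phis s + 1500 + 1000 * total r']].
set M := t + 400 * phis s + 2000 + 1000 * (n * k).
apply: (@wp_while _ _ _ _ _ _ I M).
- exists x, y, r; split=> //=.
    by rewrite (F2v vx isT).
    by rewrite (F2v vi isT) /= (F1v vi isT).
  split=> //; first by case: su2 => -[*]; split.
    by case: ro2 => [a1 a2 a3 a4 [a5 a6 a7]]; split.
  by move: ht1 ht2; rewrite /phis /=; lia.
- move=> t' s' _ [x' [y' [r' [_ _ _ [_ ro' _ ht']]]]] /=.
  by have := total_le (ro_size ro'); rewrite /M; ok.
- move=> t3 s3 F3 [x3 [y3 [r3 [ex3 ey3 ei3 [su3 ro3 W3 ht3]]]]] /=; rewrite ex3 ey3 => xy.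
  have ne : x3 != y3 by apply: contraTneq xy => ->; rewrite PeanoNat.Nat.lxor_nilpotent.
  have rest xx yy t4 s4 : t4 <= t3 + 40 -> xx < yy -> walk r r3 i (X i) (Y i) xx yy ->
      vr s4 vx = xx -> vr s4 vy = yy -> vr s4 vi = i -> setup s4 -> rows r3 s4 ->
      phis s4 = phis s3 ->
    wp (ve <-- aPE![vx] *' (vk +' #1) ;; vc <-- Out ve +' #1 ;;
    Wr ve vc ;; Wr (ve +' vc) vi ;;
    If (Teq vc vk) (St aUNM (aMS![vx]) (Bin Bxor (aUNM![aMS![vx]]) (aBM![vx]))) Skip ;;
    vz <-- aPAR![vx] ;; c_find ;; vx <-- vz) I t4 s4.
    move=> ht4 lt W ex4 ey4 ei4 su4 ro4 eph.
    have [hx [sx next]] := @walk_step _ _ _ _ _ _ _ (par xx) hx0 hy0 W lt.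
    have {}next x' := (@walk_step _ _ _ _ _ _ _ x' hx0 hy0 W lt).2.2.
    have hp := hpar hx; have hpn : par xx < n by lia.
    have pe := pek _ hx; have xn : xx < n by lia.
    have oun : PE xx * k.+1 + k.+1 <= OS.
      apply: leq_trans OSE; rewrite -mulSnr; apply: leq_mul => //; exact: PE_lt.
    step; first by rewrite ex4 (su_pe su4) // (su_k su4) addn1; ok.
    rewrite ex4 (su_pe su4) // (su_k su4) addn1 => _ ->.
    step; rewrite (ro_cnt ro4) //; first by ok.
    rewrite addn1 => _ ->.
    step=> _ _ -> ->.
    step; rewrite ei4 => _ _ -> ->.
    have R c hc := rows_out i ro4 hx sx (c := c) hc.
    have tot := total_add r3 i hx.
    have fin t5 s5 : t5 <= t4 + 160 -> setup s5 -> vr s5 vx = xx -> vr s5 vy = yy -> vr s5 vi = i ->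
       ou s5 = ou (wro (wro s4 (PE xx * k.+1) (size (r3 xx)).+1) (PE xx * k.+1 + (size (r3 xx)).+1) i) ->
       unmasks s5 (full (add r3 xx i)) -> uf (full (add r3 xx i)) s5 -> phis s5 = phis s4 ->
       wp (vz <-- aPAR![vx] ;; c_find ;; vx <-- vz) I t5 s5.
      move=> ht5 su5 ex5 ey5 ei5 eo um5 uf5 eph5.
      step; rewrite ex5 (su_par su5) // => _ ->.
      apply: wp_seq; apply: (FW (add r3 xx i) _ _ _ _ _ hpn).
      - by [].
      - by case: (su_sc su5); split.
      - exact: um5.
      - by case: uf5; split.
      move=> t6 s6 F6 u6 x6n x6f c6 ht6.
      have su6 : setup s6 by apply: (setup_find F6); case: su5 => -[*]; split.
      have [F6v F6a F6o] := F6.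
      step=> x7 ex7; rewrite -ex7 in x6n x6f c6.
      exists x7, yy, (add r3 xx i); split=> //=.
        by rewrite (F6v vy isT).
        by rewrite (F6v vi isT).
      split=> //.
      - by case: su6 => -[*]; split.
      - split=> /=.
        + move=> c hc; rewrite /add; case: eqP => [->|_]; last exact: (ro_size ro4).
          by rewrite size_rcons.
        + by move=> c hc; rewrite (F6o isT) /= eo; have [] := R c hc.
        + by move=> c j hc hj; rewrite (F6o isT) /= eo; have [_] := R c hc; apply.
        + by rewrite /unmasks (F6a aUNM isT).
        + by case: u6; split.
      - exact: next.
      - by move: ht6; rewrite tot /phis /= in eph eph5 ht3 *; rewrite eph5 eph; lia.
    have uf4 : uf (full (add r3 xx i)) s4.
      by apply: uf_sub (ro_uf ro4) => c; rewrite full_add // => ->.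
    apply: wp_seq; step; rewrite /= (su_k su4) => ek.
      step; rewrite ex4 (sc_ms (su_sc su4)) // => _ _ -> ->.
      apply: fin => //=; first by rewrite /ct /=; lia.
      + by case: su4 => -[*]; split.
      + by apply: (mask_step _ su4 ro4) => //= g; rewrite ek; case: eqP.
      + by case: uf4; split.
    step; apply: fin => //=; first by rewrite /ct /=; lia.
    + by case: su4 => -[*]; split.
    + by apply: (mask_step _ su4 ro4) => //= g; rewrite (negbTE ek).
    + by case: uf4; split.
  apply: wp_seq; step; rewrite ex3 ey3 => hlt.
    step=> _ ->; step=> _ ->; step=> _ ->.
    apply: (rest y3 x3) => //=; first by rewrite /ct /=; lia.
    + exact: walk_sym.
    + by case: su3 => -[*]; split.
    + by case: ro3 => [a1 a2 a3 a4 [a5 a6 a7]]; split.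
  step; apply: (rest x3 y3) => //=; first by rewrite /ct /=; lia.
  by rewrite ltn_neqAle ne leqNgt.
- move=> t3 s3 F3 [x3 [y3 [r3 [ex3 ey3 ei3 [su3 ro3 W3 ht3]]]]] /=; rewrite ex3 ey3 => xy F.
  have e : x3 = y3 by apply: PeanoNat.Nat.lxor_eq; lia.
  rewrite -e in W3; apply: (HQ _ _ r3) => //.
    by move=> c hc; apply: walk_end W3 hc.
  by rewrite /ct /=; lia.
Qed.

Definition lightest ord j c := take k [seq i <- take j ord | on c (X i) (Y i)].

Lemma step_lightest ord j c : j < size ord ->
  step_rows (lightest ord j) (nth 0 ord j) c = lightest ord j.+1 c.
Proof.
move=> hj; rewrite /step_rows /lightest (take_nth 0) // filter_rcons.
set l := [seq i <- _ | _]; case: (ltnP (size (take k l)) k) => h /=.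
  have sl : size l < k by move: h; rewrite size_take_min; lia.
  rewrite (take_oversize (ltnW sl)); case: ifP => _; rewrite take_oversize //; last exact: ltnW.
  by rewrite size_rcons.
have sl : k <= size l by move: h; rewrite size_take_min; lia.
by case: ifP => // _; rewrite -cats1 takel_cat.
Qed.

Lemma main_wp (Q : nat -> st -> Prop) t s ord :
  setup s -> perm_eq ord (iota 0 p) -> (forall j, j < p -> ar s aSRT j = nth 0 ord j) ->
  (forall c, c < n.-1 -> PE c * k.+1 + k.+1 <= n * k.+1) ->
  (forall x, x < p -> inp (2 * n + 1 + x * 3) < n /\ inp (2 * n + 1 + x * 3 + 1) < n) ->
  rows (fun=> [::]) s ->
  (forall t' s', frame c_main s s' -> rows (lightest ord p) s' ->
    t' <= t + 400 * phis s + 1000 * (n * k) + 2100 * p + 100 -> Q t' s') ->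
  wp c_main Q t s.
Proof.
move=> su po eS pek hin ro HQ; have B1 := BN1 N2 BN.
have so : size ord = p by rewrite (perm_size po) size_iota.
apply: wp_framed; rewrite {1}/c_main; step=> _ ->.
have eq_rows r r' s' : (forall c, c < n.-1 -> r c = r' c) -> rows r s' -> rows r' s'.
  move=> e [h1 h2 h3 h4 h5].
  have ef c : full r c = full r' c by rewrite /full; case: (ltnP c n.-1) => // /e->.
  split=> [c hc|c hc|c j hc|j hj|]; rewrite -?e //; [exact: h1|exact: h2|exact: h3| |].
    by rewrite -ef; apply: h4.
  by apply: uf_sub h5 => c; rewrite ef.
pose I t' s' := exists j, [/\ vr s' vj = j, j <= p, setup s', rows (lightest ord j) s' &
  t' + 400 * phis s' <= t + 400 * phis s + 10 + 2050 * j + 1000 * total (lightest ord j)].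
set M := t + 400 * phis s + 10 + 2050 * p + 1000 * (n * k).
apply: (@wp_while _ _ _ _ _ _ I M).
- exists 0; split=> //=.
  + by case: su => -[*]; split.
  + apply: eq_rows (_ : rows (fun=> [::]) _).
      by move=> c _; rewrite /lightest take0.
    by case: ro => [a1 a2 a3 a4 [a5 a6 a7]]; split.
  + by rewrite /phis /=; lia.
- move=> t' s' _ [j [ej hj _ ro' ht]] /=.
  by have := total_le (ro_size ro'); rewrite /M; ok.
- move=> t' s' [Fv Fa _] [j [ej hj su' ro' ht]] /=; rewrite ej (su_p su') => jp.
  have ip : nth 0 ord j < p.
    have : nth 0 ord j \in ord by rewrite mem_nth ?so.
    by rewrite (perm_mem po) mem_iota.
  have ei : ar s' aSRT (vr s' vj) = nth 0 ord j by rewrite ej (Fa aSRT isT) /= eS.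
  apply: wp_seq; apply: (path_wp ei ip su' ro' pek) => //.
  + move=> t2 s2 r2 F2 su2 ro2 er ht2; have [F2v _ _] := F2.
    have ej2 : vr s2 vj = j by rewrite (F2v vj isT).
    step; rewrite ej2 => _ ->; exists j.+1; split=> //=; rewrite ?addn1 //.
    * by case: su2 => -[*]; split.
    * apply: (eq_rows r2); last by case: ro2 => [a1 a2 a3 a4 [a5 a6 a7]]; split.
      by move=> c hc; rewrite er // step_lightest // so.
    * have <- : total r2 = total (lightest ord j.+1).
        by apply: eq_bigr => -[c hc] _ /=; rewrite er // step_lightest // so.
      by rewrite /phis /ct /= in ht ht2 *; lia.
- move=> t' s' _ [j [ej hj su' ro' ht]] /=; rewrite ej (su_p su') => jp F.
  have e : j = p by lia.
  rewrite e in ro' ht; apply: HQ => //.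
  by have := total_le (ro_size ro'); rewrite /ct /=; lia.
Qed.

End Paths.

Lemma frame_ar c s s' j : frame c s s' -> j \notin ma c -> ar s' j = ar s j.
Proof. by case=> _ h _; apply: h. Qed.

Lemma frame_vr c s s' x : frame c s s' -> x \notin mv c -> vr s' x = vr s x.
Proof. by case=> h _ _; apply: h. Qed.

Lemma frame_ou c s s' : frame c s s' -> ~~ mo c -> ou s' = ou s.
Proof. by case=> _ _ h; apply: h. Qed.

Ltac back :=
  repeat match goal with
  | F : frame _ _ ?s' |- context [ar ?s' ?j] => rewrite (@frame_ar _ _ _ j F isT)
  | F : frame _ _ ?s' |- context [vr ?s' ?x] => rewrite (@frame_vr _ _ _ x F isT)
  | F : frame _ _ ?s' |- context [ou ?s'] => rewrite (@frame_ou _ _ _ F isT)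
  end.

(** * The whole algorithm *)

Section Whole.

Variables (B L OS : nat) (inp : nat -> nat) (n p k C N : nat).
Hypothesis n0 : 0 < n.
Hypothesis k0 : 0 < k.
Hypothesis NE : n + p + k + C <= N.
Hypothesis N2 : 2 <= N.
Hypothesis BN : 16 * (N * N) + 64 <= B.
Hypothesis LE : L = 2 * n + 1 + 3 * p.
Hypothesis OSE : OS = n * k.+1.

Variables (ea eb P dep pe u v wt : nat -> nat).
Hypothesis rt : rooted n ea eb P dep pe.
Hypothesis inp_ea : forall i, i < n.-1 -> inp (i + i + 3) = ea i.
Hypothesis inp_eb : forall i, i < n.-1 -> inp (i + i + 4) = eb i.
Hypothesis inp_u : forall i, i < p -> inp (2 * n + 1 + i * 3) = u i.
Hypothesis inp_v : forall i, i < p -> inp (2 * n + 1 + i * 3 + 1) = v i.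
Hypothesis inp_w : forall i, i < p -> inp (2 * n + 1 + i * 3 + 2) = wt i.
Hypothesis u_lt : forall i, i < p -> u i < n.
Hypothesis v_lt : forall i, i < p -> v i < n.
Hypothesis wtC : forall i, i < p -> wt i <= C.

Definition start : st :=
  Mk (fun x => nth 0 [:: n; p; k] x) (fun _ _ => 0) (fun _ => 0).

(* The two sides of an edge [e] are told apart by [f]. *)
Definition answer (s : st) := exists ord,
  [/\ perm_eq ord (iota 0 p), pairwise (fun i j => wt i <= wt j) ord &
  forall e, e < n.-1 -> exists f : nat -> bool,
    (forall i, i < n.-1 -> (f (ea i) == f (eb i)) = (i != e)) /\
    let l := take k [seq i <- ord | f (u i) != f (v i)] in
    ou s (e * k.+1) = size l /\
    forall j, j < size l -> ou s (e * k.+1 + j.+1) = nth 0 l j].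

(** Each of the at most [n / b] elements contributes at most [log n <= 2 * b + 1 <= 3 * b]. *)
Lemma phi_le b LAB SZ els : 0 < b -> n < 2 ^ (b + b).+2 -> size els * b <= n ->
  phi n els LAB SZ <= 3 * n.
Proof.
move=> b0 nb sb.
have lb : trunc_log 2 n <= 3 * b.
  rewrite -ltnS; have h : 2 ^ trunc_log 2 n < 2 ^ (b + b).+2.
    by apply: leq_ltn_trans nb; apply: trunc_logP.
  by rewrite ltn_exp2l // in h; lia.
apply: leq_trans (_ : size els * (3 * b) <= _); last by lia.
rewrite /phi -sum1_size big_distrl /=; apply: leq_sum => g _; lia.
Qed.

(** Double counting: these microsets have at least [b] members each, and a vertex belongs to only
    one microset. *)
Lemma els_size b par GRP CL hd : grouped n b par GRP CL hd -> size (els n CL) * b <= n.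
Proof.
move=> gr; rewrite -sum1_size big_distrl /=.
apply: (@leq_trans (\sum_(g <- els n CL) cnt hd n g)).
  rewrite big_seq [X in _ <= X]big_seq; apply: leq_sum => g.
  by rewrite mem_els mul1n => /andP[/eqP h1 h2]; apply: (gr_big gr).
rewrite /cnt exchange_big /=; apply: leq_trans (_ : \sum_(j < n) 1 <= _); last first.
  by rewrite sum_nat_const card_ord muln1.
apply: leq_sum => j _.
rewrite -(size_filter_sum (els n CL) (fun g => hd j == g)).
have uf : uniq [seq g <- els n CL | hd j == g] by rewrite filter_uniq ?uniq_els.
apply: (@uniq_leq_size _ _ [:: hd j]) => // g.
by rewrite mem_filter inE eq_sym => /andP[].
Qed.

Lemma algorithm_wp :
  wp B L OS inp algorithm (fun t s => t <= 4900 * (n * k + p + C) /\ answer s) 0 start.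
Proof.
have nN : n <= N by lia.
have NE' : n + p + k <= N by lia.
have Ln : 2 * n + 1 <= L by lia.
have Lp : 2 * n + 1 + 3 * p <= L by lia.
rewrite /algorithm; apply: wp_seq.
apply: (degrees_wp _ n0 k0 NE' N2 BN rt Ln inp_ea inp_eb) => //= t1 s1 F1 D1 D2 D3 T1.
apply: wp_seq; apply: (leaves_wp _ _ _ n0 k0 NE' N2 BN rt) => //; first by back.
move=> t2 s2 F2 [hP hlt hpos hord hpos0] T2.
set pos := ar s2 aPOS in hlt hpos hord hpos0; set od := ar s2 aORD in hpos hord.
apply: wp_seq; apply: (rename_wp _ _ _ n0 k0 NE' N2 BN).
- by back.
- by move=> j /hord[]; rewrite -/od; lia.
move=> t3 s3 F3 hren T3.
(* The tree in the new numbering, in which [n.-1] is the root; [od] inverts [pos] away from the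
   root. *)
pose par j := pos (P (od j)); pose PEf j := pe (od j).
have pos_lt x : x < n -> pos x < n.
  by case: (posnP x) => [->|x0 xn]; [rewrite hpos0; lia | have [] := hpos x; lia].
have od_pos c : c < n.-1 -> 0 < od c < n /\ pos (od c) = c by apply: hord.
have hpar j : j < n.-1 -> j < par j < n.
  move=> hj; have [h1 h2] := od_pos j hj; have := hlt _ h1; rewrite h2 /par => ->.
  by apply: pos_lt; apply: (rt_par rt).
have ePAR j : j < n.-1 -> ar s3 aPAR j = par j.
  move=> hj; have [h1 _] := od_pos j hj.
  by have [-> _] := hren j hj; rewrite -/od -/pos; have [-> _] := hP _ h1.
have ePE j : j < n.-1 -> ar s3 aPE j = PEf j.
  move=> hj; have [h1 _] := od_pos j hj.
  by have [_ ->] := hren j hj; rewrite -/od; have [_ ->] := hP _ h1.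
apply: wp_seq; apply: (buckets_wp _ n0 k0 NE N2 BN Lp inp_w wtC).
- by back.
- by back.
- by move=> x; back.
move=> t4 s4 F4 eW mw1 mw2 ch T4.
apply: wp_seq; apply: (sort_wp _ _ n0 k0 NE N2 BN Lp mw1 mw2 ch).
move=> t5 s5 ord F5 po pw eS T5.
apply: wp_seq; apply: (log_wp _ _ _ n0 nN N2 BN).
- by back.
- by move=> x; back.
move=> t6 s6 b F6 eb6 b0 bn nb lg T6.
have bn3 : b <= n + 3.
  by apply: leq_trans bn; apply: leq_trans (ltnW (ltn_expl _ (ltnSn 1))); lia.
apply: wp_seq; apply: (groups_wp _ _ _ n0 nN N2 BN b0 bn3 hpar) => //.
- by back.
- by move=> j hj; back; apply: ePAR.
- by move=> x; back.
- by move=> x; back.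
move=> t7 s7 hd F7 gr T7.
apply: wp_seq; apply: (micro_wp _ _ _ n0 nN N2 BN b0 bn hpar gr) => //.
- by back.
- by back.
- by move=> j hj; back; apply: ePAR.
- by move=> x; back.
move=> t8 s8 F8 mi T8.
have PE_lt c : c < n.-1 -> PEf c < n.-1.
  by move=> hc; have [h _] := od_pos c hc; apply: (rt_pe rt).
have PE_inj c d : c < n.-1 -> d < n.-1 -> PEf c = PEf d -> c = d.
  move=> hc hd' e; have [h1 e1] := od_pos c hc; have [h2 e2] := od_pos d hd'.
  by rewrite -e1 -e2 (rt_inj rt h1 h2 e).
pose X i := pos (u i); pose Y i := pos (v i).
have X_lt i : i < p -> X i < n by move=> h; apply: pos_lt; apply: u_lt.
have Y_lt i : i < p -> Y i < n by move=> h; apply: pos_lt; apply: v_lt.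
have OSE' : n.-1 * k.+1 <= OS by rewrite OSE leq_mul //; lia.
have grpE g : g \in els n (ar s7 aCL) -> exists j,
    [/\ j < n.-1, ar s7 aCL (ar s7 aGRP j) = 1 & ar s7 aGRP j = g].
  rewrite mem_els => /andP[/eqP cl hg].
  have : 0 < cnt hd n g by apply: leq_trans (gr_big gr hg cl).
  rewrite lt0n /cnt sum_nat_eq0 negb_forall => /existsP[[j hj]] /=.
  rewrite eqb0 negbK => /eqP e.
  have [i [h1 _ h3 h4]] := hd_top hpar gr hj; exists i; rewrite h4 e; split=> //.
  case: (ltnP i n.-1) => // h; have [r1 _] := gr_root gr.
  have ie : i = n.-1 by lia.
  by rewrite ie r1 e in h4; lia.
have sc : static n b par (ar s7 aGRP) (ar s7 aCL) hd s8.
  split.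
  - by back.
  - by move=> j hj; apply: (mi_ms mi).
  - by move=> j hj; apply: (mi_tbl mi).
  - by move=> j x hj; apply: (mi_anc mi).
  - by move=> i hi; back; apply: lg.
  - by move=> j hj cl; have hj' : 0 <= j < n.-1 by []; have [] := mi_grp mi hj' cl.
have su : setup inp n p k b par (ar s7 aGRP) (ar s7 aCL) hd PEf X Y s8.
  split=> //.
  - by move=> j hj; back; apply: ePAR.
  - by move=> j hj; back; apply: ePE.
  - by move=> j hj; apply: (mi_bm mi).
  - by back.
  - by back.
  - by back.
  - by move=> i hi; rewrite inp_u //; back.
  - by move=> i hi; rewrite inp_v //; back.
have nofull : forall c, full n k (fun=> [::]) c = false.
  by move=> c; rewrite /full /= eq_sym (gtn_eqF k0) andbF.
have ro : rows n k par (ar s7 aCL) hd PEf (fun=> [::]) s8.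
  split=> //.
  - by move=> c hc; back.
  - by move=> j hj; rewrite nofull; apply: (mi_unm mi).
  have lab g : g \in els n (ar s7 aCL) -> [/\ ar s8 aLAB g = g, ar s8 aTOP g = g,
      ar s8 aHD g = g.+1 & ar s8 aSZ g = 1].
    case/grpE => j [hj cl <-]; have hj' : 0 <= j < n.-1 by [].
    by have [_ h1 h2 [h3 h4]] := mi_grp mi hj' cl.
  split=> g hg; have [h1 h2 h3 h4] := lab g hg.
  - by rewrite h1 h2.
  - by rewrite h1 h2; apply: cov_refl.
  - exists [:: g]; rewrite h1; split=> //=; first by split=> //; back.
    move=> h; rewrite inE; case he : (h \in _); first by have [-> _ _ _] := lab h he.
    by apply: contraFF he => /eqP->.
apply: (main_wp n0 k0 NE' N2 BN b0 bn hpar OSE' Lp gr PE_lt PE_inj X_lt Y_lt su po) => //.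
- by move=> j hj; back; apply: eS.
- by move=> c /PE_lt hc; rewrite -mulSnr leq_mul //; lia.
- by move=> i hi; rewrite inp_u // inp_v //; split; [apply: u_lt | apply: v_lt].
move=> t9 s9 F9 R9 T9; split.
  have ph : phis n (ar s7 aCL) s8 <= 3 * n by apply: (phi_le _ _ b0 nb (els_size gr)).
  have nk : n <= n * k by rewrite leq_pmulr.
  by move: T1 T2 T3 T4 T5 T6 T7 T8 T9; clear -ph nk n0 k0; lia.
exists ord; split=> // e he.
have [x hx ex] := rt_sur rt he.
have [px ox] := hpos x hx; set c := pos x in px ox.
(* One side of [e] is the subtree below it, tested in the new numbering. *)
exists (fun z => anc n par c (pos z)); split.
  move=> i hi; have [y hy ey] := rt_sur rt hi.
  have [py oy] := hpos y hy.
  have yn : pos y < n by lia.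
  have E : (anc n par c (pos y) == anc n par c (pos (P y))) = (i != e).
    have eP : par (pos y) = pos (P y) by rewrite /par oy.
    have hp := hpar _ py.
    rewrite (ancE hpar) // py eP /=; case: (eqVneq c (pos y)) => [ec|ne] /=.
      have xy : x = y by rewrite -ox -oy ec.
      rewrite -ey -ex xy eqxx; apply/negbTE; apply/negP => /eqP/esym h.
      by have := anc_le hpar _ h; rewrite -eP; lia.
    rewrite eqxx; apply/esym; apply: contra ne => /eqP ie.
    by rewrite /c (rt_inj rt hx hy) // ex ey.
  by have [] := rt_end rt hy; rewrite ey => -[-> ->]; rewrite // eq_sym.
have ePc : PEf c = e by rewrite /PEf ox.
have so : size ord = p by rewrite (perm_size po) size_iota.
have tk : take p ord = ord by rewrite take_oversize ?so.
have := ro_cnt R9 px; have H j := @ro_nth _ _ _ _ _ _ _ _ R9 c j px.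
by rewrite /lightest tk ePc in H *.
Qed.

End Whole.

(** * The program *)

(* Loads [n], [p] and [k] into the registers of the first three variables, and
   the base addresses of the output and of the working memory into 0 and 1. *)
Definition prelude : program :=
  [:: Const 2 0; Read 3 2; Const 2 1; Read 5 2; Const 2 2; Read 7 2;
      Op Badd 0 3 3; Const 2 1; Op Badd 0 0 2; Const 2 3; Op Bmul 2 2 5; Op Badd 0 0 2;
      Const 2 1; Op Badd 2 7 2; Op Bmul 2 3 2; Op Badd 1 0 2].

Definition with_prelude (c : cmd) : program := prelude ++ compile 16 c.

#[local] Arguments run : simpl never.

Lemma prelude_ok w code input n p k : let m := nth 0 input in
  m 0 = n -> m 1 = p -> m 2 = k -> 2 < 2 ^ w -> n + n + 1 + 3 * p + n * (k + 1) + 3 < 2 ^ w ->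
  n < 2 ^ w -> p < 2 ^ w -> k + 1 < 2 ^ w ->
  exists r, [/\ run w (prelude ++ code) 16 (init input) = State 16 r m,
    r 0 = 2 * n + 1 + 3 * p, r 1 = 2 * n + 1 + 3 * p + n * k.+1 &
    forall x, r (vreg x) = nth 0 [:: n; p; k] x].
Proof.
move=> m m0 m1 m2 w2 big nw pw kw.
have e x : x < 2 ^ w -> x %% 2 ^ w = x by apply: modn_small.
rewrite /init; set A := prelude ++ code.
have go j r m' t' : j < 16 -> run w A t'.+1 (State j r m') =
    run w A t' (exec w (nth (Jmp 0) prelude j) (State j r m')).
  move=> hj; apply: runS; do 16? [case: j hj => [//|j] hj].
  by [].
have up f a x b : upd f a x b = if b == a then x else f b by [].
have e3 : 3 %% 2 ^ w = 3 by apply: e; lia.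
have e2 : 2 %% 2 ^ w = 2 by apply: e; lia.
have e1 : 1 %% 2 ^ w = 1 by apply: e; lia.
have e0 : 0 %% 2 ^ w = 0 by apply: e; lia.
do 15! rewrite go // [exec _ _ _]/= ?up /= ?e0 ?e1 ?e2 ?e3 -?/(m _) ?m0 ?m1 ?m2.
rewrite go // [exec _ _ _]/= ?up /=.
rewrite (e (n + n)); last lia.
rewrite (e (n + n + 1)); last lia.
rewrite (e (3 * p)); last lia.
rewrite (e (k + 1)); last lia.
rewrite (e (n * (k + 1))); last lia.
rewrite (e (n + n + 1 + 3 * p)); last lia.
rewrite e; last lia.
eexists; split; first reflexivity.
- by rewrite !up /=; lia.
- by rewrite !up /=; lia.
- case=> [|[|[|x]]]; rewrite /vreg !up //=.
  by rewrite !ifN ?nth_nil //; lia.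
Qed.

Lemma with_prelude_ok w c B n p k input t s : 2 ^ w = 64 * B -> (exists m, B = 2 ^ m) ->
  2 * n + 1 + 3 * p + n * k.+1 + 4 <= 32 * B -> n < B -> p < B -> k < B ->
  nth 0 input 0 = n -> nth 0 input 1 = p -> nth 0 input 2 = k ->
  size input = 2 * n + 1 + 3 * p -> (forall i, nth 0 input i < B) ->
  bs B (size input) (n * k.+1) (nth 0 input) c (start n p k) t s ->
  exists s', [/\ run w (with_prelude c) (16 + t) (init input) = s',
    halted (with_prelude c) s', reg s' 0 = size input &
    forall i, i < n * k.+1 -> ram s' (size input + i) = ou s i].
Proof.
move=> wB Be hB nB pB kB e0 e1 e2 sz iB hbs.
have [|||||r [er r0 r1 rV]] := @prelude_ok w (compile 16 c) input n p k e0 e1 e2; try lia.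
have R0 : represents B (size input) (n * k.+1) (nth 0 input) (size input + n * k.+1) (start n p k) r (nth 0 input).
  split; [exact: rV | by rewrite sz | by rewrite sz | split=> [j i _ _|i _|]].
  - by rewrite nth_default //; lia.
  - by rewrite nth_default //; lia.
  - by [].
have W0 : wf B (start n p k).
  split=> [x|j i|i] /=; try lia.
  by case: x => [|[|[|x]]] /=; rewrite ?nth_nil; lia.
have CA : code_at (with_prelude c) 16 (compile 16 c).
  by move=> i hi.
have DB : size input + n * k.+1 <= 32 * B by lia.
have [r' [m' [eR [Rx R00 _ [_ Ro _]]]]] := compile_ok wB Be erefl DB iB hbs W0 R0 CA.
exists (State (16 + csize c) r' m'); split; [by rewrite runD er | | exact: R00 | exact: Ro].
by rewrite /halted /with_prelude size_cat size_compile leqnn.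
Qed.

(** * Layout of the encoded input *)

Section Layout.

Variables (A : Type) (f g h : A -> nat).

Lemma nth_pairs (s : seq A) i :
  nth 0 (flatten [seq [:: f x; g x] | x <- s]) (i + i) = nth 0 (map f s) i /\
  nth 0 (flatten [seq [:: f x; g x] | x <- s]) (i + i).+1 = nth 0 (map g s) i.
Proof.
elim: s i => [|x s IH] [|i] /=; rewrite ?nth_nil //.
by rewrite ?addSn ?addnS /=; apply: IH.
Qed.

Lemma size_pairs (s : seq A) : size (flatten [seq [:: f x; g x] | x <- s]) = 2 * size s.
Proof. by elim: s => //= x s ->; lia. Qed.

Lemma nth_triples (s : seq A) i :
  let l := flatten [seq [:: f x; g x; h x] | x <- s] in
  [/\ nth 0 l (i * 3) = nth 0 (map f s) i, nth 0 l (i * 3).+1 = nth 0 (map g s) i &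
      nth 0 l (i * 3).+2 = nth 0 (map h s) i].
Proof.
by elim: s i => [|x s IH] [|i] /=; rewrite ?nth_nil.
Qed.

Lemma size_triples (s : seq A) : size (flatten [seq [:: f x; g x; h x] | x <- s]) = 3 * size s.
Proof. by elim: s => //= x s ->; lia. Qed.

End Layout.

(** Filtering keeps the order by weight, so whatever is cut off by [take k] is at least as heavy as
    all that is kept. *)
Lemma take_lightest (p k : nat) (wt : 'I_p -> nat) (wN : nat -> nat) (S : pred nat) ord :
  (forall i : 'I_p, wN i = wt i) ->
  perm_eq ord (iota 0 p) -> pairwise (fun i j => wN i <= wN j) ord ->
  exists l : seq 'I_p, take k [seq i <- ord | S i] = [seq val i | i <- l] /\
    k_lightest wt k [set i : 'I_p | S i] l.
Proof.
move=> ew po pw.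
have uo : uniq ord by rewrite (perm_uniq po) iota_uniq.
set t := [seq i <- ord | S i].
have lt_p i : i \in ord -> i < p by rewrite (perm_mem po) mem_iota.
have mt i : (i \in t) = (i < p) && S i.
  by rewrite mem_filter (perm_mem po) mem_iota /= andbC.
pose l : seq 'I_p := pmap insub t.
have vl : [seq val i | i <- l] = t.
  rewrite /l pmap_filter; last by move=> i; rewrite insubK.
  by apply/all_filterP/allP => i; rewrite mt isSome_insub => /andP[].
have ut : uniq t by rewrite filter_uniq.
have ul : uniq l by rewrite -(map_inj_uniq val_inj) vl.
have ml i : (i \in l) = S i by rewrite -(mem_map val_inj) vl mt ltn_ord.
exists (take k l); rewrite map_take vl; split=> //; split.
- exact: take_uniq.
- by move=> i /mem_take; rewrite ml inE.
- rewrite size_take_min; congr minn; rewrite -(card_uniqP ul).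
  by apply: eq_card => i; rewrite ml inE.
move=> i j hi hj nj.
have jl : j \in l by rewrite ml; rewrite inE in hj.
have : pairwise (fun i j => wt i <= wt j) l.
  have := subseq_pairwise (filter_subseq S ord) pw; rewrite -/t -vl pairwise_map.
  by apply: sub_pairwise => a c; rewrite /relpre /= !ew.
rewrite -(cat_take_drop k l) pairwise_cat => /andP[/allrelP H _].
by apply: H => //; move: jl; rewrite -{1}(cat_take_drop k l) mem_cat (negbTE nj).
Qed.

Theorem theorem4p3 :
  exists (A : program) (c K : nat), 0 < c /\
    forall (n : nat) (T : seq ('I_n * 'I_n))
      (p : nat) (u v : 'I_p -> 'I_n) (P : 'I_p -> seq 'I_n)
      (wt : 'I_p -> nat) (C k w : nat),
      is_tree T ->
      (forall i : 'I_p, simple_path T (u i) (v i) (P i)) ->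
      (forall i : 'I_p, wt i <= C) ->
      0 < k ->
      (n + p + k + C) ^ c <= 2 ^ w ->
      exists (t : nat) (s : state),
        [/\ t <= K * (n * k + p + C),
            run w A t (init (encode T u v wt k)) = s,
            halted A s &
            forall (e : 'I_(size T)),
              exists l : seq 'I_p,
                output_row k s e = [seq val i | i <- l] /\
                k_lightest wt k
                  [set i | traverses (u i) (P i) (tnth (in_tuple T) e)] l].
Proof.
(* For [N >= 2], [N ^ 16] exceeds [64 * (16 * N ^ 2 + 64)], which is enough for the values and the
   six address bits. The constant 5000 is 4900 for the algorithm with room for the 16 steps of the
   prelude. *)
exists (with_prelude algorithm), 16, 5000; split=> // n T p u v P wt C k w treeT paths wtC k0 hw.
have n0 : 0 < n by case: treeT.
set N := n + p + k + C in hw.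
have N2 : 2 <= N by rewrite /N; lia.
have [sT [Pn [dep [pe rt]]]] := tree_rooted treeT.
have w16 : 16 <= w by rewrite -(@leq_exp2l 2) //; apply: leq_trans hw; rewrite leq_exp2r.
pose B := 2 ^ (w - 6).
have wB : 2 ^ w = 64 * B.
  have e : w = 6 + (w - 6) by rewrite subnKC // (leq_trans _ w16).
  by rewrite {1}e expnD.
have BN : 16 * (N * N) + 64 <= B.
  have p6 : 64 <= N ^ 6 by rewrite -[64]/(2 ^ 6) leq_exp2r.
  have p5 : 32 <= N ^ 5 by rewrite -[32]/(2 ^ 5) leq_exp2r.
  have pX : 4 <= N * N by apply: (@leq_mul 2 2).
  have e : N ^ 16 = N ^ 6 * (N ^ 5 * (N * N)) * N ^ 3 by rewrite mulnn -!expnD.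
  rewrite -(@leq_pmul2l 64) // -wB; apply: leq_trans hw; rewrite e.
  apply: leq_trans (leq_pmulr _ _); last by rewrite expn_gt0; case: (N) N2.
  apply: leq_mul => //; apply: (@leq_trans (32 * (N * N))); first by lia.
  by rewrite leq_mul.
have wBe : exists m, B = 2 ^ m by exists (w - 6).
have NN : n + p + k + C <= N by [].
clear hw w16; clearbody B N.
have B1 := BN1 N2 BN.
set L := 2 * n + 1 + 3 * p; set OS := n * k.+1.
have DB : L + OS <= 32 * B.
  have : OS <= N * N by apply: leq_mul; lia.
  rewrite /L; lia.
set input := encode T u v wt k.
pose inp := nth 0 input.
pose uN i := nth 0 [seq val (u x) | x <- enum 'I_p] i.
pose vN i := nth 0 [seq val (v x) | x <- enum 'I_p] i.
pose wN i := nth 0 [seq wt x | x <- enum 'I_p] i.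
pose ea := nth 0 [seq val e.1 | e <- T]; pose eb := nth 0 [seq val e.2 | e <- T].
have sz : size input = L.
  by rewrite /input /encode /= !size_cat size_pairs size_triples size_enum_ord sT /L; lia.
have inpE i : inp (i + i + 3) = nth 0 (flatten [seq [:: val e.1; val e.2] | e <- T] ++
    flatten [seq [:: val (u x); val (v x); wt x] | x <- enum 'I_p]) (i + i).
  by rewrite /inp addn3.
have inp_ea i : i < n.-1 -> inp (i + i + 3) = ea i.
  move=> hi; rewrite inpE nth_cat size_pairs ifT; last by rewrite sT; lia.
  by have [] := nth_pairs (fun e => val e.1) (fun e => val e.2) T i.
have inp_eb i : i < n.-1 -> inp (i + i + 4) = eb i.
  move=> hi; rewrite /inp !addnS addn0 /= nth_cat size_pairs ifT; last by rewrite sT; lia.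
  by have [] := nth_pairs (fun e => val e.1) (fun e => val e.2) T i.
have inpT i d : d < 3 -> inp (2 * n + 1 + i * 3 + d) =
    nth 0 (flatten [seq [:: val (u x); val (v x); wt x] | x <- enum 'I_p]) (i * 3 + d).
  move=> hd; rewrite /inp /input /encode.
  have -> : 2 * n + 1 + i * 3 + d = (2 * n.-1 + (i * 3 + d)).+3 by lia.
  rewrite /= nth_cat size_pairs sT ifN; last by lia.
  by rewrite addKn.
have T3 i := nth_triples (fun x => val (u x)) (fun x => val (v x)) wt (enum 'I_p) i.
have inp_u i : i < p -> inp (2 * n + 1 + i * 3) = uN i.
  by move=> hi; rewrite -[_ + _]addn0 inpT // addn0; have [] := T3 i.
have inp_v i : i < p -> inp (2 * n + 1 + i * 3 + 1) = vN i.
  by move=> hi; rewrite inpT // addn1; have [] := T3 i.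
have inp_w i : i < p -> inp (2 * n + 1 + i * 3 + 2) = wN i.
  by move=> hi; rewrite inpT // addn2; have [] := T3 i.
have unE (i : 'I_p) : uN i = u i.
  by rewrite /uN (nth_map i) ?size_enum_ord // nth_ord_enum.
have vnE (i : 'I_p) : vN i = v i.
  by rewrite /vN (nth_map i) ?size_enum_ord // nth_ord_enum.
have wnE (i : 'I_p) : wN i = wt i.
  by rewrite /wN (nth_map i) ?size_enum_ord // nth_ord_enum.
have u_lt i : i < p -> uN i < n by move=> hi; rewrite (unE (Ordinal hi)).
have v_lt i : i < p -> vN i < n by move=> hi; rewrite (vnE (Ordinal hi)).
have w_le i : i < p -> wN i <= C by move=> hi; rewrite (wnE (Ordinal hi)).
have [t [s [hbs [ht [ord [po pw ans]]]]]] :=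
  algorithm_wp n0 k0 NN N2 BN erefl erefl rt inp_ea inp_eb inp_u inp_v inp_w u_lt v_lt w_le.
have OSN : OS <= N * N by apply: leq_mul; lia.
have NB x : x <= N -> x < B by lia.
have inpB i : inp i < B.
  case: (ltnP i (size input)) => hi; last by rewrite /inp nth_default // NB.
  have /allP : all (fun x => x < B) input; last by apply; apply: mem_nth.
  rewrite /input /encode /= !NB ?all_cat /=; try lia.
  apply/andP; split; apply/allP => x /flatten_mapP[y _]; rewrite !inE.
    by case/orP => /eqP->; apply: NB; apply: leq_trans (ltnW (ltn_ord _)) _; lia.
  case/or3P => /eqP->; apply: NB.
  - by apply: leq_trans (ltnW (ltn_ord (u y))) _; lia.
  - by apply: leq_trans (ltnW (ltn_ord (v y))) _; lia.
  - by apply: leq_trans (wtC y) _; lia.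
have hbs' : bs B (size input) (n * k.+1) inp algorithm (start n p k) t s by rewrite sz.
have hB : 2 * n + 1 + 3 * p + n * k.+1 + 4 <= 32 * B by rewrite -/OS; lia.
have [|||s' [er hs R00 Ro]] :=
  with_prelude_ok wB wBe hB _ _ _ (erefl : nth 0 input 0 = n) (erefl : nth 0 input 1 = p)
    (erefl : nth 0 input 2 = k) sz inpB hbs'; try by (apply: NB; lia).
rewrite sz in R00 Ro.
exists (16 + t), s'; split; [ | exact: er | exact: hs | ].
  have : 0 < n * k by rewrite muln_gt0 n0.
  lia.
move=> e; have he : e < n.-1 by rewrite -sT.
have [f [fs [l0 ln]]] := ans _ he.
have [l [el kl]] := take_lightest k (fun i => f (uN i) != f (vN i)) wnE po pw.
exists l; split.
  have sk : size (take k [seq i <- ord | f (uN i) != f (vN i)]) <= k by rewrite size_take_min geq_minl.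
  have eOS x : x <= k -> e * k.+1 + x < OS.
    move=> hx; apply: (@leq_trans (e.+1 * k.+1)); first by rewrite mulSn; lia.
    by apply: leq_mul => //; lia.
  rewrite -el /output_row /= R00 Ro; last by rewrite -[_ * _]addn0; apply: eOS.
  rewrite l0 -[RHS](mkseq_nth 0) /mkseq; apply/eq_in_map => j; rewrite mem_iota => /= hj.
  rewrite -addnA Ro ?ln //; apply: eOS; exact: leq_trans hj sk.
suff -> : [set i | traverses (u i) (P i) (tnth (in_tuple T) e)] =
          [set i : 'I_p | f (uN i) != f (vN i)] by [].
apply/setP => i; rewrite !inE unE vnE.
have eaE j (hj : j < size T) : (ea j = (tnth (in_tuple T) (Ordinal hj)).1) *
    (eb j = (tnth (in_tuple T) (Ordinal hj)).2).
  by split; rewrite (tnth_nth (tnth (in_tuple T) e)) /ea /eb (nth_map (tnth (in_tuple T) e)).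
have {}fs j : j < n.-1 -> (f (ea j) == f (eb j)) = (j != e) by apply: fs.
apply: (traverses_sides (T := T) (f := fun x : 'I_n => f x) _ _ (paths i)).
  move=> d dT de; have hj : index d T < size T by rewrite index_mem.
  have := fs (index d T); rewrite -sT => /(_ hj); rewrite !(eaE _ hj).
  have -> : tnth (in_tuple T) (Ordinal hj) = d by rewrite (tnth_nth d) /= nth_index.
  have -> : index d T != e.
    by apply: contra de => /eqP ie; rewrite (tnth_nth d) /= -ie nth_index.
  by move/eqP.
have := fs e he; rewrite eqxx !(eaE _ (ltn_ord e)).
have -> : Ordinal (ltn_ord e) = e by apply: val_inj.
by move=> /= ->.
Qed.
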